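(* Consider the stationary Sampled Moran Genealogy Process with population size $n$, event rate $\mu$, and sampling times $t_1<t_2<\cdots$. Let $k\ge1$, let $\mathbf{G}_k$ be the observed genealogy of the first $k$ samples, and write $\mathrm{live}(\mathbf{G}_k)=\{e_1,\dots,e_q\}$ with $e_1<\dots<e_q$. Then, for real $a$, \[ -\log\Pr(A_{k+1}<a\mid\mathbf{G}_k)=\int_a^\infty\frac{\ell_k(t)}{\binom n2}\mu\,dt+\sum_{\{j:\,a\le e_j\}}\log\frac{n-\ell_k(e_j)}{n-\ell_k(e_j)-1}, \] \[ -\log\Pr(A_{k+1}\le a\mid\mathbf{G}_k)=\int_a^\infty\frac{\ell_k(t)}{\binom n2}\mu\,dt+\sum_{\{j:\,a< e_j\}}\log\frac{n-\ell_k(e_j)}{n-\ell_k(e_j)-1}, \] \[ -\log\Pr(A_{k+1}=a\mid\mathbf{G}_k)=\begin{cases}\log(n-\ell_k(a))-\log\Pr(A_{k+1}\le a), & a\in\mathrm{live}(\mathbf{G}_k),\\ 0,& a\notin\mathrm{live}(\mathbf{G}_k).\end{cases} \] Moreover, the conditional distribution of $A_{k+1}$ given $\mathbf{G}_k$ is \[ f_{A_{k+1}\mid\mathbf{G}_k}(a)\,da=\Pr(A_{k+1}\le a\mid\mathbf{G}_k)\left(\mu\frac{\ell_k(a)}{\binom n2}\,da+\frac{\mathbf 1\{a\in\mathrm{live}(\mathbf{G}_k)\}}{n-\ell_k(a)}\,dn\right), \] where $da$ is Lebesgue measure and $dn$ counting measure on $\mathbb{R}$.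
   Context: Fix an integer $n\ge2$, $\mu>0$ and deterministic sampling times $t_1<t_2<\cdots$. A population of constant size $n$ evolves under Moran dynamics: events occur at rate $\mu$; at each, an ordered pair of distinct individuals is chosen uniformly at random, the first dies and the second gives birth to one offspring. Stationary: the population has evolved under these dynamics from the infinite past (the genealogy of the population at some time before $t_1$ is drawn from the stationary distribution of the genealogy process). At each time $t_i$ one living individual, chosen uniformly at random, is sampled (sampling does not alter the population). Each individual has a unique ancestral lineage going back in time. The observed genealogy $\mathbf{G}_k$ is the genealogy (tree with times) formed by the ancestral lineages of samples $1,\dots,k$, sample $i$'s lineage traced back from $t_i$. For $j\ge2$, the attachment time $A_j$ (with realized value $a_j$, $a_j\le t_{j-1}$) is the most recent time $s$ at which the ancestor at time $s$ of sample $j$ coincides with the ancestor-or-self at time $s$ of some sample $i<j$ with $t_i\ge s$; almost surely either $a_j=t_i$ for some $i<j$ (direct descent: sample $j$ descends from sample $i$ itself) or $a_j$ is not a sample time (a branch point). Sample $i\le k$ is dead in $\mathbf{G}_k$ if $a_j=t_i$ for some $j$ with $i<j\le k$, and live otherwise; $\mathrm{live}(\mathbf{G}_k)$ is the set of sample times of live samples. The branch points of $\mathbf{G}_k$ are the $a_j$, $2\le j\le k$, that are not sample times. The lineage-count function is $\ell_k(t)=|\{e\in\mathrm{live}(\mathbf{G}_k):e>t\}|-|\{\text{branch points }b\text{ of }\mathbf{G}_k: b>t\}|$ (right-continuous; the number of lineages of $\mathbf{G}_k$ at time $t$).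
   Formalization: For a not in live(G_k) the third formula is corrected to Pr(A_{k+1}=a|G_k)=0 (printed ''−log Pr = 0'' would mean probability 1); Pr(A_{k+1}≤a) there is read as conditional on G_k, and the −log identities are stated in exponentiated form so that zero factors make sense. *)

(* Defs.v *)
From HB Require Import structures.
From mathcomp Require Import all_boot all_order all_algebra.
From mathcomp Require Import all_classical all_reals all_analysis.
Set Implicit Arguments. Unset Strict Implicit. Unset Printing Implicit Defensive.
Import Order.TTheory GRing.Theory Num.Theory.
Local Open Scope classical_set_scope.
Local Open Scope ring_scope.

(* The Moran genealogy driven by a two-sided marked Poisson process.   *)
(* Slots 'I_n hold the n individuals.  An event is a pair             *)
(* (time, (d, p)): slot d's occupant dies and is replaced by an       *)
(* offspring of the occupant of slot p (d <> p).                      *)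

Definition fwd_time (R : realType) (T : Type) (X : nat -> T -> R) (w : T) (m : nat) : R :=
  \sum_(i < m.+1) X i w.
Definition bwd_time (R : realType) (T : Type) (Y : nat -> T -> R) (w : T) (m : nat) : R :=
  - \sum_(i < m.+1) Y i w.

Definition events (R : realType) (T : Type) (n : nat) (X Y : nat -> T -> R)
    (Mf Mb : nat -> T -> 'I_n * 'I_n) (w : T) : set (R * ('I_n * 'I_n)) :=
  [set (fwd_time X w m, Mf m w) | m in [set: nat]] `|`
  [set (bwd_time Y w m, Mb m w) | m in [set: nat]].

Definition lin_step (R : realType) (n : nat) (y : 'I_n) (e : R * ('I_n * 'I_n)) : 'I_n :=
  if y == e.2.1 then e.2.2 else y.

(* anc Ev x u s y : the ancestor at time s (s <= u) of the individual in slot x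
   at time u occupies slot y at time s.  Obtained by tracing back through all the
   events with time in (s, u], in decreasing time order (the state is
   right-continuous: an event at time s has already happened at time s). *)
Definition anc (R : realType) (n : nat) (Ev : set (R * ('I_n * 'I_n)))
    (x : 'I_n) (u s : R) (y : 'I_n) : Prop :=
  exists l : seq (R * ('I_n * 'I_n)),
    (forall e, e \in l <-> (Ev e /\ s < e.1 <= u)) /\
    sorted (fun e1 e2 : R * ('I_n * 'I_n) => e2.1 < e1.1) l /\
    y = foldl (@lin_step R n) x l.

Definition meet (R : realType) (n : nat) (Ev : set (R * ('I_n * 'I_n)))
    (S : nat -> 'I_n) (t : nat -> R) (i j : nat) (s : R) : Prop :=
  s <= t i /\ s <= t j /\ exists y, anc Ev (S i) (t i) s y /\ anc Ev (S j) (t j) s y.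

Definition coal (R : realType) (n : nat) (Ev : set (R * ('I_n * 'I_n)))
    (S : nat -> 'I_n) (t : nat -> R) (i j : nat) : R :=
  sup [set s | meet Ev S t i j s].

Definition attach (R : realType) (n : nat) (Ev : set (R * ('I_n * 'I_n)))
    (S : nat -> 'I_n) (t : nat -> R) (j : nat) : R :=
  sup [set s | exists i, (1 <= i < j)%N /\ meet Ev S t i j s].

Definition gen_events (R : realType) (d : measure_display) (T : measurableType d)
    (n : nat) (X Y : nat -> T -> R) (Mf Mb : nat -> T -> 'I_n * 'I_n)
    (S : nat -> T -> 'I_n) (c : 'I_5 * nat) : set (set T) :=
  match nat_of_ord c.1 with
  | 0 => [set E | exists B : set R, measurable B /\ E = X c.2 @^-1` B]
  | 1 => [set E | exists B : set R, measurable B /\ E = Y c.2 @^-1` B]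
  | 2 => [set E | exists B : set ('I_n * 'I_n), E = Mf c.2 @^-1` B]
  | 3 => [set E | exists B : set ('I_n * 'I_n), E = Mb c.2 @^-1` B]
  | _ => [set E | exists B : set 'I_n, E = S c.2 @^-1` B]
  end.

Definition mutually_independent (R : realType) (d : measure_display) (T : measurableType d)
    (P : probability T R) (I : eqType) (F : I -> set (set T)) : Prop :=
  forall (J : seq I) (E : I -> set T), uniq J -> (forall i, i \in J -> F i (E i)) ->
    P (\big[setI/setT]_(i <- J) E i) = (\big[*%E/1%E]_(i <- J) P (E i))%E.

(* The sampled Moran genealogy process: events at rate mu on the whole real line
   (two-sided homogeneous Poisson process: i.i.d. Exp(mu) gaps on both sides of 0),
   each event marked by a uniformly random ordered pair (d, p) of distinct slots,
   sample i taken at time t i from a uniformly random slot S i; all independent. *)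
Definition moran_model (R : realType) (d : measure_display) (T : measurableType d)
    (P : probability T R) (n : nat) (mu : R) (X Y : nat -> T -> R)
    (Mf Mb : nat -> T -> 'I_n * 'I_n) (S : nat -> T -> 'I_n) : Prop :=
  (forall m, measurable_fun setT (X m) /\ measurable_fun setT (Y m)) /\
      (forall m (B : set ('I_n * 'I_n)), measurable (Mf m @^-1` B) /\ measurable (Mb m @^-1` B)) /\
      (forall m (B : set 'I_n), measurable (S m @^-1` B)) /\
      (forall m x, 0 <= x ->
          P [set w | x < X m w] = (expR (- (mu * x)))%:E /\
          P [set w | x < Y m w] = (expR (- (mu * x)))%:E) /\
      (forall m, P [set w | X m w < 0] = 0%E /\ P [set w | Y m w < 0] = 0%E) /\
      (forall m (dp : 'I_n * 'I_n),
          P [set w | Mf m w = dp] = (if dp.1 != dp.2 then ((n * n.-1)%:R)^-1 else 0)%:E /\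
          P [set w | Mb m w = dp] = (if dp.1 != dp.2 then ((n * n.-1)%:R)^-1 else 0)%:E) /\
      (forall m (x : 'I_n), P [set w | S m w = x] = (n%:R^-1)%:E) /\
      mutually_independent P (gen_events X Y Mf Mb S).

(* The sigma-algebra generated by the observed genealogy G_k.  The genealogy
   (timed tree spanned by the lineages of the sample-labelled samples 1..k)
   is encoded by the pairwise coalescence times coal i j, 1 <= i < j <= k. *)
Definition sigmaG (R : realType) (d : measure_display) (T : measurableType d)
    (n : nat) (X Y : nat -> T -> R) (Mf Mb : nat -> T -> 'I_n * 'I_n)
    (S : nat -> T -> 'I_n) (t : nat -> R) (k : nat) : set (set T) :=
  <<s [set E | exists i j (B : set R), [/\ (1 <= i)%N, (i < j <= k)%N, measurable B &
        E = (fun w => coal (events X Y Mf Mb w) (S^~ w) t i j) @^-1` B]] >>.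

Definition cond_prob_is (R : realType) (d : measure_display) (T : measurableType d)
    (P : probability T R) (G : set (set T)) (H : set T) (F : T -> \bar R) : Prop :=
  forall E, G E -> P (H `&` E) = (\int[P]_(w in E) F w)%E.

Definition liveb (R : realType) (t : nat -> R) (k : nat) (Av : nat -> R) (i : nat) : bool :=
  (1 <= i <= k)%N && [forall j : 'I_k.+1, ~~ ((i < j)%N && (Av j == t i))].

Definition is_branch (R : realType) (t : nat -> R) (Av : nat -> R) (j : nat) : bool :=
  `[< ~ exists m, (1 <= m)%N /\ t m = Av j >].

Definition ell (R : realType) (t : nat -> R) (k : nat) (Av : nat -> R) (x : R) : R :=
  (\sum_(1 <= i < k.+1) nat_of_bool (liveb t k Av i && (x < t i)%R))%N%:R
  - (\sum_(2 <= j < k.+1) nat_of_bool (is_branch t Av j && (x < Av j)%R))%N%:R.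

Definition hazard_int (R : realType) (n : nat) (mu : R) (t : nat -> R) (k : nat)
    (Av : nat -> R) (a : R) : \bar R :=
  ((mu / ('C(n, 2))%:R)%:E *
     \int[lebesgue_measure]_(x in [set x : R | (a <= x)%R]) (ell t k Av x)%:E)%E.

Definition cdf_formula (R : realType) (n : nat) (mu : R) (t : nat -> R) (k : nat)
    (Av : nat -> R) (a : R) (sel : R -> bool) : \bar R :=
  (expeR (- hazard_int n mu t k Av a) *
   (\prod_(1 <= i < k.+1 | liveb t k Av i && sel (t i))
      ((n%:R - ell t k Av (t i) - 1) / (n%:R - ell t k Av (t i))))%:E)%E.

Definition F_lt (R : realType) (n : nat) (mu : R) (t : nat -> R) (k : nat)
    (Av : nat -> R) (a : R) : \bar R :=
  cdf_formula n mu t k Av a (fun e => a <= e).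

Definition F_le (R : realType) (n : nat) (mu : R) (t : nat -> R) (k : nat)
    (Av : nat -> R) (a : R) : \bar R :=
  cdf_formula n mu t k Av a (fun e => a < e).

Definition F_eq (R : realType) (n : nat) (mu : R) (t : nat -> R) (k : nat)
    (Av : nat -> R) (a : R) : \bar R :=
  if `[< exists i, liveb t k Av i /\ t i = a >]
  then (F_le n mu t k Av a * ((n%:R - ell t k Av a)^-1)%:E)%E
  else 0%E.

Definition cond_law (R : realType) (n : nat) (mu : R) (t : nat -> R) (k : nat)
    (Av : nat -> R) (B : set R) : \bar R :=
  (\int[lebesgue_measure]_(a in B)
      (F_le n mu t k Av a * (mu * ell t k Av a / ('C(n, 2))%:R)%:E)
   + \sum_(1 <= i < k.+1 | liveb t k Av i && `[< B (t i) >])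
      (F_le n mu t k Av (t i) * ((n%:R - ell t k Av (t i))^-1)%:E))%E.

(* Main.v *)
(** Cut the time axis, read backwards from above the last sample, into short
    windows whose end points include all the deterministic times of interest.
    Up to an error of the order of the mesh, each window contains at most one
    event, so that the lineages of the samples become a Markov chain on slots
    with an explicit law.  In this chain the lineage of sample [k+1] sits at a
    uniformly random slot which is independent of the others, given that it has
    not yet met one of them: this symmetry is preserved by a step backwards, a
    step costs the factor [1 - 2 th * (number of lineages)] when no event
    occurs, and a newly met sample [i] costs [(n - l - 1) / (n - l)] if it is
    live and [1] if it is dead.  Letting the mesh go to [0], the probability of
    [A_(k+1) < a] together with finitely many constraints [c <= coal i j]
    becomes the expectation of the explicit survival function on these
    constraints.  The constraints form a pi-system generating [sigmaG], so
    Dynkin's lemma gives the conditional survival function.  For almost every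
    path, the fundamental theorem of calculus between consecutive break points,
    together with the jumps at the live samples, shows that [cond_law] is the
    probability measure with this survival function, and a second use of
    Dynkin's lemma gives all Borel sets. *)
Require Import Defs.
From HB Require Import structures.
From mathcomp Require Import all_boot all_order all_algebra all_fingroup.
From mathcomp Require Import ring lra zify.
Set Implicit Arguments. Unset Strict Implicit. Unset Printing Implicit Defensive.
Import Order.TTheory GRing.Theory Num.Theory.
Local Open Scope ring_scope.

Section FiniteModel.
Variables (R : realFieldType) (n k : nat).
Notation mark := ('I_n * 'I_n)%type.
Notation slots := {ffun 'I_k.+1 -> 'I_n}.

Definition lin (o : option mark) (y : 'I_n) : 'I_n :=
  if o is Some e then (if y == e.1 then e.2 else y) else y.

Definition stp (pr : pred 'I_k.+1) (o : option mark) (x : slots) : slots :=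
  [ffun i => if pr i then lin o (x i) else x i].

Definition occ (pr : pred 'I_k.+1) (x : slots) : {set 'I_n} :=
  [set y | [exists i, pr i && (x i == y)]].

Definition agree (pr : pred 'I_k.+1) (x x' : slots) : bool :=
  [forall i, pr i ==> (x' i == x i)].

Definition absum (pr : pred 'I_k.+1) (V : slots -> R) (x : slots) : R :=
  \sum_(x' | agree pr x x') V x'.

Definition relabel (a b : 'I_n) (x : slots) : slots := [ffun i => tperm a b (x i)].

Definition upd (x : slots) (i : 'I_k.+1) (z : 'I_n) : slots :=
  [ffun j => if j == i then z else x j].

Definition local (pr : pred 'I_k.+1) (D : slots -> R) : Prop :=
  forall x x', agree pr x x' -> D x' = D x.
Definition symmetric_fun (D : slots -> R) : Prop :=
  forall a b x, D (relabel a b x) = D x.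

Implicit Types (pr : pred 'I_k.+1) (x : slots) (o : option mark) (V D : slots -> R).

Lemma agreeP pr x x' : reflect (forall i, pr i -> x' i = x i) (agree pr x x').
Proof.
apply: (iffP forallP) => h i; first by move=> pi; have := h i; rewrite pi /= => /eqP.
by apply/implyP => pi; rewrite h.
Qed.

Lemma occP pr x y : reflect (exists2 i, pr i & x i = y) (y \in occ pr x).
Proof.
rewrite inE; apply: (iffP existsP) => [[i /andP[pi /eqP xi]]|[i pi xi]]; exists i => //.
by rewrite pi xi eqxx.
Qed.

Lemma occ_agree pr x x' : agree pr x x' -> occ pr x' = occ pr x.
Proof.
move=> /agreeP h; apply/setP => y; apply/occP/occP => -[i pi xi]; exists i => //.
  by rewrite -h. by rewrite h.
Qed.

Lemma card_occ pr x : (#|occ pr x| <= k.+1)%N.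
Proof.
rewrite -[X in (_ <= X)%N]card_ord; apply: leq_trans (leq_imset_card x predT).
by apply/subset_leq_card/subsetP => y /occP[i _ <-]; exact: imset_f.
Qed.

Lemma absum_local pr V : local pr (absum pr V).
Proof.
move=> x x' /agreeP h; apply: eq_bigl => x2.
by apply/agreeP/agreeP => h2 i pi; rewrite h2 ?h.
Qed.

Lemma relabelK a b : involutive (relabel a b).
Proof. by move=> x; apply/ffunP => i; rewrite !ffunE tpermK. Qed.

Lemma agree_relabel pr a b x x' : agree pr (relabel a b x) (relabel a b x') = agree pr x x'.
Proof.
apply/agreeP/agreeP => h i pi; have := h i pi; rewrite !ffunE; first by move/perm_inj.
by move=> ->.
Qed.

Lemma absum_sym pr V : symmetric_fun V -> symmetric_fun (absum pr V).
Proof.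
move=> sV a b x; rewrite /absum (reindex_inj (inv_inj (relabelK a b))) /=.
by apply: eq_big => [x'|x' _]; [exact: agree_relabel|exact: sV].
Qed.

Lemma absum_stp pr o V x : absum pr (fun x' => V (stp pr o x')) x = absum pr V (stp pr o x).
Proof.
pose back (x'' : slots) : slots := [ffun i => if pr i then x i else x'' i].
rewrite /absum [RHS](reindex_onto (stp pr o) back) /=; last first.
  move=> x' /agreeP h; apply/ffunP => i.
  by have [pi|/negbTE pi] := boolP (pr i); rewrite !ffunE pi // h // ffunE pi.
apply: eq_bigl => x'; apply/idP/andP => [/agreeP h|[/agreeP h1 /eqP h2]]; last first.
  by apply/agreeP => i pi; rewrite -h2 ffunE pi.
split; first by apply/agreeP => i pi; rewrite !ffunE pi h.
apply/eqP/ffunP => i; rewrite ffunE; case: ifP => [pi|pi]; first by rewrite h.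
by rewrite ffunE pi.
Qed.

Lemma absum_split pr pr' i V x : ~~ pr i -> (forall j, pr' j = (j == i) || pr j) ->
  absum pr V x = \sum_z absum pr' V (upd x i z).
Proof.
move=> pi h; rewrite /absum (partition_big (fun x' : slots => x' i) predT) //=.
apply: eq_bigr => z _; apply: eq_bigl => x'.
apply/andP/agreeP => [[/agreeP h1 /eqP h2] j|h1].
  by rewrite h ffunE; case: eqP => [-> //|_ /= pj]; rewrite h1.
split; last by have := h1 i; rewrite h eqxx ffunE eqxx => ->.
apply/agreeP => j pj; have := h1 j; rewrite h pj orbT ffunE => -> //.
by case: eqP => // ji; move: pi; rewrite -ji pj.
Qed.

Lemma eq_absum pr pr' V x : pr =1 pr' -> absum pr V x = absum pr' V x.
Proof. by move=> h; apply: eq_bigl => x'; apply: eq_forallb => i; rewrite h. Qed.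

Definition Q (q0 th : R) (o : option mark) : R :=
  if o is Some e then (if e.1 != e.2 then q0 * th else 0) else q0.

Lemma sum_option (A : finType) (F : option A -> R) :
  \sum_o F o = F None + \sum_a F (Some a).
Proof.
rewrite (bigD1 None) //=; congr (_ + _).
rewrite (@reindex_omap _ _ _ _ _ Some id) /=; last by case.
by apply: eq_bigl => a; rewrite eqxx.
Qed.

Lemma lin_relabel a b e y :
  lin (Some e) (tperm a b y) = tperm a b (lin (Some (tperm a b e.1, tperm a b e.2)) y).
Proof.
rewrite /lin /= -(inj_eq (@perm_inj _ (tperm a b)) y) tpermK.
by case: ifP => _ //; rewrite tpermK.
Qed.

Definition conj_mark (a b : 'I_n) (o : option mark) : option mark :=
  if o is Some e then Some (tperm a b e.1, tperm a b e.2) else None.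

Lemma conj_markK a b : involutive (conj_mark a b).
Proof. by case=> [[d p]|] //=; rewrite !tpermK. Qed.

Lemma stp_relabel pr o a b x :
  stp pr o (relabel a b x) = relabel a b (stp pr (conj_mark a b o) x).
Proof.
apply/ffunP => i; rewrite !ffunE; case: ifP => // _.
by case: o => [e|] //; rewrite lin_relabel.
Qed.

Lemma Q_conj q0 th a b o : Q q0 th (conj_mark a b o) = Q q0 th o.
Proof. by case: o => [e|] //=; rewrite (inj_eq perm_inj). Qed.

Lemma occ_relabel pr a b x : occ pr (relabel a b x) = tperm a b @: occ pr x.
Proof.
apply/setP => y; apply/occP/imsetP => [[i pi]|[z /occP[i pi <-] ->]].
  by rewrite ffunE => <-; exists (x i) => //; apply/occP; exists i.
by exists i => //; rewrite ffunE.
Qed.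

Lemma card_occ_relabel pr a b x : #|occ pr (relabel a b x)| = #|occ pr x|.
Proof. by rewrite occ_relabel card_imset //; exact: perm_inj. Qed.

Lemma mem_occ_relabel pr a b x y : (tperm a b y \in occ pr (relabel a b x)) = (y \in occ pr x).
Proof. by rewrite occ_relabel mem_imset //; exact: perm_inj. Qed.

(* Marks that attach a free lineage at [y]: those sending [y] into an occupied
   slot, and those sending an occupied slot to [y]. There are [2 #|occ|] of them,
   and each one moves [x] by a relabelling at most. *)
Lemma killed_window pr q0 th D x y : y \notin occ pr x ->
  local pr D -> symmetric_fun D ->
  \sum_o Q q0 th o * ((lin o y \notin occ pr (stp pr o x))%:R * D (stp pr o x)) =
  \sum_o Q q0 th o * ((if o is None then 1 - 2 * th * #|occ pr x|%:R else 1) * D (stp pr o x)).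
Proof.
move=> yx lD sD; rewrite !sum_option /=.
have stpN : stp pr None x = x by apply/ffunP => i; rewrite ffunE; case: ifP.
rewrite stpN yx mul1r.
pose kill (e : mark) := ((e.1 == y) && (e.2 \in occ pr x)) || ((e.2 == y) && (e.1 \in occ pr x)).
have occN e : kill e = false -> e.1 != e.2 -> lin (Some e) y \notin occ pr (stp pr (Some e) x).
  move=> ke de; apply/negP => /occP[i pi]; rewrite ffunE pi /lin.
  have xio : x i \in occ pr x by apply/occP; exists i.
  case: (eqVneq (x i) e.1) => [xi|xi]; case: (eqVneq y e.1) => [ye|ye].
  - by move: yx; rewrite ye -xi xio.
  - by move=> e2y; move: ke; rewrite /kill e2y eqxx -xi xio /= orbT.
  - by move=> xie; move: ke; rewrite /kill -xie xio -ye eqxx.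
  - by move=> xiy; move: yx; rewrite -xiy xio.
have killD e : kill e -> e.1 != e.2 /\ lin (Some e) y \in occ pr (stp pr (Some e) x) /\
    D (stp pr (Some e) x) = D x.
  case: e => d p; rewrite /kill /= => /orP[/andP[/eqP -> po]|/andP[/eqP -> dof]].
  - have yp : y != p by apply: contraNneq yx => ->.
    have sx : agree pr x (stp pr (Some (y, p)) x).
      apply/agreeP => i pi; rewrite ffunE pi /lin /=; case: eqP => // xi.
      by move: yx; rewrite -xi; case/occP; exists i.
    split=> //; split; last exact: lD.
    by rewrite /= eqxx (occ_agree sx).
  - have dy : d != y by apply: contraNneq yx => <-.
    have sx : agree pr (relabel d y x) (stp pr (Some (d, y)) x).
      apply/agreeP => i pi; rewrite !ffunE pi /lin /=; case: eqP => [->|/eqP xid]; first by rewrite tpermL.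
      by rewrite tpermD // eq_sym //; apply: contraNneq yx => <-; apply/occP; exists i.
    split=> //; split; last by rewrite (lD _ _ sx) sD.
    rewrite /lin /= eq_sym (negbTE dy); case/occP: dof => i pi xi.
    by apply/occP; exists i => //; rewrite ffunE pi /lin xi /= eqxx.
rewrite [in LHS](bigID kill) [in RHS](bigID kill) /=.
rewrite [X in _ + (X + _)]big1 ?add0r; last first.
  by move=> e /killD[de [-> _]]; rewrite mul0r mulr0.
have -> : \sum_(e | ~~ kill e) Q q0 th (Some e) * ((lin (Some e) y \notin occ pr (stp pr (Some e) x))%:R * D (stp pr (Some e) x)) =
          \sum_(e | ~~ kill e) Q q0 th (Some e) * (1 * D (stp pr (Some e) x)).
  apply: eq_bigr => e /negbTE ke; rewrite /Q; case: ifP => de; last by rewrite !mul0r.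
  by rewrite occN.
have -> : \sum_(e | kill e) Q q0 th (Some e) * (1 * D (stp pr (Some e) x)) =
          (2 * #|occ pr x|)%N%:R * (q0 * th * D x).
  rewrite (eq_bigr (fun=> q0 * th * D x)); last first.
    by move=> e /killD[de [_ ->]]; rewrite /Q de mul1r.
  rewrite sumr_const -[LHS]mulr_natl; congr (_%:R * _).
  rewrite (@eq_card _ _ (mem (setX [set y] (occ pr x) :|: setX (occ pr x) [set y]))); last first.
    move=> [d p]; change (kill (d, p) = ((d, p) \in setX [set y] (occ pr x) :|: setX (occ pr x) [set y])).
    by rewrite /kill in_setU !in_setX !in_set1 [(_ == y) && (_.1 \in _)]andbC.
  rewrite cardsU !cardsX !cards1 mul1n muln1.
  rewrite (_ : _ :&: _ = set0) ?cards0 ?subn0 ?mul2n ?addnn //.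
  apply/setP => -[d p]; rewrite in_setI !in_setX !in_set1 in_set0.
  apply/negbTE/negP => /andP[/andP[/eqP -> _] /andP[]].
  by rewrite (negbTE yx).
rewrite natrM; ring.
Qed.

Lemma sum_tupleS (A : finType) r (F : r.+1.-tuple A -> R) :
  \sum_s F s = \sum_a \sum_(s : r.-tuple A) F [tuple of a :: s].
Proof.
rewrite pair_big /= (reindex (fun p : A * r.-tuple A => [tuple of p.1 :: p.2])) //=.
exists (fun s => (thead s, [tuple of behead s])) => [[a s] _|s _] /=.
  by congr pair; apply/val_inj.
by case/tupleP: s => a s; apply/val_inj; rewrite /= theadE.
Qed.

Lemma sum_tuple0 (A : finType) (F : 0.-tuple A -> R) : \sum_s F s = F [tuple].
Proof. by rewrite (big_pred1 [tuple]) // => s; apply/esym/eqP; exact: tuple0. Qed.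

Lemma sum_tuple_prod (A : finType) r (f : nat -> A -> R) (a0 : A) :
  \sum_(s : r.-tuple A) \prod_(i < r) f i (nth a0 s i) = \prod_(i < r) \sum_a f i a.
Proof.
elim: r f => [|r IH] f.
  by rewrite sum_tuple0 !big_ord0.
rewrite sum_tupleS big_ord_recl mulr_suml; apply: eq_bigr => a _.
rewrite -(IH (fun i => f i.+1)) mulr_sumr; apply: eq_bigr => s _.
by rewrite big_ord_recl.
Qed.

Lemma sumQ_some c h : \sum_(e : mark) Q c h (Some e) = c * h * (n * n.-1)%:R.
Proof.
rewrite /Q -big_mkcond /= sumr_const -[LHS]mulr_natr; congr (_ * _%:R).
have := cardC [pred e : mark | e.1 == e.2]; rewrite card_prod !card_ord.
have -> : #|[pred e : mark | e.1 == e.2]| = n.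
  rewrite -[RHS]card_ord -(card_imset (f := fun i : 'I_n => (i, i))); last by move=> i j [].
  apply: eq_card => -[u v]; rewrite inE /=; apply/eqP/imsetP => [->|[i _ [-> ->]]] //.
  by exists v.
have -> : #|[predC [pred e : mark | e.1 == e.2]]| = #|[pred e : mark | e.1 != e.2]|.
  by apply: eq_card.
by case: (n) => //= l; rewrite mulnS; lia.
Qed.

Lemma sumQ c h : \sum_o Q c h o = c * (1 + h * (n * n.-1)%:R).
Proof. by rewrite sum_option sumQ_some /=; ring. Qed.

Section Words.
Variables (q0 th : nat -> R) (pr : nat -> pred 'I_k.+1) (yp act : nat -> bool).
Variable g : nat -> slots -> R.

Definition ins m x : R :=
  \prod_(i | ~~ pr m i && pr m.+1 i)
    (if x i \in occ (pr m) x then 1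
     else (n%:R - #|occ (pr m) x|%:R - 1) / (n%:R - #|occ (pr m) x|%:R)).

Definition wt m o x : R := if o is None then 1 - 2 * th m * #|occ (pr m) x|%:R else 1.

Definition ymove m o y : 'I_n := if yp m then lin o y else y.

Definition facU m x y : R :=
  (if act m then (y \notin occ (pr m.+1) x)%:R else 1) * g m.+1 x.
Definition facF m o x x' : R :=
  (if act m then wt m o x * ins m x' else 1) * g m.+1 x'.

Fixpoint VU r m x y : R := if r is r'.+1 then
    \sum_o Q (q0 m) (th m) o *
      (facU m (stp (pr m) o x) (ymove m o y) * VU r' m.+1 (stp (pr m) o x) (ymove m o y))
  else 1.
Fixpoint VF r m x : R := if r is r'.+1 then
    \sum_o Q (q0 m) (th m) o *
      (facF m o x (stp (pr m) o x) * VF r' m.+1 (stp (pr m) o x))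
  else 1.

Hypothesis g_local : forall m, local (pr m) (g m).
Hypothesis g_sym : forall m, symmetric_fun (g m).
Hypothesis act_down : forall m, act m.+1 -> act m.
Hypothesis pr_up : forall m, pr m.+1 =1 pr m \/
  exists2 i, ~~ pr m i & forall j, pr m.+1 j = (j == i) || pr m j.
Hypothesis yp_pr : forall m, yp m = false -> forall i, pr m i = false.

Lemma VU_inactive r m x y : ~~ act m -> VU r m x y = VF r m x.
Proof.
elim: r m x y => // r IH m x y am /=; apply: eq_bigr => o _; rewrite /facU /facF (negbTE am).
by rewrite IH //; apply: contra am => /act_down.
Qed.

Lemma ins_sym m : symmetric_fun (ins m).
Proof.
move=> a b x; apply: eq_bigr => i _.
by rewrite card_occ_relabel ffunE mem_occ_relabel.
Qed.

Lemma VF_sym r m : symmetric_fun (VF r m).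
Proof.
elim: r m => // r IH m a b x /=.
rewrite (reindex_inj (inv_inj (conj_markK a b))) /=; apply: eq_bigr => o _.
rewrite Q_conj stp_relabel conj_markK IH; congr (_ * (_ * _)); rewrite /facF g_sym ins_sym.
by case: (act m) => //; congr (_ * _ * _); case: o => [e|] //=; rewrite card_occ_relabel.
Qed.

Lemma absumZ p D V x : local p D -> absum p (fun x' => D x' * V x') x = D x * absum p V x.
Proof. by move=> lD; rewrite /absum mulr_sumr; apply: eq_bigr => x' /lD ->. Qed.

Lemma insertion m V (W : slots -> 'I_n -> R) x y : y \notin occ (pr m) x ->
  symmetric_fun V ->
  (forall x' y', y' \notin occ (pr m.+1) x' ->
    absum (pr m.+1) (W^~ y') x' = absum (pr m.+1) V x') ->
  absum (pr m) (fun x' => (y \notin occ (pr m.+1) x')%:R * g m.+1 x' * W x' y) x =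
  absum (pr m) (fun x' => ins m x' * g m.+1 x' * V x') x.
Proof.
move=> yx sV WV; case: (pr_up m) => [e|[i pi e]].
  have oe x' : occ (pr m.+1) x' = occ (pr m) x'.
    by apply/setP => z; rewrite !inE; apply: eq_existsb => j; rewrite e.
  have i1 x' : ins m x' = 1 by rewrite /ins big_pred0 // => j; rewrite e andNb.
  have lg : local (pr m) (g m.+1).
    by move=> x1 x2 h; apply: g_local; apply/agreeP => j; rewrite e; apply/agreeP: j.
  have -> : absum (pr m) (fun x' => (y \notin occ (pr m.+1) x')%:R * g m.+1 x' * W x' y) x =
            absum (pr m) (fun x' => g m.+1 x' * W x' y) x.
    by apply: eq_bigr => x' /occ_agree ox; rewrite oe ox yx mul1r.
  have -> : absum (pr m) (fun x' => ins m x' * g m.+1 x' * V x') x =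
            absum (pr m) (fun x' => g m.+1 x' * V x') x.
    by apply: eq_bigr => x' _; rewrite i1 mul1r.
  rewrite !absumZ // -!(eq_absum _ _ e) WV ?oe //.
rewrite !(absum_split _ _ pi e).
have occU z : occ (pr m.+1) (upd x i z) = z |: occ (pr m) x.
  apply/setP => w; rewrite in_setU1; apply/occP/orP => [[j]|].
    rewrite e ffunE; case: eqP => [_ _ ->|_ /= pj <-]; first by rewrite eqxx; left.
    by right; apply/occP; exists j.
  case=> [/eqP ->|/occP[j pj xj]]; first by exists i; rewrite ?e ?eqxx // ffunE eqxx.
  exists j; rewrite ?e ?pj ?orbT // ffunE; case: eqP => // ji.
  by move: pi; rewrite -ji pj.
have occm z x' : agree (pr m.+1) (upd x i z) x' -> occ (pr m) x' = occ (pr m) x /\ x' i = z.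
  move=> /agreeP h; split; last by rewrite h ?e ?eqxx // ffunE eqxx.
  apply: occ_agree; apply/agreeP => j pj; rewrite h ?e ?pj ?orbT // ffunE.
  by case: eqP => // ji; move: pi; rewrite -ji pj.
pose c z := g m.+1 (upd x i z) * absum (pr m.+1) V (upd x i z).
set l := #|occ (pr m) x|.
have L z : absum (pr m.+1) (fun x' => (y \notin occ (pr m.+1) x')%:R * g m.+1 x' * W x' y) (upd x i z)
     = (z != y)%:R * c z.
  rewrite absumZ; last by move=> x1 x2 h; rewrite (occ_agree h) (g_local h).
  rewrite occU in_setU1 (negbTE yx) orbF eq_sym -mulrA; case: eqP => [->|/eqP yz]; rewrite ?mul0r //.
  by rewrite WV // occU in_setU1 negb_or eq_sym yz.
have Rz z : absum (pr m.+1) (fun x' => ins m x' * g m.+1 x' * V x') (upd x i z)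
     = (if z \in occ (pr m) x then 1 else (n%:R - l%:R - 1) / (n%:R - l%:R)) * c z.
  rewrite (_ : absum _ _ _ = absum (pr m.+1) (fun x' => (if z \in occ (pr m) x then 1 else
      (n%:R - l%:R - 1) / (n%:R - l%:R)) * g m.+1 x' * V x') (upd x i z)); last first.
    apply: eq_bigr => x' /occm [o1 o2]; congr (_ * _ * _).
    rewrite /ins (big_pred1 i) ?o2 ?o1 // => j /=; rewrite e.
    by case: eqP => [->|_] /=; rewrite ?pi // andNb.
  by rewrite absumZ ?mulrA // => x1 x2 h; rewrite (g_local h).
rewrite (eq_bigr _ (fun z _ => L z)) (eq_bigr _ (fun z _ => Rz z)).
rewrite (bigID (mem (occ (pr m) x))) [in RHS](bigID (mem (occ (pr m) x))) /=; congr (_ + _).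
  by apply: eq_bigr => z zo; rewrite zo (_ : z != y) //; apply: contraNneq yx => <-.
have cz z : z \notin occ (pr m) x -> c z = c y.
  move=> zo; rewrite /c.
  have ag : agree (pr m.+1) (relabel z y (upd x i y)) (upd x i z).
    apply/agreeP => j; rewrite e !ffunE; case: eqP => [_ _|_ /= pj]; first by rewrite tpermR.
    by rewrite tpermD //; [apply: contraNneq zo|apply: contraNneq yx] => ->; apply/occP; exists j.
  by rewrite (g_local ag) g_sym (@absum_local (pr m.+1) V _ _ ag) (absum_sym _ sV).
have cardo : (#|[pred z | z \notin occ (pr m) x]| = n - l)%N.
  have h := cardC (mem (occ (pr m) x)); rewrite card_ord in h.
  by rewrite -[X in _ = (X - _)%N]h addKn.
have ln : (l < n)%N.
  rewrite ltnNge; apply: contra yx => nl.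
  suff -> : occ (pr m) x = setT by rewrite inE.
  by apply/eqP; rewrite eqEcard subsetT cardsT card_ord.
have -> : \sum_(z | z \notin occ (pr m) x) (z != y)%:R * c z = (n%:R - l%:R - 1) * c y.
  rewrite (bigD1 y) //= eqxx mul0r add0r.
  rewrite (eq_bigr (fun=> c y)); last by move=> z /andP[zo ->]; rewrite mul1r cz.
  rewrite sumr_const -[LHS]mulr_natl; congr (_ * _).
  have := cardD1 y [pred z | z \notin occ (pr m) x]; rewrite cardo inE yx add1n => cD.
  rewrite (@eq_card _ _ [predD1 [pred z | z \notin occ (pr m) x] & y]); last first.
    by move=> z; exact: andbC.
  have -> : #|[predD1 [pred z | z \notin occ (pr m) x] & y]| = (n - l).-1 by rewrite cD.
  by rewrite -subn1 !natrB //; lia.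
rewrite (eq_bigr (fun=> (n%:R - l%:R - 1) / (n%:R - l%:R) * c y)); last first.
  by move=> z zo; rewrite (negbTE zo) cz.
rewrite sumr_const cardo -[RHS]mulr_natl natrB 1?ltnW //; field.
by rewrite subr_eq0 eqr_nat gtn_eqF.
Qed.

Lemma VU_VF r m x y : y \notin occ (pr m) x ->
  absum (pr m) (VU r m ^~ y) x = absum (pr m) (VF r m) x.
Proof.
elim: r m x y => // r IH m x y yx.
have [am|am] := boolP (act m); last by apply: eq_bigr => x' _; exact: VU_inactive.
pose G y' := absum (pr m) (fun x' => (y' \notin occ (pr m.+1) x')%:R * g m.+1 x' * VU r m.+1 x' y').
pose D := absum (pr m) (fun x' => ins m x' * g m.+1 x' * VF r m.+1 x').
have GD y' x' : G y' x' = (y' \notin occ (pr m) x')%:R * D x'.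
  have [yo|yo] := boolP (y' \in occ (pr m) x'); last first.
    by rewrite mul1r; apply: insertion => //; [exact: VF_sym|move=> *; exact: IH].
  rewrite mul0r /G /absum big1 // => x2 /agreeP h.
  suff -> : y' \in occ (pr m.+1) x2 by rewrite !mul0r.
  case/occP: yo => j pj <-; apply/occP; exists j; rewrite ?h //.
  by case: (pr_up m) => [->|[i _ ->]] //; rewrite pj orbT.
have -> : absum (pr m) (VU r.+1 m ^~ y) x =
    \sum_o Q (q0 m) (th m) o * G (ymove m o y) (stp (pr m) o x).
  rewrite /absum /= exchange_big /=; apply: eq_bigr => o _.
  rewrite /G -absum_stp /absum mulr_sumr; apply: eq_bigr => x' _; rewrite /facU am; ring.
have -> : absum (pr m) (VF r.+1 m) x =
    \sum_o Q (q0 m) (th m) o * (wt m o x * D (stp (pr m) o x)).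
  rewrite /absum /= exchange_big /=; apply: eq_bigr => o _.
  rewrite /D -absum_stp /absum !mulr_sumr; apply: eq_bigr => x' ag; rewrite /facF am.
  have -> : wt m o x' = wt m o x by rewrite /wt (occ_agree ag).
  ring.
have lD : local (pr m) D by exact: absum_local.
have sD : symmetric_fun D.
  by apply: absum_sym => a b x'; rewrite ins_sym g_sym VF_sym.
under eq_bigr do rewrite GD.
rewrite /ymove; case yf: (yp m); first exact: killed_window.
have o0 x' : occ (pr m) x' = set0.
  by apply/setP => z; rewrite inE in_set0; apply/existsP => -[j]; rewrite (yp_pr yf).
by apply: eq_bigr => -[e|] _; rewrite /wt !o0 in_set0 ?cards0 ?mulr0 ?subr0.
Qed.

Lemma sum_VU_VF r : (forall i, pr 0 i = false) ->
  \sum_x \sum_y VU r 0 x y = n%:R * \sum_x VF r 0 x.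
Proof.
move=> p0; rewrite exchange_big /= mulr_natl -[X in _ *+ X](card_ord n) -sumr_const.
apply: eq_bigr => y _.
have all_ag x x' : agree (pr 0) x x' by apply/agreeP => i; rewrite p0.
pose x0 : slots := [ffun => y].
have E V : \sum_x V x = absum (pr 0) V x0 by apply: eq_bigl => x; rewrite all_ag.
rewrite !E VU_VF // inE; apply/existsP => -[i]; by rewrite p0.
Qed.

Fixpoint PhiU m (s : seq (option mark)) x y : R := if s is o :: s' then
    facU m (stp (pr m) o x) (ymove m o y) * PhiU m.+1 s' (stp (pr m) o x) (ymove m o y)
  else 1.
Fixpoint PhiF m (s : seq (option mark)) x : R := if s is o :: s' then
    facF m o x (stp (pr m) o x) * PhiF m.+1 s' (stp (pr m) o x)
  else 1.

Definition word_law m r (s : seq (option mark)) : R :=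
  \prod_(i < r) Q (q0 (m + i)%N) (th (m + i)%N) (nth None s i).

Lemma word_lawS m r o (s : r.-tuple (option mark)) :
  word_law m r.+1 [tuple of o :: s] = Q (q0 m) (th m) o * word_law m.+1 r s.
Proof.
rewrite /word_law big_ord_recl /= addn0; congr (_ * _); apply: eq_bigr => i _.
by rewrite /bump /= add1n addnS addSn.
Qed.

Lemma VU_words r m x y :
  VU r m x y = \sum_(s : r.-tuple (option mark)) word_law m r s * PhiU m s x y.
Proof.
elim: r m x y => [|r IH] m x y.
  by rewrite sum_tuple0 /word_law big_ord0 mulr1.
rewrite sum_tupleS /=; apply: eq_bigr => o _; rewrite IH !mulr_sumr; apply: eq_bigr => s _.
rewrite word_lawS /=; ring.
Qed.

Lemma VF_words r m x :
  VF r m x = \sum_(s : r.-tuple (option mark)) word_law m r s * PhiF m s x.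
Proof.
elim: r m x => [|r IH] m x.
  by rewrite sum_tuple0 /word_law big_ord0 mulr1.
rewrite sum_tupleS /=; apply: eq_bigr => o _; rewrite IH !mulr_sumr; apply: eq_bigr => s _.
rewrite word_lawS /=; ring.
Qed.

Lemma ins_bound m x : 0 <= ins m x <= 1.
Proof.
pose f i : R := if x i \in occ (pr m) x then 1
     else (n%:R - #|occ (pr m) x|%:R - 1) / (n%:R - #|occ (pr m) x|%:R).
have E i : 0 <= f i <= 1.
  rewrite /f; case: ifP => xi; first by rewrite ler01 lexx.
  have : (#|occ (pr m) x| < n)%N.
    rewrite -[X in (_ < X)%N]card_ord -cardsT; apply: proper_card; rewrite properEneq subsetT andbT.
    by apply: contraFneq xi => ->; rewrite inE.
  rewrite -(ltr_nat R) => h; have h0 : 0 < n%:R - #|occ (pr m) x|%:R :> R by rewrite subr_gt0.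
  have h1 : 1 <= n%:R - #|occ (pr m) x|%:R :> R.
    by move: h; rewrite ltr_nat => h; rewrite -natrB 1?ltnW // ler1n subn_gt0.
  apply/andP; split; first by apply: divr_ge0; [rewrite subr_ge0|exact: ltW].
  by rewrite ler_pdivrMr // mul1r gerBl.
rewrite /ins; elim/big_rec: _ => [|i z _ /andP[z0 z1]]; first by rewrite ler01 lexx.
by have /andP[a b] := E i; rewrite mulr_ge0 //= mulr_ile1.
Qed.

Lemma VF_bound (b : nat -> R) r m x :
  (forall m, 0 <= q0 m) -> (forall m, 0 <= th m) -> (forall m, 2 * th m * k.+1%:R <= 1) ->
  (forall m x, 0 <= g m x <= 1) ->
  (forall m, ~~ (act m && [exists i, pr m i]) -> q0 m * (1 + th m * (n * n.-1)%:R) <= b m) ->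
  (forall m, act m -> (exists i, pr m i) ->
     q0 m * (1 + th m * (n * n.-1)%:R) - q0 m * (2 * th m) <= b m) ->
  0 <= VF r m x <= \prod_(i < r) (b (m + i)%N).
Proof.
move=> q00 th0 th1 g01 b1 b2; elim: r m x => [|r IH] m x.
  by rewrite big_ord0 /= ler01 lexx.
rewrite big_ord_recl /= addn0.
have -> : \prod_(i < r) b (m + bump 0 i)%N = \prod_(i < r) b (m.+1 + i)%N.
  by apply: eq_bigr => i _; rewrite /bump /= add1n addnS addSn.
set B := \prod_(i < r) _.
have [IH0 IH1] : (forall x', 0 <= VF r m.+1 x') /\ (forall x', VF r m.+1 x' <= B).
  by split=> x'; have /andP[] := IH m.+1 x'.
have B0 : 0 <= B by apply: le_trans (IH0 x) (IH1 x).
have occk := card_occ (pr m) x; rewrite -(ler_nat R) in occk.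
have wt0 : 0 <= 1 - 2 * th m * #|occ (pr m) x|%:R.
  rewrite subr_ge0; apply: le_trans (th1 m); apply: ler_wpM2l => //.
  by rewrite mulr_ge0.
have fac o x' : 0 <= facF m o x x' <= if act m then wt m o x else 1.
  rewrite /facF; have /andP[g0 g1] := g01 m.+1 x'; have /andP[i0 i1] := ins_bound m x'.
  case: (act m); last by rewrite mul1r g0.
  have w0 : 0 <= wt m o x by case: o.
  rewrite !mulr_ge0 //= -mulrA; apply: ler_piMr => //; exact: mulr_ile1.
have Q0 o : 0 <= Q (q0 m) (th m) o.
  by case: o => [e|] //=; case: ifP => // _; rewrite mulr_ge0.
apply/andP; split.
  by apply: sumr_ge0 => o _; have /andP[a _] := fac o (stp (pr m) o x); apply: mulr_ge0 => //; apply: mulr_ge0.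
have H c : (forall o x', facF m o x x' <= if o is None then c else 1) ->
    q0 m * c + q0 m * th m * (n * n.-1)%:R <= b m ->
    \sum_o Q (q0 m) (th m) o * (facF m o x (stp (pr m) o x) * VF r m.+1 (stp (pr m) o x)) <= b m * B.
  move=> hc hb; apply: le_trans (ler_wpM2r B0 hb).
  rewrite -sumQ_some -[X in X + _]/(Q (q0 m) (th m) None * c) mulrDl mulr_suml sum_option.
  have L o c' : facF m o x (stp (pr m) o x) <= c' ->
    Q (q0 m) (th m) o * (facF m o x (stp (pr m) o x) * VF r m.+1 (stp (pr m) o x)) <=
    Q (q0 m) (th m) o * c' * B.
    move=> h; rewrite -mulrA; apply: ler_wpM2l => //.
    by have /andP[a _] := fac o (stp (pr m) o x); apply: ler_pM.
  apply: lerD; first exact: L (hc None _).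
  by apply: ler_sum => e _; rewrite -[X in _ <= X * _]mulr1; exact: L (hc (Some e) _).
have [/andP[am /existsP[i pi]]|na] := boolP (act m && [exists i, pr m i]).
  apply: (H (1 - 2 * th m)).
    move=> o x'; have /andP[_] := fac o x'; rewrite am => /le_trans; apply.
    case: o => [e|] //=; rewrite lerD2l lerN2 ler_peMr ?mulr_ge0 // ler1n card_gt0.
    by apply/set0Pn; exists (x i); apply/occP; exists i.
  apply: le_trans (b2 m am (ex_intro _ i pi)); rewrite le_eqVlt; apply/orP; left; apply/eqP; ring.
apply: (H 1); last by apply: le_trans (b1 m na); rewrite le_eqVlt; apply/orP; left; apply/eqP; ring.
move=> o x'; have /andP[_] := fac o x'; case am: (act m); last by case: o.
move=> /le_trans; apply; by case: o => //=; rewrite gerBl mulr_ge0 // mulr_ge0.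
Qed.

End Words.
End FiniteModel.

From mathcomp Require Import all_boot all_order all_algebra.
From mathcomp Require Import all_classical all_reals all_analysis.
From mathcomp Require Import measurable_realfun.
From mathcomp Require Import ring lra zify.
Import Order.TTheory GRing.Theory Num.Theory.
Import numFieldNormedType.Exports.
Local Open Scope classical_set_scope.
Local Open Scope ring_scope.

Section Ancestors.
Variables (R : realType) (n : nat) (Ev : set (R * ('I_n * 'I_n))).
Local Notation event := (R * ('I_n * 'I_n))%type.
Local Notation later := (fun e1 e2 : event => e2.1 < e1.1).

Definition window_list (s u : R) (l : seq event) : Prop :=
  (forall e, e \in l <-> Ev e /\ s < e.1 <= u) /\ sorted later l.
Definition locally_finite : Prop := forall s u, exists l, window_list s u l.
Definition quiet (s u : R) : Prop := forall e, Ev e -> ~~ (s < e.1 <= u).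
Definition nonevent (c : R) : Prop := forall e, Ev e -> e.1 <> c.

Lemma later_trans : transitive later.
Proof. by move=> x y z /= yx xz; exact: lt_trans xz yx. Qed.

Lemma anc_quiet x s u : quiet s u -> anc Ev x u s x.
Proof.
move=> q; exists [::]; split=> // e; split=> // -[Ee se].
by have := q e Ee; rewrite se.
Qed.

Lemma anc_trans x y z u v s : s <= v -> v <= u ->
  anc Ev x u v y -> anc Ev y v s z -> anc Ev x u s z.
Proof.
move=> sv vu [l1 [m1 [s1 ->]]] [l2 [m2 [s2 ->]]]; exists (l1 ++ l2); split; last first.
  split; last by rewrite foldl_cat.
  rewrite (sorted_pairwise later_trans) pairwise_cat -!(sorted_pairwise later_trans) s1 s2 !andbT.
  apply/allrelP => e1 e2 /m1[_ /andP[h1 _]] /m2[_ /andP[_ h2]]; exact: le_lt_trans h2 h1.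
move=> e; rewrite mem_cat; split=> [/orP[/m1[Ee /andP[a b]]|/m2[Ee /andP[a b]]]|[Ee /andP[a b]]].
- by split=> //; rewrite (le_lt_trans sv a) b.
- by split=> //; rewrite a (le_trans b vu).
- apply/orP; have [ev|ve] := leP e.1 v.
    by right; apply/m2; rewrite a ev.
  by left; apply/m1; rewrite ve b.
Qed.

Lemma anc_unique x u s y y' : anc Ev x u s y -> anc Ev x u s y' -> y = y'.
Proof.
move=> [l [m [sl ->]]] [l' [m' [sl' ->]]]; congr foldl.
apply: (irr_sorted_eq later_trans _ sl sl'); first by move=> e /=; rewrite ltxx.
by move=> e; apply/idP/idP => h; [apply/m'; apply/m|apply/m; apply/m'].
Qed.

Lemma real_gap_right s (l : seq R) : (forall r, r \in l -> s < r) ->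
  exists2 s', s < s' & forall r, r \in l -> s' < r.
Proof.
elim: l => [_|r l IH h]; first by exists (s + 1) => //; lra.
have [s' ss' h'] := IH (fun r' rl => h r' (mem_behead (s := r :: l) rl)).
have sr : s < r by apply: h; rewrite mem_head.
exists (Num.min s' ((s + r) / 2)); first by rewrite lt_min ss' /=; lra.
move=> r'; rewrite in_cons gt_min => /orP[/eqP ->|/h' ->//].
by apply/orP; right; lra.
Qed.

Lemma real_gap_left s (l : seq R) : (forall r, r \in l -> r < s) ->
  exists2 s', s' < s & forall r, r \in l -> r < s'.
Proof.
move=> h; have [] := @real_gap_right (- s) (map -%R l).
  by move=> r /mapP[r' rl ->]; rewrite ltrN2; exact: h.
move=> s' ss' h'; exists (- s'); first by rewrite ltrNl.
by move=> r rl; rewrite ltrNr; apply: h'; exact: map_f.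
Qed.

Hypothesis lf : locally_finite.

Lemma quiet_right s : exists2 s', s < s' & forall s'', s'' <= s' -> quiet s s''.
Proof.
have [l [ml _]] := lf s (s + 1).
have [|s' ss' h] := @real_gap_right s [seq e.1 | e <- l].
  by move=> r /mapP[e /ml[_ /andP[]] + _ ->].
exists (Num.min s' (s + 1)); first by rewrite lt_min ss'; lra.
move=> s''; rewrite le_min => /andP[a b] e Ee; apply/negP => /andP[c d].
have el : e \in l by apply/ml; rewrite c (le_trans d b).
have := h e.1 (map_f _ el); rewrite ltNge => /negP; apply.
exact: le_trans d a.
Qed.

Lemma quiet_left c : nonevent c -> exists2 s', s' < c & quiet s' c.
Proof.
move=> nc; have [l [ml _]] := lf (c - 1) c.
have [|s' ss' h] := @real_gap_left c [seq e.1 | e <- l].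
  move=> r /mapP[e /ml[Ee /andP[_ ec]] ->]; rewrite lt_neqAle ec andbT.
  exact/eqP/nc.
exists (Num.max s' (c - 1)); first by rewrite gt_max ss'; lra.
move=> e Ee; apply/negP; rewrite gt_max => /andP[/andP[a b] d].
have el : e \in l by apply/ml; rewrite b d.
by have := h e.1 (map_f _ el); rewrite ltNge ltW.
Qed.

Definition ancf (x : 'I_n) (u s : R) : 'I_n := xget x [set y | anc Ev x u s y].

Lemma ancfP x u s : anc Ev x u s (ancf x u s).
Proof.
have [l [ml sl]] := lf s u.
by apply: (@xgetPex _ x [set y | anc Ev x u s y]); exists (foldl (@lin_step R n) x l), l.
Qed.

Lemma ancfE x u s y : anc Ev x u s y -> ancf x u s = y.
Proof. exact: anc_unique (ancfP x u s). Qed.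

Lemma ancf_comp x u v s : s <= v -> v <= u -> ancf x u s = ancf (ancf x u v) v s.
Proof. by move=> sv vu; apply: ancfE; exact: anc_trans sv vu (ancfP _ _ _) (ancfP _ _ _). Qed.

Lemma ancf_quiet x u v s : s <= v -> v <= u -> quiet s v -> ancf x u s = ancf x u v.
Proof. by move=> sv vu q; rewrite (ancf_comp _ sv vu); apply: ancfE; exact: anc_quiet. Qed.

Lemma ancf_id x u : ancf x u u = x.
Proof. by apply: ancfE; apply: anc_quiet => e _; apply/negP => /andP[/lt_le_trans h /h]; rewrite ltxx. Qed.

End Ancestors.

Lemma sum_atmost1 (I : eqType) (r : seq I) (b : pred I) : uniq r ->
  (forall i j, i \in r -> j \in r -> b i -> b j -> i = j) ->
  (\sum_(i <- r) b i = has b r)%N.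
Proof.
elim: r => [|i r IH] /=; first by rewrite big_nil.
move=> /andP[ir ur] h; rewrite big_cons IH //; last first.
  by move=> i' j' a c; apply: h; rewrite in_cons ?a ?c orbT.
case bi: (b i) => //=; case: hasP => // -[j jr bj].
by move: ir; rewrite (h i j) ?mem_head ?in_cons ?jr ?orbT.
Qed.

Section Genealogy.
Variables (R : realType) (n : nat) (Ev : set (R * ('I_n * 'I_n))).
Variables (S : nat -> 'I_n) (t : nat -> R).
Hypothesis lf : locally_finite Ev.
Hypothesis tinc : forall i j, (1 <= i)%N -> (i < j)%N -> t i < t j.

Definition pos (i : nat) (s : R) : 'I_n := ancf Ev (S i) (t i) s.

Lemma tle i j : (1 <= i)%N -> (i <= j)%N -> t i <= t j.
Proof. by move=> i1; rewrite leq_eqVlt => /orP[/eqP -> //|ij]; exact/ltW/tinc. Qed.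

Lemma t_lt_idx i j : (1 <= i)%N -> t i < t j -> (1 <= j)%N -> (i < j)%N.
Proof. by move=> i1 tij j1; rewrite ltnNge; apply/negP => /(tle j1); rewrite leNgt tij. Qed.

Lemma t_le_idx i j : (1 <= i)%N -> t i <= t j -> (1 <= j)%N -> (i <= j)%N.
Proof. by move=> i1 tij j1; rewrite leqNgt; apply/negP => /(tinc j1); rewrite ltNge tij. Qed.

Lemma t_inj i j : (1 <= i)%N -> (1 <= j)%N -> t i = t j -> i = j.
Proof. by move=> i1 j1 e; apply/eqP; rewrite eqn_leq; apply/andP; split; apply: t_le_idx => //; rewrite e. Qed.

Lemma pos_quiet i v s : s <= v -> v <= t i -> quiet Ev s v -> pos i s = pos i v.
Proof. exact: ancf_quiet. Qed.

Lemma pos_self i : pos i (t i) = S i.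
Proof. exact: ancf_id. Qed.

Lemma meetE i j s : meet Ev S t i j s <-> s <= t i /\ s <= t j /\ pos i s = pos j s.
Proof.
split=> [[a [b [y [yi yj]]]]|[a [b e]]]; split=> //; split=> //.
  by rewrite /pos (ancfE lf yi) (ancfE lf yj).
by exists (pos i s); split; [|rewrite e]; exact: ancfP.
Qed.

Lemma meet_down i j s s' : s' <= s -> meet Ev S t i j s -> meet Ev S t i j s'.
Proof.
move=> ss /meetE[a [b e]]; apply/meetE; split; first exact: le_trans a.
split; first exact: le_trans b.
by rewrite /pos (ancf_comp lf _ ss a) (ancf_comp lf _ ss b); congr ancf.
Qed.

Lemma meet_right i j s : s < t i -> s < t j -> meet Ev S t i j s ->
  exists2 s', s < s' & meet Ev S t i j s'.
Proof.
move=> si sj /meetE[_ [_ e]]; have [s' ss' q] := quiet_right lf s.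
exists (Num.min s' (Num.min (t i) (t j))); first by rewrite !lt_min ss' si sj.
set v := Num.min _ _.
have vi : v <= t i by rewrite /v !ge_min lexx orbT.
have vj : v <= t j by rewrite /v !ge_min lexx !orbT.
have sv : s <= v by rewrite /v !le_min !ltW.
have qv : quiet Ev s v by apply: q; rewrite /v ge_min lexx.
by apply/meetE; split=> //; split=> //; rewrite -!(pos_quiet sv _ qv).
Qed.

Definition attach_set j : set R := [set s | exists i, (1 <= i < j)%N /\ meet Ev S t i j s].

Lemma attach_set_ub j : ubound (attach_set j) (t j).
Proof. by move=> s [i [_ [_ []]]]. Qed.

Lemma attach_le j s : attach_set j s -> s <= attach Ev S t j.
Proof. by move=> js; apply: ub_le_sup => //; exists (t j); exact: attach_set_ub. Qed.

Lemma attach_set_down j s s' : s' <= s -> attach_set j s -> attach_set j s'.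
Proof. by move=> ss [i [ij m]]; exists i; split=> //; exact: meet_down m. Qed.

Lemma attach_ge c j : attach_set j !=set0 -> nonevent Ev c ->
  (c <= attach Ev S t j <-> attach_set j c).
Proof.
move=> ne nc; split; last exact: attach_le.
rewrite le_eqVlt => /orP[/eqP ec|]; last first.
  by move=> /(sup_gt ne)[s js /ltW cs]; exact: attach_set_down js.
have [s' s'c q] := quiet_left lf nc.
have [|v vc h] := @real_gap_left _ c [seq t i | i <- iota 1 j & t i < c].
  by move=> r /mapP[i]; rewrite mem_filter => /andP[+ _] ->.
have : Num.max s' v < attach Ev S t j by rewrite -ec gt_max s'c vc.
move=> /(sup_gt ne)[s js]; rewrite gt_max => /andP[s's vs].
have [cs|sc] := leP c s; first exact: attach_set_down js.
case: js => i [/andP[i1 ij] m]; exists i; split; first by rewrite i1.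
case/meetE: (m) => si [sj e].
have ci : c <= t i.
  rewrite leNgt; apply/negP => tc.
  have : t i < v by apply/h/map_f; rewrite mem_filter tc mem_iota i1 /= addnC addn1 ltnW.
  by rewrite ltNge ltW // (lt_le_trans vs).
have cj : c <= t j by rewrite (le_trans ci) // ltW // tinc.
have qs : quiet Ev s c.
  move=> ev Eev; apply/negP => /andP[a b].
  by have := q ev Eev; rewrite (lt_trans s's a) b.
by apply/meetE; split=> //; split=> //; rewrite -!(pos_quiet (ltW sc) _ qs).
Qed.

Lemma attach_gt x j : attach_set j !=set0 ->
  (x < attach Ev S t j <-> exists i, [/\ (1 <= i < j)%N, x < t i & meet Ev S t i j x]).
Proof.
move=> ne; split.
  move=> /(sup_gt ne)[s [i [ij m]] xs]; exists i; split=> //.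
    by case: m => si _; exact: lt_le_trans si.
  exact: meet_down (ltW xs) m.
move=> [i [/andP[i1 ij] xi m]].
have [s' xs m'] := meet_right xi (lt_trans xi (tinc i1 ij)) m.
by apply: lt_le_trans xs (attach_le _); exists i; rewrite i1 ij.
Qed.

Lemma attach_bound j : (2 <= j)%N -> attach_set j !=set0 -> attach Ev S t j <= t j.-1.
Proof.
move=> j2 ne; apply: ge_sup => // s [i [/andP[i1 ij] [si _]]].
by apply: le_trans si (tle i1 _); lia.
Qed.

Lemma coal_ge c i j : (1 <= i)%N -> (i < j)%N -> [set s | meet Ev S t i j s] !=set0 ->
  nonevent Ev c -> (c <= coal Ev S t i j <-> meet Ev S t i j c).
Proof.
move=> i1 ij ne nc; have tij := tinc i1 ij; split; last first.
  by move=> m; apply: ub_le_sup => //; exists (t i) => s [].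
rewrite le_eqVlt => /orP[/eqP ec|]; last first.
  by move=> /(sup_gt ne)[s js /ltW cs]; exact: meet_down js.
have ci : c <= t i by rewrite ec; apply: ge_sup => // s [].
have cj := le_trans ci (ltW tij).
have [s' s'c q] := quiet_left lf nc.
have : s' < coal Ev S t i j by rewrite -ec.
move=> /(sup_gt ne)[s m s's].
have [cs|sc] := leP c s; first exact: meet_down m.
have qs : quiet Ev s c.
  move=> ev Eev; apply/negP => /andP[a b].
  by have := q ev Eev; rewrite (lt_trans s's a) b.
case/meetE: m => si [sj e].
by apply/meetE; split=> //; split=> //; rewrite -!(pos_quiet (ltW sc) _ qs).
Qed.

Variable k : nat.
Hypothesis attach_ne : forall j, (2 <= j <= k)%N -> attach_set j !=set0.

Lemma all_meet : exists s, forall i j, (1 <= i <= k)%N -> (1 <= j <= k)%N -> meet Ev S t i j s.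
Proof.
suff H m : (m <= k)%N -> exists s, forall i j, (1 <= i <= m)%N -> (1 <= j <= m)%N -> meet Ev S t i j s.
  exact: (H k).
elim: m => [_|m IH mk]; first by exists 0 => i j; lia.
have [s hs] := IH (ltnW mk).
have [m0|m0] := posnP m.
  exists (t 1) => i j hi hj; have -> : i = 1%N by lia. have -> : j = 1%N by lia.
  by apply/meetE.
have [|s' [i0 [i0m m']]] := @attach_ne m.+1; first by rewrite mk; lia.
exists (Num.min s s') => i j hi hj.
have a1 i1 j1 : (1 <= i1 <= m)%N -> (1 <= j1 <= m)%N -> meet Ev S t i1 j1 (Num.min s s').
  by move=> h1 h2; apply: meet_down (hs _ _ h1 h2); rewrite ge_min lexx.
have a2 : meet Ev S t i0 m.+1 (Num.min s s').
  by apply: meet_down m'; rewrite ge_min lexx orbT.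
have a3 i1 : (1 <= i1 <= m)%N -> meet Ev S t i1 m.+1 (Num.min s s').
  move=> h1; have h0 : (1 <= i0 <= m)%N by lia.
  case/meetE: (a1 _ _ h1 h0) => b1 [b2 b3]; case/meetE: a2 => c1 [c2 c3].
  by apply/meetE; split=> //; split=> //; rewrite b3.
have sym i1 j1 s1 : meet Ev S t i1 j1 s1 -> meet Ev S t j1 i1 s1.
  by move=> /meetE[b1 [b2 b3]]; apply/meetE.
have [im|im] := leqP i m; have [jm|jm] := leqP j m.
- by apply: a1; lia.
- have -> : j = m.+1 by lia. by apply: a3; lia.
- have -> : i = m.+1 by lia. by apply/sym/a3; lia.
- have -> : i = m.+1 by lia. have -> : j = m.+1 by lia.
  by case/meetE: a2 => c1 [c2 c3]; apply/meetE.
Qed.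

Lemma coal_ne i j : (1 <= i)%N -> (i < j <= k)%N -> [set s | meet Ev S t i j s] !=set0.
Proof. by move=> i1 ij; have [s h] := all_meet; exists s; apply: h; lia. Qed.

Hypothesis tne : forall i, (1 <= i)%N -> nonevent Ev (t i).
Local Notation Av := (attach Ev S t).

Lemma direct_descent j m : (2 <= j <= k)%N -> (1 <= m)%N -> Av j = t m ->
  (m < j)%N /\ pos j (t m) = S m.
Proof.
move=> jk m1 e; have ne := attach_ne jk.
have := (attach_ge ne (tne m1)).1; rewrite e lexx => /(_ isT)[i [/andP[i1 ij] mij]].
case/meetE: (mij) => mi [mj pe].
have mi' : (m <= i)%N by exact: t_le_idx.
have [mlt|] := ltnP m i; last first.
  move=> im; have emi : m = i by lia.
  by rewrite emi; split=> //; rewrite -emi -pe emi pos_self.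
suff : t m < Av j by rewrite e ltxx.
by apply/(attach_gt _ ne); exists i; rewrite i1 ij; split=> //; exact: tinc.
Qed.

Lemma direct_inj j j' m : (2 <= j <= k)%N -> (2 <= j' <= k)%N -> (1 <= m)%N ->
  Av j = t m -> Av j' = t m -> j = j'.
Proof.
wlog jj : j j' / (j <= j')%N.
  move=> H hj hj' m1 e e'; have [l|/ltnW l] := leqP j j'; first exact: H.
  by apply/esym; exact: H.
move=> hj hj' m1 e e'; move: jj; rewrite leq_eqVlt => /orP[/eqP //|jj].
have [mj p] := direct_descent hj m1 e; have [mj' p'] := direct_descent hj' m1 e'.
suff : t m < Av j' by rewrite e' ltxx.
apply/(attach_gt _ (attach_ne hj')); exists j.
have tm1 : t m < t j by exact: tinc.
split=> //; first by lia.
by apply/meetE; split; [exact: ltW|split; [exact/ltW/tinc|rewrite p p']].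
Qed.

Lemma ellE x : ell t k Av x = (\sum_(1 <= i < k.+1) (x < t i)%R)%N%:R
                            - (\sum_(2 <= j < k.+1) (x < Av j)%R)%N%:R.
Proof.
rewrite /ell; apply/eqP; rewrite subr_eq addrAC eq_sym subr_eq -!natrD eqr_nat; apply/eqP.
suff H : (\sum_(1 <= i < k.+1) (~~ liveb t k Av i && (x < t i)%R) =
     \sum_(2 <= j < k.+1) (~~ is_branch t Av j && (x < Av j)%R))%N.
  have E1 : (\sum_(1 <= i < k.+1) (x < t i)%R = \sum_(1 <= i < k.+1) (liveb t k Av i && (x < t i)%R)
      + \sum_(1 <= i < k.+1) (~~ liveb t k Av i && (x < t i)%R))%N.
    by rewrite -big_split /=; apply: eq_bigr => i _; case: liveb => /=; rewrite ?addn0.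
  have E2 : (\sum_(2 <= j < k.+1) (x < Av j)%R = \sum_(2 <= j < k.+1) (is_branch t Av j && (x < Av j)%R)
      + \sum_(2 <= j < k.+1) (~~ is_branch t Av j && (x < Av j)%R))%N.
    by rewrite -big_split /=; apply: eq_bigr => i _; case: is_branch => /=; rewrite ?addn0.
  by rewrite E1 E2 H; lia.
transitivity (\sum_(1 <= i < k.+1) \sum_(2 <= j < k.+1) ((Av j == t i) && (x < t i)%R))%N.
  apply: eq_big_nat => i /andP[i1 ik].
  have [xi|xi] := boolP (x < t i); last by rewrite andbF big1 // => j _; rewrite andbF.
  under eq_bigr do rewrite andbT.
  rewrite andbT (@sum_atmost1 _ _ (fun j => Av j == t i)) ?iota_uniq //; last first.
    move=> j j'; rewrite !mem_index_iota => hj hj' /eqP e /eqP e'.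
    by apply: (@direct_inj j j' i).
  congr nat_of_bool; rewrite /liveb i1 -ltnS ik /= negb_forall.
  apply/existsP/hasP => [[j]|[j]].
    rewrite negbK => /andP[ij e]; exists (j : nat) => //.
    by rewrite mem_index_iota ltn_ord andbT; lia.
  rewrite mem_index_iota => /andP[j2 jk] e.
  have [ij _] := @direct_descent j i (introT andP (conj j2 jk)) i1 (eqP e).
  by exists (Ordinal jk); rewrite negbK /= ij.
rewrite exchange_big_nat /=; apply: eq_big_nat => j /andP[j2 jk].
have hj : (2 <= j <= k)%N by rewrite j2.
have [xj|xj] := boolP (x < Av j); last first.
  rewrite andbF big1 // => i _; case: eqP => // <-; by rewrite (negbTE xj).
transitivity (\sum_(1 <= i < k.+1) (Av j == t i))%N.
  by apply: eq_bigr => i _; case: eqP => // <-; rewrite xj.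
rewrite andbT (@sum_atmost1 _ _ (fun i => Av j == t i)) ?iota_uniq //; last first.
  move=> i i'; rewrite !mem_index_iota => /andP[hi _] /andP[hi' _] /eqP e /eqP e'.
  by apply: t_inj => //; rewrite -e -e'.
congr nat_of_bool; apply/hasP/negP => [[i]|].
  rewrite mem_index_iota => /andP[i1 _] /eqP e /asboolP; apply; by exists i.
move=> /negP/asboolPn/contrapT[m [m1 e]]; exists m; last by rewrite e.
by have [mj _] := direct_descent hj m1 (esym e); rewrite mem_index_iota m1; lia.
Qed.

Definition lineages (m : nat) (x : R) : {set 'I_n} :=
  finset (fun y => has (fun i => (x < t i) && (pos i x == y)) (iota 1 m)).

Lemma lineages_attach m x : (1 <= m < k)%N -> x < t m.+1 ->
  (pos m.+1 x \in lineages m x) = (x < Av m.+1).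
Proof.
move=> mk xm; have hm : (2 <= m.+1 <= k)%N by lia.
rewrite inE; apply/hasP/idP => [[i]|].
  rewrite mem_iota => hi /andP[xi /eqP e]; apply/(attach_gt _ (attach_ne hm)).
  exists i; split=> //.
  by apply/meetE; split; [exact: ltW|split; [exact: ltW|]].
move=> /(attach_gt _ (attach_ne hm))[i [hi xi /meetE[_ [_ e]]]].
by exists i; [rewrite mem_iota; lia|rewrite xi e eqxx].
Qed.

Lemma card_lineages_le m x : (m <= k)%N ->
  #|lineages m x|%:R = (\sum_(1 <= i < m.+1) (x < t i)%R)%N%:R
                       - (\sum_(2 <= j < m.+1) (x < Av j)%R)%N%:R :> R.
Proof.
elim: m => [_|m IH mk].
  rewrite !big_geq // subrr (_ : lineages 0 x = finset.set0) ?cards0 //.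
have lS : lineages m.+1 x = if x < t m.+1 then (pos m.+1 x |: lineages m x)%SET else lineages m x.
  have iS : iota 1 m.+1 = iota 1 m ++ [:: m.+1] by rewrite -[X in iota 1 X]addn1 iotaD add1n.
  case: ifP => xm; apply/finset.setP => y; rewrite /lineages !inE iS has_cat /= orbF xm //=.
    by rewrite orbC eq_sym.
  by rewrite orbF.
rewrite big_nat_recr //= lS; have [m0|m0] := posnP m.
  subst m; rewrite [\sum_(2 <= j < 2) _]big_geq // big_geq // subr0 add0n.
  case: ifP => xm; last first.
    by rewrite (_ : lineages 0 x = finset.set0) ?cards0.
  rewrite cardsU1 (_ : lineages 0 x = finset.set0) ?cards0 ?inE //.
rewrite [\sum_(2 <= j < m.+2) _]big_nat_recr //= !natrD.
have IH' := IH (ltnW mk); have hm : (1 <= m < k)%N by lia.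
case: ifP => xm; last first.
  have -> : x < Av m.+1 = false.
    apply/negbTE; rewrite -leNgt; apply: le_trans (attach_bound _ (attach_ne _)) _; [lia|lia|].
    by move/negbT: xm; rewrite -leNgt /=; apply: le_trans; apply: tle.
  by rewrite IH'; ring.
rewrite cardsU1 natrD IH' lineages_attach //; case: (x < Av m.+1); rewrite /=; ring.
Qed.

Lemma live_card i : (1 <= i <= k)%N -> liveb t k Av i = (S i \notin lineages k (t i)).
Proof.
move=> /andP[i1 ik]; apply/idP/idP; last first.
  move=> nl; rewrite /liveb i1 ik /=; apply/forallP => j; apply/negP => /andP[ij /eqP e].
  have hj : (2 <= j <= k)%N by have := ltn_ord j; lia.
  have [_ p] := direct_descent hj i1 e.
  move/negP: nl; apply; rewrite inE; apply/hasP; exists (j : nat).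
    by rewrite mem_iota; lia.
  by rewrite p eqxx tinc.
move=> /andP[_ /forallP lv]; apply/negP; rewrite inE => /hasP H.
have {}H : exists j, (1 <= j <= k)%N && (t i < t j) && (pos j (t i) == S i).
  by case: H => j; rewrite mem_iota add1n ltnS => hj /andP[a b]; exists j; rewrite a b hj.
case: (ex_minnP H) => j /andP[/andP[jk tij] /eqP pj] jmin.
have ij : (i < j)%N by apply: t_lt_idx => //; lia.
have hj : (2 <= j <= k)%N by lia.
have jk1 : (j < k.+1)%N by lia.
have := lv (Ordinal jk1); rewrite /= ij /= => /eqP; apply.
have ne := attach_ne hj.
apply/eqP; rewrite eq_le; apply/andP; split; last first.
  apply/(attach_ge ne (tne i1)); exists i; rewrite i1 ij; split=> //.
  by apply/meetE; split=> //; split; [exact: ltW|rewrite pos_self pj].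
rewrite leNgt; apply/negP => /(attach_gt _ ne)[i' [hi' ti' /meetE[_ [_ e]]]].
have := jmin i'; rewrite ti' e pj eqxx /=; lia.
Qed.

End Genealogy.

Section MeasurablePredicates.
Context {d : measure_display} {T : measurableType d}.

Lemma measurable_forall (I : countType) (A : I -> T -> Prop) :
  (forall i, measurable [set w | A i w]) -> measurable [set w | forall i, A i w].
Proof.
move=> mA; rewrite (_ : [set w | _] = \bigcap_m (if unpickle m is Some i then [set w | A i w] else setT)).
  by apply: bigcapT_measurable => m; case: unpickle.
apply/seteqP; split=> w /= h; first by move=> m _; case: unpickle => /=.
by move=> i; have := h (pickle i) Logic.I; rewrite pickleK.
Qed.

Lemma measurable_exists (I : countType) (A : I -> T -> Prop) :
  (forall i, measurable [set w | A i w]) -> measurable [set w | exists i, A i w].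
Proof.
move=> mA; rewrite (_ : [set w | _] = ~` [set w | forall i, ~ A i w]).
  by apply: measurableC; apply: measurable_forall => i; exact: measurableC (mA i).
by apply/seteqP; split=> w /= h; [case: h => i Ai /(_ i)|apply: contrapT => /forallNP].
Qed.

Lemma measurable_const (Q : Prop) : measurable [set w : T | Q].
Proof.
have [q|q] := pselect Q.
  by rewrite (_ : [set w | _] = setT) //; apply/seteqP; split.
by rewrite (_ : [set w | _] = set0) //; apply/seteqP; split.
Qed.

Lemma measurable_conj (A B : T -> Prop) : measurable [set w | A w] -> measurable [set w | B w] ->
  measurable [set w | A w /\ B w].
Proof. exact: measurableI. Qed.

Lemma measurable_disj (A B : T -> Prop) : measurable [set w | A w] -> measurable [set w | B w] ->
  measurable [set w | A w \/ B w].
Proof. exact: measurableU. Qed.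

Lemma measurable_notP (A : T -> Prop) : measurable [set w | A w] -> measurable [set w | ~ A w].
Proof. exact: measurableC. Qed.

Lemma measurable_impl (A B : T -> Prop) : measurable [set w | A w] -> measurable [set w | B w] ->
  measurable [set w | A w -> B w].
Proof.
move=> mA mB; rewrite (_ : [set w | _] = [set w | ~ A w \/ B w]).
  by apply: measurable_disj => //; exact: measurable_notP.
by apply/seteqP; split=> w /= h; [have [a|a] := pselect (A w); [right; exact: h|left]|case: h].
Qed.

Definition mdisc (E : Type) (f : T -> E) : Prop := forall B : set E, measurable (f @^-1` B).

Lemma mdisc_comp2 (E1 E2 : countType) (E3 : Type) (h : E1 -> E2 -> E3) (f : T -> E1) (g : T -> E2) :
  mdisc f -> mdisc g -> mdisc (fun w => h (f w) (g w)).
Proof.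
move=> mf mg B.
rewrite (_ : _ @^-1` _ = [set w | exists a, exists b, [set b' | B (h a b')] b /\ (f w = a /\ g w = b)]).
  apply: measurable_exists => a; apply: measurable_exists => b.
  apply: measurable_conj; first exact: measurable_const.
  by apply: measurable_conj; [exact: (mf [set a])|exact: (mg [set b])].
apply/seteqP; split=> w /=; first by move=> h0; exists (f w), (g w).
by move=> [a [b [h0 [-> ->]]]].
Qed.

Lemma mdisc_eq (E : countType) (f g : T -> E) : mdisc f -> mdisc g -> measurable [set w | f w = g w].
Proof.
move=> mf mg; have := @mdisc_comp2 _ _ _ (fun a b => a = b) _ _ mf mg [set Q | Q].
exact.
Qed.

Variable R : realType.

Lemma measurable_ltS (f g : T -> R) : measurable_fun setT f -> measurable_fun setT g ->
  measurable [set w | f w < g w].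
Proof.
move=> mf mg; have := measurable_fun_ltr mf mg measurableT (Y:=[set true]) Logic.I.
by rewrite setTI (_ : _ @^-1` _ = [set w | f w < g w]).
Qed.

Lemma measurable_leS (f g : T -> R) : measurable_fun setT f -> measurable_fun setT g ->
  measurable [set w | f w <= g w].
Proof.
move=> mf mg; have := measurable_fun_ler mf mg measurableT (Y:=[set true]) Logic.I.
by rewrite setTI (_ : _ @^-1` _ = [set w | f w <= g w]).
Qed.

Lemma measurable_eqS (f g : T -> R) : measurable_fun setT f -> measurable_fun setT g ->
  measurable [set w | f w = g w].
Proof.
move=> mf mg; rewrite (_ : [set w | _] = [set w | f w <= g w] `&` [set w | g w <= f w]).
  by apply: measurableI; exact: measurable_leS.
apply/seteqP; split=> w /=; first by move=> ->; rewrite lexx.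
by move=> [a b]; apply/eqP; rewrite eq_le a b.
Qed.

(* [C] enumerates a countable set meeting every [E w] above each [c < s] in [E w]. *)
Lemma measurable_sup (E : T -> set R) (b : R) (J : countType) (C : J -> R) :
  (forall w s, E w s -> s <= b) ->
  (forall q, measurable [set w | E w (C q)]) ->
  (forall w s c, E w s -> c < s -> exists2 q, c < C q & E w (C q)) ->
  measurable_fun setT (fun w => sup (E w)).
Proof.
move=> ub mE dense; apply: (measurability _ (RGenOInfty.measurableE R)) => //.
move=> /= _ [_ [c ->] <-]; rewrite setTI.
rewrite (_ : _ @^-1` _ = [set w | (exists q, c < C q /\ E w (C q)) \/ ((forall q, ~ E w (C q)) /\ c < 0)]).
  apply: measurable_disj.
    by apply: measurable_exists => q; apply: measurable_conj => //; exact: measurable_const.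
  apply: measurable_conj; last exact: measurable_const.
  by apply: measurable_forall => q; exact: measurable_notP.
apply/seteqP; split=> w /=; rewrite in_itv /= andbT.
  have [[s Es]|] := pselect (E w !=set0).
    move=> cs; left; have [s' Es' cs'] := sup_gt (ex_intro _ s Es) cs.
    by have [q] := dense _ _ _ Es' cs'; exists q.
  move=> e0; rewrite (_ : E w = set0); last by apply/seteqP; split=> s // Es; case: e0; exists s.
  by rewrite sup0 => c0; right; split=> // q [].
move=> [[q [cq Eq]]|[h c0]].
  by apply: lt_le_trans cq _; apply: ub_le_sup => //; exists b => s; exact: ub.
rewrite (_ : E w = set0) ?sup0 //; apply/seteqP; split=> s // Es.
have [|q _ Eq] := dense w s (s - 1) Es; first by lra.
by case: (h q).
Qed.

End MeasurablePredicates.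

Section MoranMeasurable.
Context (R : realType) (d : measure_display) (T : measurableType d) (n : nat).
Variables (X Y : nat -> T -> R) (Mf Mb : nat -> T -> 'I_n * 'I_n) (S : nat -> T -> 'I_n).
Variable t : nat -> R.
Hypothesis mX : forall m, measurable_fun setT (X m).
Hypothesis mY : forall m, measurable_fun setT (Y m).
Hypothesis mMf : forall m, mdisc (Mf m).
Hypothesis mMb : forall m, mdisc (Mb m).
Hypothesis mS : forall m, mdisc (S m).
Local Notation Ev := (events X Y Mf Mb).
Local Notation idx := (bool * nat)%type.
Local Notation event := (R * ('I_n * 'I_n))%type.
Local Notation later := (fun e1 e2 : event => e2.1 < e1.1).

Definition evt (w : T) (c : idx) : event :=
  if c.1 then (fwd_time X w c.2, Mf c.2 w) else (bwd_time Y w c.2, Mb c.2 w).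

Lemma eventsE w e : Ev w e <-> exists c, evt w c = e.
Proof.
split; first by case=> -[m _ <-]; [exists (true, m)|exists (false, m)].
by move=> [[[] m] <-]; [left|right]; exists m.
Qed.

Lemma measurable_evt_time c : measurable_fun setT (fun w => (evt w c).1).
Proof.
case: c => -[] m /=; rewrite /evt /= /fwd_time /bwd_time; first exact: measurable_sum.
by apply: measurableT_comp => //; exact: measurable_sum.
Qed.

Lemma mdisc_evt_mark c : mdisc (fun w => (evt w c).2).
Proof. by case: c => -[] m; [exact: mMf|exact: mMb]. Qed.

Lemma anc_idx w x u s y : anc (Ev w) x u s y <-> exists l : seq idx,
  (forall c, c \in l -> s < (evt w c).1 /\ (evt w c).1 <= u) /\
  (forall c, s < (evt w c).1 /\ (evt w c).1 <= u ->
     exists c', c' \in l /\ ((evt w c).1 = (evt w c').1 /\ (evt w c).2 = (evt w c').2)) /\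
  sorted later (map (evt w) l) /\ y = foldl (@lin_step R n) x (map (evt w) l).
Proof.
split.
  move=> [l [ml [sl ->]]].
  have [l' el] : exists l', l = map (evt w) l'.
    have {ml sl} : forall e, e \in l -> Ev w e by move=> e /ml[].
    elim: l => [_|e l IH h]; first by exists [::].
    have [|l' ->] := IH; first by move=> e' el; apply: h; rewrite in_cons el orbT.
    by have /eventsE[c <-] := h e (mem_head _ _); exists (c :: l').
  exists l'; split; first by move=> c cl; have /ml[_ /andP[]] : evt w c \in l by rewrite el map_f.
  split; last by rewrite -el.
  move=> c [a b]; have : evt w c \in l by apply/ml; rewrite a b; split=> //; apply/eventsE; exists c.
  by rewrite el => /mapP[c' cl ->]; exists c'.
move=> [l [h1 [h2 [h3 ->]]]]; exists (map (evt w) l); split=> // e; split.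
  move=> /mapP[c cl ->]; have [a b] := h1 c cl.
  by rewrite a b; split=> //; apply/eventsE; exists c.
move=> [/eventsE[c <-] ab]; have [c' [cl [e1 e2]]] := h2 c (andP ab).
by rewrite (_ : evt w c = evt w c') ?map_f // [LHS]surjective_pairing e1 e2 -surjective_pairing.
Qed.

Lemma measurable_path c l : measurable [set w | path later (evt w c) (map (evt w) l)].
Proof.
elim: l c => [|c' l IH] c /=; first exact: measurable_const.
rewrite (_ : [set w | _] = [set w | (evt w c').1 < (evt w c).1 /\ path later (evt w c') (map (evt w) l)]).
  by apply: measurable_conj => //; apply: measurable_ltS; exact: measurable_evt_time.
by apply/seteqP; split=> w /= /andP.
Qed.

Lemma mdisc_foldl (x : T -> 'I_n) l : mdisc x ->
  mdisc (fun w => foldl (@lin_step R n) (x w) (map (evt w) l)).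
Proof.
elim: l x => [|c l IH] x mx //=; apply: IH.
apply: (@mdisc_comp2 _ _ _ _ _ (fun a (b : 'I_n * 'I_n) => if a == b.1 then b.2 else a)) => //.
exact: mdisc_evt_mark.
Qed.

Lemma measurable_anc (x : T -> 'I_n) u s y : mdisc x ->
  measurable [set w | anc (Ev w) (x w) u s y].
Proof.
move=> mx; have mw c : measurable [set w | s < (evt w c).1 /\ (evt w c).1 <= u].
  apply: measurable_conj; [apply: measurable_ltS|apply: measurable_leS] => //; exact: measurable_evt_time.
rewrite (_ : [set w | _] = [set w | exists l : seq idx,
  (forall c, c \in l -> s < (evt w c).1 /\ (evt w c).1 <= u) /\
  (forall c, s < (evt w c).1 /\ (evt w c).1 <= u ->
     exists c', c' \in l /\ ((evt w c).1 = (evt w c').1 /\ (evt w c).2 = (evt w c').2)) /\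
  sorted later (map (evt w) l) /\ y = foldl (@lin_step R n) (x w) (map (evt w) l)]); last first.
  by apply/seteqP; split=> w /anc_idx.
apply: measurable_exists => l; apply: measurable_conj.
  by apply: measurable_forall => c; apply: measurable_impl => //; exact: measurable_const.
apply: measurable_conj.
  apply: measurable_forall => c; apply: measurable_impl => //; apply: measurable_exists => c'.
  apply: measurable_conj; first exact: measurable_const.
  apply: measurable_conj; first by apply: measurable_eqS; exact: measurable_evt_time.
  by apply: mdisc_eq; exact: mdisc_evt_mark.
apply: measurable_conj.
  by case: l => [|c l] /=; [exact: measurable_const|exact: measurable_path].
by apply: mdisc_eq; [move=> B; exact: measurable_const|exact: mdisc_foldl].
Qed.

Lemma measurable_meet i j s : measurable [set w | meet (Ev w) (S^~ w) t i j s].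
Proof.
rewrite /meet; apply: measurable_conj; first exact: measurable_const.
apply: measurable_conj; first exact: measurable_const.
by apply: measurable_exists => y; apply: measurable_conj; apply: measurable_anc; exact: mS.
Qed.

Local Notation dense_pts := (fun q : rat + nat => match q with inl r => ratr r | inr m => t m end : R).

Lemma anc_right (E : set event) x u s s' y : anc E x u s y -> s < s' -> s' <= u ->
  exists2 v, s < v & forall v', s <= v' -> v' < v -> anc E x u v' y.
Proof.
move=> [l [ml [sl ->]]] ss' s'u.
have [|v sv hv] := @real_gap_right R s [seq e.1 | e <- l].
  by move=> r /mapP[e /ml[_ /andP[a _]] ->].
exists v => // v' a b; exists l; split=> // e; split.
  move=> el; have [Ee /andP[_ eu]] := (ml e).1 el; split=> //; rewrite eu andbT.
  by apply: lt_trans b _; apply: hv; exact: map_f.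
by move=> [Ee /andP[a' b']]; apply/ml; split=> //; rewrite b' andbT; exact: le_lt_trans a'.
Qed.

Lemma meet_dense (E : set event) (x : nat -> 'I_n) i j s c : meet E x t i j s -> c < s ->
  exists2 q, c < dense_pts q & meet E x t i j (dense_pts q).
Proof.
move=> [si [sj [y [ai aj]]]] cs.
have [ei|si'] := eqVneq s (t i).
  by exists (inr i); rewrite -ei //; split=> //; split=> //; exists y.
have [ej|sj'] := eqVneq s (t j).
  by exists (inr j); rewrite -ej //; split=> //; split=> //; exists y.
have {}si : s < t i by rewrite lt_neqAle si'.
have {}sj : s < t j by rewrite lt_neqAle sj'.
have [v sv hv] := anc_right ai si (lexx _).
have [v' sv' hv'] := anc_right aj sj (lexx _).
have : s < Num.min (Num.min v v') (Num.min (t i) (t j)) by rewrite !lt_min sv sv' si sj.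
move=> /rat_in_itvoo[q]; rewrite in_itv /= !lt_min => /andP[sq /andP[/andP[qv qv'] /andP[qi qj]]].
exists (inl q); first exact: lt_trans sq.
by split; [exact: ltW|split; [exact: ltW|exists y; split; [apply: hv|apply: hv'] => //; exact: ltW]].
Qed.

Lemma measurable_coal i j : measurable_fun setT (fun w => coal (Ev w) (S^~ w) t i j).
Proof.
apply: (@measurable_sup _ _ _ (fun w => [set s | meet (Ev w) (S^~ w) t i j s]) (t i) _ dense_pts).
- by move=> w s [].
- by move=> q; exact: measurable_meet.
- by move=> w s c; exact: meet_dense.
Qed.

Lemma measurable_attach_set j s :
  measurable [set w | exists i, (1 <= i < j)%N /\ meet (Ev w) (S^~ w) t i j s].
Proof.
apply: measurable_exists => i; apply: measurable_conj; first exact: measurable_const.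
exact: measurable_meet.
Qed.

Lemma measurable_attach j : measurable_fun setT (fun w => attach (Ev w) (S^~ w) t j).
Proof.
apply: (@measurable_sup _ _ _ (fun w => [set s | exists i, (1 <= i < j)%N /\ meet (Ev w) (S^~ w) t i j s])
  (t j) _ dense_pts).
- by move=> w s [i [_ [_ []]]].
- by move=> q; exact: measurable_attach_set.
- by move=> w s c [i [ij /meet_dense h]] /h[q cq m]; exists q => //; exists i.
Qed.

End MoranMeasurable.

Section RealBounds.
Variable R : realType.
Implicit Types z : R.

Lemma expRN_ub z : 0 <= z -> expR (- z) <= 1 - z + z ^+ 2.
Proof.
move=> z0; have h := expR_ge1Dx z; have e0 := expR_gt0 z.
rewrite expRN -[X in X <= _]mul1r ler_pdivrMr //.
apply: le_trans (ler_wpM2l _ h); last by nra.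
have : 0 <= z ^+ 3 by exact: exprn_ge0.
by nra.
Qed.

Lemma expR_ub2 z : 0 <= z -> z <= 2^-1 -> expR z <= 1 + z + 2 * z ^+ 2.
Proof.
move=> z0 z1; have h := expR_ge1Dx (- z); have e0 := expR_gt0 z.
have : expR z * (1 - z) <= 1.
  by rewrite -[X in _ <= X](expRxMexpNx_1 z) ler_wpM2l // ltW.
move=> h2; have : expR z * (1 - z) <= (1 + z + 2 * z ^+ 2) * (1 - z).
  by apply: le_trans h2 _; nra.
by rewrite ler_pM2r //; lra.
Qed.

Lemma eq_of_close (a b K : R) (N0 : nat) :
  (forall N, (N0 <= N)%N -> `|a - b| <= K / N.+1%:R) -> a = b.
Proof.
move=> h; apply/eqP; rewrite -subr_eq0 -normr_eq0; apply/eqP/le_anti.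
rewrite normr_ge0 andbT leNgt; apply/negP => e0.
have K0 : 0 <= K.
  have := h N0 (leqnn _); rewrite leNgt; apply: contraNle => K0.
  by apply: lt_trans e0; rewrite pmulr_llt0 // invr_gt0 ltr0n.
pose N := maxn N0 (Num.truncn (K / `|a - b|)).
have := h N (leq_maxl _ _); rewrite leNgt => /negP; apply.
rewrite ltr_pdivrMr ?ltr0n // mulrC -ltr_pdivrMr //.
apply: lt_le_trans (truncnS_gt _) _; rewrite ler_nat ltnS; exact: leq_maxr.
Qed.

Lemma increment_sandwich (F : R -> R) (E mu h : R) : 0 <= E -> 0 < mu -> 0 <= h ->
  (forall u v, 0 <= u -> u <= v -> v <= h ->
    E * (1 - expR (- (mu * (v - u)))) <= F u - F v <= E * (expR (mu * (v - u)) - 1)) ->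
  F 0 - F h = E * (mu * h).
Proof.
move=> E0 mu0 h0 H.
apply: (@eq_of_close _ _ (2 * E * (mu * h) ^+ 2) (Num.truncn (2 * (mu * h)))) => N hN.
set z := mu * h / N.+1%:R.
have N0 : (0 : R) < N.+1%:R by rewrite ltr0n.
have z0 : 0 <= z by rewrite divr_ge0 // ?mulr_ge0 // ltW.
have z1 : z <= 2^-1.
  rewrite ler_pdivrMr //; have : 2 * (mu * h) < N.+1%:R.
    by apply: lt_le_trans (truncnS_gt _) _; rewrite ler_nat ltnS.
  by lra.
pose u i := h / N.+1%:R * i%:R.
have step (i : nat) : (i < N.+1)%N -> `|F (u i) - F (u i.+1) - E * z| <= 2 * E * z ^+ 2.
  move=> iN; have hN0 : 0 <= h / N.+1%:R by rewrite divr_ge0.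
  have ui : 0 <= u i by rewrite mulr_ge0.
  have uu : u i <= u i.+1 by rewrite ler_wpM2l // ler_nat.
  have uh : u i.+1 <= h.
    rewrite /u -mulrA -[X in _ <= X]mulr1 ler_wpM2l // mulrC ler_pdivrMr // mul1r ler_nat.
    exact: iN.
  have := H _ _ ui uu uh.
  have -> : mu * (u i.+1 - u i) = z by rewrite /u /z -[i.+1]addn1 natrD; field; lra.
  have a1 := expRN_ub z0; have a2 := expR_ub2 z0 z1.
  move=> /andP[b1 b2]; rewrite ler_norml; apply/andP; split.
    have : E * (z - z ^+ 2) <= E * (1 - expR (- z)) by apply: ler_wpM2l => //; lra.
    have : 0 <= E * z ^+ 2 by rewrite mulr_ge0 // sqr_ge0.
    by lra.
  have : E * (expR z - 1) <= E * (z + 2 * z ^+ 2) by apply: ler_wpM2l => //; lra.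
  by lra.
have -> : F 0 - F h - E * (mu * h) = \sum_(i < N.+1) (F (u i) - F (u i.+1) - E * z).
  rewrite sumrB sumr_const card_ord -(big_mkord xpredT (fun i => F (u i) - F (u i.+1))).
  rewrite (@telescope_sumr_eq _ _ _ (fun i => - F (u i))) //; last by move=> i _; lra.
  rewrite -mulr_natr /u /z mulr0 divfK ?gt_eqF //.
  have -> : E * (mu * h / N.+1%:R) * N.+1%:R = E * (mu * h) by field; lra.
  lra.
apply: le_trans (ler_norm_sum _ _ _) _.
apply: le_trans (ler_sum _ (fun (i : 'I_N.+1) _ => step i (ltn_ord i))) _.
rewrite sumr_const card_ord -[X in X <= _]mulr_natr /z.
have -> : 2 * E * (mu * h / N.+1%:R) ^+ 2 * N.+1%:R = 2 * E * (mu * h) ^+ 2 / N.+1%:R by field; lra.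
exact: lexx.
Qed.

End RealBounds.

Section RealProbability.
Context {R : realType} {d : measure_display} {T : measurableType d}.
Variable P : probability T R.

Definition prb (A : set T) : R := fine (P A).

Lemma prbE A : measurable A -> P A = (prb A)%:E.
Proof. by move=> mA; rewrite /prb fineK // fin_num_measure. Qed.

Lemma prb_ge0 A : measurable A -> 0 <= prb A.
Proof. by move=> mA; rewrite -lee_fin -prbE. Qed.

Lemma prbT : prb setT = 1.
Proof. by rewrite /prb probability_setT. Qed.

Lemma prb_le A B : measurable A -> measurable B -> A `<=` B -> prb A <= prb B.
Proof. by move=> mA mB AB; rewrite -lee_fin -!prbE //; apply: le_measure => //; rewrite inE. Qed.

Lemma prb_le1 A : measurable A -> prb A <= 1.
Proof. by move=> mA; rewrite -prbT; apply: prb_le. Qed.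

Lemma prbU A B : measurable A -> measurable B -> A `&` B = set0 -> prb (A `|` B) = prb A + prb B.
Proof.
move=> mA mB AB; apply: EFin_inj; rewrite EFinD -!prbE //; last exact: measurableU.
exact: measureU.
Qed.

Lemma prbID A B : measurable A -> measurable B -> prb A = prb (A `&` B) + prb (A `&` ~` B).
Proof.
move=> mA mB; rewrite -prbU -?setIUr ?setUv ?setIT //.
- exact: measurableI.
- by apply: measurableI => //; exact: measurableC.
- by rewrite setIACA setICr setI0.
Qed.

End RealProbability.

Section Renewal.
Context {R : realType} {d : measure_display} {T : measurableType d}.
Variables (P : probability T R) (n : nat) (mu : R).
Hypothesis mu0 : 0 < mu.
Hypothesis n2 : (2 <= n)%N.
Local Notation mark := ('I_n * 'I_n)%type.
Local Notation prb := (prb P).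
Implicit Types (X : nat -> T -> R) (M : nat -> T -> mark) (H : set T).

Definition mark_law (B : pred mark) : R :=
  \sum_(e | B e) (if e.1 != e.2 then ((n * n.-1)%:R)^-1 else 0).

Lemma mark_law1 e : mark_law (pred1 e) = if e.1 != e.2 then ((n * n.-1)%:R)^-1 else 0.
Proof. by rewrite /mark_law big_pred1_eq. Qed.

Lemma mark_lawT : mark_law predT = 1.
Proof.
rewrite /mark_law -big_mkcond /= sumr_const -[LHS]mulr_natr.
suff -> : #|[pred e : mark | e.1 != e.2]| = (n * n.-1)%N.
  by rewrite mulVf // pnatr_eq0; lia.
have := cardC [pred e : mark | e.1 == e.2]; rewrite card_prod !card_ord.
have -> : #|[pred e : mark | e.1 == e.2]| = n.
  rewrite -[RHS]card_ord -(card_imset (f := fun i : 'I_n => (i, i))); last by move=> i j [].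
  apply: eq_card => -[a b]; rewrite inE /=; apply/eqP/imsetP => [->|[i _ [-> ->]]] //.
  by exists b.
have -> : #|[predC [pred e : mark | e.1 == e.2]]| = #|[pred e : mark | e.1 != e.2]|.
  by apply: eq_card.
by case: n n2 => //= m _; rewrite mulnS; lia.
Qed.

Lemma mark_law_ge0 B : 0 <= mark_law B.
Proof. by apply: sumr_ge0 => e _; case: ifP => // _; rewrite invr_ge0. Qed.

Definition tail X M (j : nat) (x : nat -> R) (B : nat -> pred mark) : set T :=
  [set w | forall i, (i < j)%N -> x i < X i w /\ B i (M i w)].

Definition tail_law (j : nat) (x : nat -> R) (B : nat -> pred mark) : R :=
  \prod_(i < j) (expR (- (mu * x i)) * mark_law (B i)).

Record renewal X M H : Prop := Renewal {
  ren_X : forall i, measurable_fun setT (X i);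
  ren_M : forall i, mdisc (M i);
  ren_H : measurable H;
  ren_tail : forall j x B, (forall i, 0 <= x i) ->
    prb (H `&` tail X M j x B) = prb H * tail_law j x B }.

Lemma measurable_tail X M j x B : (forall i, measurable_fun setT (X i)) ->
  (forall i, mdisc (M i)) -> measurable (tail X M j x B).
Proof.
move=> mX mM; apply: measurable_forall => i; apply: measurable_impl; first exact: measurable_const.
by apply: measurable_conj; [exact: measurable_ltS|exact: (mM i [set e | B i e])].
Qed.

Definition skip0 (h : R) X : nat -> T -> R :=
  fun i => if i is 0 then fun w => X 0 w - h else X i.
Definition skip1 (h : R) X : nat -> T -> R :=
  fun i => if i is 0 then fun w => X 0 w + X 1 w - h else X i.+1.
Definition none_ev (h : R) X : set T := [set w | h < X 0 w].
Definition one_ev (h : R) X M (B : pred mark) : set T :=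
  [set w | [/\ 0 < X 0 w, X 0 w <= h, h < X 0 w + X 1 w & B (M 0 w)]].

Lemma measurable_none_ev h X : measurable_fun setT (X 0) -> measurable (none_ev h X).
Proof. by move=> mX; exact: measurable_ltS. Qed.

Lemma measurable_one_ev h X M B : (forall i, measurable_fun setT (X i)) -> mdisc (M 0) ->
  measurable (one_ev h X M B).
Proof.
move=> mX mM; rewrite (_ : one_ev _ _ _ _ = [set w | 0 < X 0 w /\ (X 0 w <= h /\ (h < X 0 w + X 1 w /\ B (M 0 w)))]).
  apply: measurable_conj; first exact: measurable_ltS.
  apply: measurable_conj; first exact: measurable_leS.
  apply: measurable_conj; last exact: (mM [set e | B e]).
  by apply: measurable_ltS => //; exact: measurable_funD.
by apply/seteqP; split=> w /= [] // a [b [c e]].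
Qed.

Lemma renewal_none X M H h : 0 <= h -> renewal X M H ->
  renewal (skip0 h X) M (H `&` none_ev h X) /\
  prb (H `&` none_ev h X) = prb H * expR (- (mu * h)).
Proof.
move=> h0 [mX mM mH tP].
have pH : prb (H `&` none_ev h X) = prb H * expR (- (mu * h)).
  have := tP 1 (fun=> h) (fun=> predT) (fun=> h0).
  rewrite /tail_law big_ord_recl big_ord0 mulr1 mark_lawT mulr1 => <-; congr (prb (_ `&` _)).
  apply/seteqP; split=> w /=; first by move=> hX i; rewrite ltnS leqn0 => /eqP ->.
  by move=> /(_ 0%N isT)[].
split=> //; split=> //.
- by case=> [|i] //=; exact: measurable_funB.
- by apply: measurableI => //; exact: measurable_none_ev.
case=> [|j] x B x0; first by rewrite /tail_law big_ord0 mulr1; congr prb; apply/seteqP; split=> w [].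
have -> : H `&` none_ev h X `&` tail (skip0 h X) M j.+1 x B =
    H `&` tail X M j.+1 (fun i => if i is 0 then x 0 + h else x i) B.
  apply/seteqP; split=> w /= [].
    move=> [Hw hX] tl; split=> // -[|i] ij; last exact: (tl i.+1 ij).
    by have [a b] := tl 0%N ij; split=> //; move: a => /=; lra.
  move=> Hw tl; have [a b] := tl 0%N isT; split; first by split=> //; move: (x0 0%N) a => /=; rewrite /none_ev /=; lra.
  by move=> [|i] ij; [split=> //=; lra|exact: (tl i.+1 ij)].
rewrite tP; last by case=> // ; rewrite addr_ge0.
rewrite pH /tail_law !big_ord_recl /= mulrDr opprD expRD; ring.
Qed.

Lemma renewal_one X M H h C : 0 <= h -> renewal X M H ->
  renewal (skip1 h X) (fun i => M i.+1) (H `&` one_ev h X M C) /\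
  prb (H `&` one_ev h X M C) = prb H * (mu * h * expR (- (mu * h)) * mark_law C).
Proof.
move=> h0 [mX mM mH tP].
have main j x B : (forall i, 0 <= x i) ->
  prb (H `&` one_ev h X M C `&` tail (skip1 h X) (fun i => M i.+1) j.+1 x B) =
  prb H * (mu * h * expR (- (mu * h)) * mark_law C) * tail_law j.+1 x B.
  move=> x0.
  pose xt (v y : R) (i : nat) := match i with 0 => v | 1 => y | i'.+2 => x i'.+1 end.
  pose Bt (i : nat) := if i is i'.+1 then B i' else C.
  pose K := prb H * mark_law C * (mark_law (B 0) * \prod_(i < j) (expR (- (mu * x i.+1)) * mark_law (B i.+1))).
  have K0 : 0 <= K.
    by rewrite !mulr_ge0 ?prb_ge0 ?mark_law_ge0 // prodr_ge0 // => i _; rewrite mulr_ge0 ?mark_law_ge0 ?expR_ge0.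
  pose tl v y := H `&` tail X M j.+2 (xt v y) Bt.
  have mtl v y : measurable (tl v y) by apply: measurableI => //; exact: measurable_tail.
  have tlP v y : 0 <= v -> 0 <= y -> prb (tl v y) = K * (expR (- (mu * v)) * expR (- (mu * y))).
    move=> v0 y0; rewrite /tl tP; last by case=> [|[|i]] //; exact: x0.
    by rewrite /tail_law !big_ord_recl /= /K; ring.
  pose D := H `&` [set w | C (M 0 w)] `&` [set w | h + x 0 < X 0 w + X 1 w] `&`
     [set w | B 0 (M 1 w)] `&` [set w | forall i, (i < j)%N -> x i.+1 < X i.+2 w /\ B i.+1 (M i.+2 w)].
  have mD : measurable D.
    apply: measurableI; last first.
      exact: (@measurable_tail (fun i => X i.+2) (fun i => M i.+2) j (fun i => x i.+1) (fun i => B i.+1)).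
    apply: measurableI; last exact: (mM 1 [set e | B 0 e]).
    apply: measurableI; last by apply: measurable_ltS => //; exact: measurable_funD.
    by apply: measurableI => //; exact: (mM 0 [set e | C e]).
  pose F v := prb (D `&` [set w | v < X 0 w]).
  have mlt v : measurable [set w | v < X 0 w] by exact: measurable_ltS.
  have Fdiff u v : u <= v -> F u - F v = prb (D `&` [set w | u < X 0 w] `&` ~` [set w | v < X 0 w]).
    move=> uv; rewrite /F (@prbID _ _ _ P (D `&` [set w | u < X 0 w]) [set w | v < X 0 w]) //; last exact: measurableI.
    have -> : D `&` [set w | u < X 0 w] `&` [set w | v < X 0 w] = D `&` [set w | v < X 0 w].
      by apply/seteqP; split=> w /= => [[[]]//|[Dw vX]]; split=> //; split=> //; exact: le_lt_trans vX.
    by rewrite addrAC subrr add0r.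
  have tdiff u v y : 0 <= u -> u <= v -> 0 <= y ->
      prb (tl u y `&` ~` [set w | v < X 0 w]) = K * ((expR (- (mu * u)) - expR (- (mu * v))) * expR (- (mu * y))).
    move=> u0 uv y0; have v0 := le_trans u0 uv.
    have := @prbID _ _ _ P (tl u y) [set w | v < X 0 w] (mtl _ _) (mlt _).
    have -> : tl u y `&` [set w | v < X 0 w] = tl v y.
      apply/seteqP; split=> w /=.
        by move=> [[Hw th] vX]; split=> // -[|i] ij; [have [_ b] := th 0%N ij|exact: (th i.+1 ij)].
      move=> [Hw th]; have [a b] := th 0%N isT; split=> //; split=> // -[|i] ij; last exact: (th i.+1 ij).
      by split=> //=; exact: le_lt_trans a.
    by rewrite !tlP // => e; apply: (addrI (K * (expR (- (mu * v)) * expR (- (mu * y))))); rewrite -e; ring.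
  have sand u v : 0 <= u -> u <= v -> v <= h ->
      K * expR (- (mu * (h + x 0))) * (1 - expR (- (mu * (v - u)))) <= F u - F v <=
      K * expR (- (mu * (h + x 0))) * (expR (mu * (v - u)) - 1).
    move=> u0 uv vh; rewrite Fdiff //.
    have hx := x0 0%N.
    have mc y : measurable (tl u y `&` ~` [set w | v < X 0 w]).
      by apply: measurableI => //; exact: measurableC.
    have mDc : measurable (D `&` [set w | u < X 0 w] `&` ~` [set w | v < X 0 w]).
      by apply: measurableI; [exact: measurableI|exact: measurableC].
    apply/andP; split.
      have -> : K * expR (- (mu * (h + x 0))) * (1 - expR (- (mu * (v - u)))) =
          prb (tl u (h + x 0 - u) `&` ~` [set w | v < X 0 w]).
        rewrite tdiff //; last by lra.
        by rewrite -mulrA; congr (_ * _); rewrite mulrBr mulr1 mulrBl -!expRD; congr (expR _ - expR _); ring.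
      apply: prb_le => // w /= [[Hw th] vX]; split=> //.
      have [a1 a2] := th 0%N isT; have [b1 b2] := th 1%N isT; rewrite /= in a1 a2 b1 b2.
      split=> //; split; last by move=> i ij; exact: (th i.+2 ij).
      by split=> //; split=> //=; lra.
    have -> : K * expR (- (mu * (h + x 0))) * (expR (mu * (v - u)) - 1) =
          prb (tl u (h + x 0 - v) `&` ~` [set w | v < X 0 w]).
      rewrite tdiff //; last by lra.
      by rewrite -mulrA; congr (_ * _); rewrite mulrBr mulr1 mulrBl -!expRD; congr (expR _ - expR _); ring.
    apply: prb_le => // w /= [[Dw uX] vX]; split=> //; case: Dw => [[[[Hw Cw] sw] Bw] tw]; split=> //.
    move/negP: vX; rewrite -leNgt => vX.
    case=> [|[|i]] ij; [by []| |exact: (tw i ij)].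
    by split=> //=; move: sw => /=; lra.
  have := increment_sandwich (mulr_ge0 K0 (expR_ge0 _)) mu0 h0 sand; rewrite Fdiff // => e.
  transitivity (K * expR (- (mu * (h + x 0))) * (mu * h)); last first.
    rewrite /tail_law big_ord_recl /K mulrDr opprD expRD /=; ring.
  rewrite -e; congr prb; apply/seteqP; split=> w /=.
    move=> [[Hw [X0 Xh hX Cw]] th]; have [a b] := th 0%N isT; rewrite /= in a.
    split; last by apply/negP; rewrite -leNgt.
    split=> //; split; last by move=> i ij; exact: (th i.+1 ij).
    by split=> //; split=> //=; lra.
  move=> [[[[[[Hw Cw] sw] Bw] tw] X0] Xh]; move/negP: Xh; rewrite -leNgt => Xh.
  have hx := x0 0%N; split; first by split=> //; split=> //; move: sw => /=; lra.
  by move=> [|i] ij; [split=> //=; move: sw => /=; lra|exact: (tw i ij)].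
have pH : prb (H `&` one_ev h X M C) = prb H * (mu * h * expR (- (mu * h)) * mark_law C).
  have := main 0 (fun=> 0) (fun=> predT) (fun=> lexx 0).
  rewrite /tail_law big_ord_recl big_ord0 mulr0 oppr0 expR0 mark_lawT !mulr1 => <-.
  congr prb; apply/seteqP; split=> w /=; last by case.
  by move=> [Hw ow]; split=> // i; rewrite ltnS leqn0 => /eqP ->; split=> //=; case: ow; lra.
split=> //; split=> //.
- by case=> [|i] //=; apply: measurable_funB => //; exact: measurable_funD.
- by apply: measurableI => //; exact: measurable_one_ev.
case=> [|j] x B x0; last by rewrite main // pH.
by rewrite /tail_law big_ord0 mulr1; congr prb; apply/seteqP; split=> w [].
Qed.

End Renewal.

Section Windows.
Variables (R : realType) (n : nat).
Local Notation mark := ('I_n * 'I_n)%type.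
Implicit Types (E : set (R * mark)) (o : option mark).

Definition win E (s u : R) o : Prop := match o with
  | None => quiet E s u
  | Some m => exists tau, s < tau <= u /\ forall e, (E e /\ s < e.1 <= u) <-> e = (tau, m)
  end.

Lemma win_anc E s u o x : win E s u o -> anc E x u s (lin o x).
Proof.
case: o => [m|] /=; last exact: anc_quiet.
move=> [tau [h H]]; exists [:: (tau, m)]; split=> // e; split.
  by rewrite mem_seq1 => /eqP; exact: (H e).2.
by move=> /H ->; rewrite mem_head.
Qed.

Lemma win_unique E s u o o' : win E s u o -> win E s u o' -> o = o'.
Proof.
case: o o' => [m|] [m'|] //=.
- move=> [tau [h H]] [tau' [h' H']].
  by have /H'[_ ->] := (H (tau, m)).2 erefl.
- by move=> [tau [h H]] q; have [a b] := (H (tau, m)).2 erefl; have := q _ a; rewrite b.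
- by move=> q [tau [h H]]; have [a b] := (H (tau, m')).2 erefl; have := q _ a; rewrite b.
Qed.

Lemma win_ext E E' s u s' u' o : s <= s' -> u <= u' -> s' <= u ->
  (forall e, E e /\ s < e.1 <= u <-> E' e /\ s' < e.1 <= u') -> win E s u o -> win E' s' u' o.
Proof.
move=> _ _ _ H; case: o => [m|] /=; last first.
  by move=> q e Ee; apply/negP => h; have [a b] := (H e).2 (conj Ee h); have := q _ a; rewrite b.
move=> [tau [h K]]; exists tau; split; last by move=> e; rewrite -H.
by have [] := (H (tau, m)).1 ((K (tau, m)).2 erefl).
Qed.

End Windows.

Section WordEvents.
Context {R : realType} {d : measure_display} {T : measurableType d}.
Variables (P : probability T R) (n : nat) (mu : R).
Hypothesis mu0 : 0 < mu.
Hypothesis n2 : (2 <= n)%N.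
Local Notation mark := ('I_n * 'I_n)%type.
Local Notation prb := (prb P).
Implicit Types (X : nat -> T -> R) (M : nat -> T -> mark) (H : set T).

Fixpoint wev X M (l : seq (R * option mark)) : set T := match l with
  | [::] => setT
  | (h, None) :: l' => none_ev h X `&` wev (skip0 h X) M l'
  | (h, Some e) :: l' => one_ev h X M (pred1 e) `&` wev (skip1 h X) (fun i => M i.+1) l'
  end.

Definition q0 (h : R) : R := expR (- (mu * h)).
Definition th (h : R) : R := mu * h / (n * n.-1)%:R.
Definition wlaw (l : seq (R * option mark)) : R := \prod_(c <- l) Q (q0 c.1) (th c.1) c.2.

Lemma measurable_wev X M l : (forall i, measurable_fun setT (X i)) -> (forall i, mdisc (M i)) ->
  measurable (wev X M l).
Proof.
elim: l X M => [|[h [e|]] l IH] X M mX mM //=; apply: measurableI.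
- exact: measurable_one_ev.
- by apply: IH => // -[|i] //=; apply: measurable_funB => //; exact: measurable_funD.
- exact: measurable_none_ev.
- by apply: IH => // -[|i] //=; exact: measurable_funB.
Qed.

Lemma wev_law X M H l : renewal P mu X M H -> (forall c, c \in l -> 0 <= c.1) ->
  prb (H `&` wev X M l) = prb H * wlaw l.
Proof.
elim: l X M H => [|[h o] l IH] X M H rX l0.
  by rewrite /wlaw big_nil mulr1 /= setIT.
have h0 : 0 <= h by apply: (l0 (h, o)); rewrite mem_head.
have l0' c : c \in l -> 0 <= c.1 by move=> cl; apply: l0; rewrite in_cons cl orbT.
rewrite /wlaw big_cons /=; case: o {l0} => [e|] /=; rewrite setIA.
  have [rX' pH] := renewal_one mu0 n2 (pred1 e) h0 rX.
  rewrite (IH _ _ _ rX' l0') pH mark_law1 /q0 /th /wlaw; case: ifP => _; last by rewrite !(mulr0, mul0r).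
  ring.
have [rX' pH] := renewal_none mu0 n2 h0 rX.
by rewrite (IH _ _ _ rX' l0') pH mulrA.
Qed.

Definition fset (o : R) X M (w : T) : set (R * mark) :=
  [set e | exists m, e = (o + \sum_(i < m.+1) X i w, M m w)].

Lemma fset_gt o X M w e : (forall i, 0 < X i w) -> fset o X M w e -> o < e.1.
Proof.
move=> X0 [m ->] /=; rewrite ltrDl big_ord_recl ltr_pwDl //.
by apply: sumr_ge0 => i _; exact: ltW.
Qed.

Lemma fset_skip0 o h X M w : fset (o + h) (skip0 h X) M w = fset o X M w.
Proof.
by apply/seteqP; split=> e [m ->]; exists m; congr pair; rewrite !big_ord_recl /=; ring.
Qed.

Lemma fset_skip1 o h X M w :
  fset o X M w = (o + X 0 w, M 0 w) |` fset (o + h) (skip1 h X) (fun i => M i.+1) w.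
Proof.
have E m : o + h + \sum_(i < m.+1) skip1 h X i w = o + \sum_(i < m.+2) X i w.
  by rewrite !big_ord_recl /=; ring.
apply/seteqP; split=> e.
  by move=> [[|m] ->]; [left; rewrite big_ord_recl big_ord0 addr0|right; exists m; rewrite E].
by move=> [->|[m ->]]; [exists 0%N; rewrite big_ord_recl big_ord0 addr0|exists m.+1; rewrite E].
Qed.

Lemma wev_win X M l o w l1 h c l2 : (forall i, 0 < X i w) -> (forall c, c \in l -> 0 < c.1) ->
  wev X M l w -> l = l1 ++ (h, c) :: l2 ->
  win (fset o X M w) (o + \sum_(c <- l1) c.1) (o + \sum_(c <- l1) c.1 + h) c.
Proof.
elim: l1 l X M o => [|[h1 o1] l1 IH] l X M o X0 l0 wl el.
  rewrite big_nil addr0; rewrite {}el in l0 wl.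
  have h0 : 0 < h by apply: (l0 (h, c)); rewrite mem_head.
  case: c wl l0 => [e|] /= [A _] l0.
    case: A => _ Xh hX /eqP me; exists (o + X 0 w); split; first by rewrite ltrDl X0 lerD2l.
    move=> e'; rewrite (fset_skip1 o h); split=> [[[->|fe] /andP[_ b]]|->]; first by rewrite me.
      have : o + h < e'.1 by apply: fset_gt fe => -[|i] //=; lra.
      by rewrite ltNge b.
    by split; [left; rewrite me|rewrite /= ltrDl X0 lerD2l].
  move=> e fe; rewrite -(fset_skip0 o h) in fe.
  have : o + h < e.1 by apply: fset_gt fe => -[|i] //=; move: A; rewrite /none_ev /=; lra.
  by move=> he; apply/negP => /andP[_]; rewrite leNgt he.
rewrite {}el /= in l0 wl; rewrite big_cons /= !addrA.
have h0 : 0 < h1 by apply: (l0 (h1, o1)); rewrite mem_head.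
have sge : o + h1 <= o + h1 + \sum_(j <- l1) j.1.
  rewrite lerDl; rewrite big_seq sumr_ge0 // => j jl; apply/ltW/l0.
  by rewrite in_cons mem_cat jl orbT.
have hpos : 0 < h by apply: (l0 (h, c)); rewrite in_cons mem_cat mem_head !orbT.
have {}l0 c' : c' \in l1 ++ (h, c) :: l2 -> 0 < c'.1 by move=> cl; apply: l0; rewrite in_cons cl orbT.
case: o1 wl => [e|] /= [A wl]; last first.
  rewrite -(fset_skip0 o h1); apply: (IH _ _ _ _ _ l0 wl erefl).
  by case=> [|i] //=; move: A; rewrite /none_ev /=; lra.
case: A => X00 Xh hX /eqP me.
have W := IH _ _ _ (o + h1) _ l0 wl erefl.
apply: win_ext (W _) => //; first by rewrite lerDl ltW.
  move=> e'; rewrite (fset_skip1 o h1 X); split=> -[a /andP[b b']].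
    by split; [right|rewrite b b'].
  case: a => [ee|a]; last by rewrite b b'.
  by move: b; rewrite ee /= => b; suff : false by []; lra.
by case=> [|i] //=; lra.
Qed.

(* [calm N X h]: at most one event in each of the first [N] windows of length [h],
   and none in the next one. *)
Fixpoint calm (N : nat) X M (h : R) : set T :=
  if N is N'.+1 then (none_ev h X `&` calm N' (skip0 h X) M h) `|`
    (one_ev h X M predT `&` calm N' (skip1 h X) (fun i => M i.+1) h)
  else none_ev h X.

Lemma measurable_calm N X M h : (forall i, measurable_fun setT (X i)) -> (forall i, mdisc (M i)) ->
  measurable (calm N X M h).
Proof.
elim: N X M => [|N IH] X M mX mM /=; first exact: measurable_none_ev.
apply: measurableU; apply: measurableI.
- exact: measurable_none_ev.
- by apply: IH => // -[|i] //=; exact: measurable_funB.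
- exact: measurable_one_ev.
- by apply: IH => // -[|i] //=; apply: measurable_funB => //; exact: measurable_funD.
Qed.

Lemma calm_law N X M H h : 0 <= h -> renewal P mu X M H ->
  prb (H `&` calm N X M h) = prb H * ((q0 h * (1 + mu * h)) ^+ N * q0 h).
Proof.
move=> h0; elim: N X M H => [|N IH] X M H rX /=.
  by rewrite expr0 mul1r; have [] := renewal_none mu0 n2 h0 rX.
have [r0 p0] := renewal_none mu0 n2 h0 rX.
have [r1 p1] := renewal_one mu0 n2 predT h0 rX.
rewrite setIUr prbU.
- rewrite !setIA (IH _ _ _ r0) (IH _ _ _ r1) p0 p1 (mark_lawT mu0 n2) exprS /q0; ring.
- rewrite setIA; apply: measurableI; first exact: ren_H r0.
  by apply: measurable_calm; [exact: ren_X r0|exact: ren_M r0].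
- rewrite setIA; apply: measurableI; first exact: ren_H r1.
  by apply: measurable_calm; [exact: ren_X r1|exact: ren_M r1].
- apply/seteqP; split=> w //= [[_ [a _]] [_ [[_ b _ _] _]]].
  by move: a; rewrite /none_ev /= ltNge b.
Qed.

Lemma calm_nonevent N X M h w m : 0 < h -> (forall i, 0 < X i w) -> calm N X M h w ->
  \sum_(i < m.+1) X i w != N.+1%:R * h.
Proof.
move=> h0; elim: N X M m => [|N IH] X M m X0 /=.
  rewrite /none_ev /= mul1r => hX; rewrite gt_eqF // big_ord_recl.
  by apply: lt_le_trans hX _; rewrite lerDl; apply: sumr_ge0 => i _; exact: ltW.
have NE : N.+2%:R * h = N.+1%:R * h + h by rewrite -[N.+2]addn1 natrD; ring.
move=> [[a c]|[[a b c e] f]].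
  have {}IH := IH (skip0 h X) M m.
  rewrite NE -subr_eq (_ : _ - h = \sum_(i < m.+1) skip0 h X i w); last by rewrite !big_ord_recl /=; ring.
  by apply: IH => //; case=> [|i] //=; move: a; rewrite /none_ev /=; lra.
case: m => [|m].
  rewrite big_ord_recl big_ord0 addr0 lt_eqF // (le_lt_trans b) // NE ltrDr mulr_gt0 //.
have {}IH := IH (skip1 h X) (fun i => M i.+1) m.
rewrite NE -subr_eq (_ : _ - h = \sum_(i < m.+1) skip1 h X i w); last by rewrite !big_ord_recl /=; ring.
by apply: IH => //; case=> [|i] //=; lra.
Qed.

Lemma no_event_at X M (c : R) : 0 < c -> renewal P mu X M setT ->
  measurable [set w | forall i, 0 < X i w] -> prb [set w | forall i, 0 < X i w] = 1 ->
  prb [set w | exists m, \sum_(i < m.+1) X i w = c] = 0.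
Proof.
move=> c0 rX mpos ppos; set B := [set w | _].
have mX := ren_X rX; have mM := ren_M rX.
have mB : measurable B.
  by apply: measurable_exists => m; apply: measurable_eqS => //; exact: measurable_sum.
apply: (@eq_of_close _ _ _ ((mu * c) ^+ 2 + mu * c) (Num.truncn (mu * c))) => N hN.
rewrite subr0 ger0_norm ?prb_ge0 //.
set h := c / N.+1%:R; have N0 : (0 : R) < N.+1%:R by rewrite ltr0n.
have h0 : 0 < h by rewrite divr_gt0.
have mC := @measurable_calm N X M h mX mM.
have : prb B <= prb (~` (calm N X M h `&` [set w | forall i, 0 < X i w])).
  apply: prb_le => //; first by apply: measurableC; exact: measurableI.
  move=> w [m e] [cw pw]; have := calm_nonevent m h0 pw cw; rewrite e => /eqP; apply.
  by rewrite /h; field; lra.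
move=> /le_trans; apply.
have pC : prb (calm N X M h `&` [set w | forall i, 0 < X i w]) = (q0 h * (1 + mu * h)) ^+ N * q0 h.
  have := @calm_law N X M setT h (ltW h0) rX; rewrite setTI prbT mul1r => <-.
  rewrite [RHS](@prbID _ _ _ _ _ [set w | forall i, 0 < X i w]) //.
  suff -> : prb (calm N X M h `&` ~` [set w | forall i, 0 < X i w]) = 0 by rewrite addr0.
  apply/eqP; rewrite eq_le prb_ge0 ?andbT; last by apply: measurableI => //; exact: measurableC.
  have := @prbID _ _ _ P setT [set w | forall i, 0 < X i w] measurableT mpos.
  rewrite !setTI prbT ppos => e.
  apply: (@le_trans _ _ (prb (~` [set w | forall i, 0 < X i w]))); last by lra.
  by apply: prb_le => //; [apply: measurableI => //; exact: measurableC|exact: measurableC].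
have := @prbID _ _ _ P setT (calm N X M h `&` [set w | forall i, 0 < X i w]) measurableT (measurableI _ _ mC mpos).
rewrite !setTI prbT pC => e.
set z := mu * h.
have zE : z = mu * c / N.+1%:R by rewrite /z /h mulrA.
have z0 : 0 <= z by rewrite mulr_ge0 // ltW.
have z1 : z <= 1.
  rewrite zE ler_pdivrMr // mul1r; apply/ltW; apply: lt_le_trans (truncnS_gt _) _.
  by rewrite ler_nat ltnS.
have q1 : 1 - z <= q0 h by rewrite /q0 -/z; have := expR_ge1Dx (- z); lra.
have b1 : 1 - z ^+ 2 <= q0 h * (1 + z).
  by apply: le_trans (ler_wpM2r _ q1); [nra|lra].
have b2 : 1 - N%:R * z ^+ 2 <= (1 - z ^+ 2) ^+ N.
  have z2 : 0 <= z ^+ 2 by rewrite sqr_ge0.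
  have z3 : z ^+ 2 <= 1 by rewrite expr_le1.
  elim: (N) => [|m IHm]; first by rewrite mul0r subr0 expr0.
  rewrite [X in _ <= X]exprS -[m.+1]addn1 natrD; apply: le_trans (ler_wpM2l _ IHm); last by lra.
  have : 0 <= m%:R * (z ^+ 2) ^+ 2 by rewrite mulr_ge0 // sqr_ge0.
  by nra.
have b3 : (1 - z ^+ 2) ^+ N <= (q0 h * (1 + z)) ^+ N.
  apply: lerXn2r => //; rewrite nnegrE ?subr_ge0 ?expr_le1 //.
  by rewrite mulr_ge0 ?expR_ge0 //; lra.
have b4 : 1 - N%:R * z ^+ 2 - z <= (q0 h * (1 + z)) ^+ N * q0 h.
  have b5 : (1 - N%:R * z ^+ 2) <= (q0 h * (1 + z)) ^+ N by exact: le_trans b3.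
  have b6 : (q0 h * (1 + z)) ^+ N <= 1.
    rewrite exprn_ile1 // ?mulr_ge0 ?expR_ge0 //; first by lra.
    rewrite /q0 -/z -[X in _ <= X](expRxMexpNx_1 z) mulrC ler_wpM2r ?expR_ge0 //; exact: expR_ge1Dx.
  have b7 : 0 <= (q0 h * (1 + z)) ^+ N by rewrite exprn_ge0 // mulr_ge0 ?expR_ge0 //; lra.
  apply: le_trans (ler_wpM2l b7 q1); nra.
have -> : ((mu * c) ^+ 2 + mu * c) / N.+1%:R = N.+1%:R * z ^+ 2 + z by rewrite zE; field; lra.
have : N%:R * z ^+ 2 <= N.+1%:R * z ^+ 2 by rewrite ler_wpM2r ?sqr_ge0 // ler_nat.
by lra.
Qed.

End WordEvents.

Section NullSets.
Context {R : realType} {d : measure_display} {T : measurableType d}.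
Context {P : probability T R}.
Local Notation prb := (prb P).

Lemma prb_partition (E : finType) (f : T -> E) (A : set T) : mdisc f -> measurable A ->
  prb A = \sum_e prb (A `&` [set w | f w = e]).
Proof.
move=> mf mA.
have H (r : seq E) : uniq r -> prb (A `&` [set w | f w \in r]) = \sum_(e <- r) prb (A `&` [set w | f w = e]).
  elim: r => [_|e r IH /= /andP[er ur]].
    by rewrite big_nil (_ : _ `&` _ = set0) ?/prb ?measure0 //; apply/seteqP; split=> w // [].
  rewrite big_cons -IH // -prbU.
  - congr prb; apply/seteqP; split=> w /=.
      by rewrite in_cons => -[Aw /orP[/eqP|]]; [left|right].
    by rewrite in_cons => -[[Aw ->]|[Aw ->]]; rewrite ?eqxx ?orbT.
  - by apply: measurableI => //; exact: (mf [set e]).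
  - by apply: measurableI => //; exact: (mf [set` r]).
  - by apply/seteqP; split=> w //= [[_ ->] [_]]; rewrite (negbTE er).
have := H (enum E) (enum_uniq E); rewrite big_enum /= => <-; congr prb.
by apply/seteqP; split=> w /=; [rewrite mem_enum|case].
Qed.

Lemma null_exists (I : countType) (A : I -> T -> Prop) : (forall i, measurable [set w | A i w]) ->
  (forall i, prb [set w | A i w] = 0) -> prb [set w | exists i, A i w] = 0.
Proof.
move=> mA PA; pose B m := if unpickle m is Some i then [set w | A i w] else set0.
have mB m : measurable (B m) by rewrite /B; case: unpickle.
have PB m : P (B m) = 0%E by rewrite /B; case: unpickle => [i|]; rewrite ?measure0 // prbE ?PA.
have -> : [set w | exists i, A i w] = \bigcup_m B m.
  apply/seteqP; split=> w /= [i]; first by move=> Ai; exists (pickle i) => //; rewrite /B pickleK.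
  by move=> _; rewrite /B; case: unpickle => // j Aj; exists j.
rewrite /prb; suff -> : P (\bigcup_m B m) = 0%E by [].
apply/negligibleP; first exact: bigcupT_measurable.
by apply: negligible_bigcup => m; apply/negligibleP; [exact: mB|exact: PB].
Qed.

Lemma null_sub A B : measurable A -> measurable B -> A `<=` B -> prb B = 0 -> prb A = 0.
Proof. by move=> mA mB AB B0; apply/eqP; rewrite eq_le prb_ge0 // andbT -B0 prb_le. Qed.

Lemma prb0_setU A B : measurable A -> measurable B -> prb A = 0 -> prb B = 0 -> prb (A `|` B) = 0.
Proof.
move=> mA mB A0 B0; have -> : A `|` B = [set w | exists b : bool, (if b then A else B) w].
  apply/seteqP; split=> w /=; first by case; [exists true|exists false].
  by move=> [[]]; [left|right].
by apply: null_exists => -[].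
Qed.

Lemma prb_setC A : measurable A -> prb (~` A) = 1 - prb A.
Proof.
move=> mA; have := @prbID _ _ _ P setT A measurableT mA.
by rewrite !setTI prbT; lra.
Qed.

End NullSets.

Section Moran.
Context {R : realType} {d : measure_display} {T : measurableType d}.
Variables (P : probability T R) (n : nat) (mu : R).
Variables (X Y : nat -> T -> R) (Mf Mb : nat -> T -> 'I_n * 'I_n) (S : nat -> T -> 'I_n).
Hypothesis mu0 : 0 < mu.
Hypothesis n2 : (2 <= n)%N.
Hypothesis model : moran_model P mu X Y Mf Mb S.
Local Notation mark := ('I_n * 'I_n)%type.
Local Notation prb := (prb P).
Local Notation Ev := (events X Y Mf Mb).

Lemma model_mX m : measurable_fun setT (X m).
Proof. by case: model => /(_ m)[]. Qed.
Lemma model_mY m : measurable_fun setT (Y m).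
Proof. by case: model => /(_ m)[]. Qed.
Lemma model_mMf m : mdisc (Mf m).
Proof. by move=> B; case: model => _ [/(_ m B)[]]. Qed.
Lemma model_mMb m : mdisc (Mb m).
Proof. by move=> B; case: model => _ [/(_ m B)[]]. Qed.
Lemma model_mS m : mdisc (S m).
Proof. by move=> B; case: model => _ [_ [/(_ m B)]]. Qed.

Lemma model_X m x : 0 <= x -> P [set w | x < X m w] = (expR (- (mu * x)))%:E.
Proof. by case: model => _ [_ [_ [h _]]] x0; have [] := h m x x0. Qed.
Lemma model_Y m x : 0 <= x -> P [set w | x < Y m w] = (expR (- (mu * x)))%:E.
Proof. by case: model => _ [_ [_ [h _]]] x0; have [] := h m x x0. Qed.

Lemma mark_law_of (M : T -> mark) (B : pred mark) : mdisc M ->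
  (forall e, P [set w | M w = e] = (if e.1 != e.2 then ((n * n.-1)%:R)^-1 else 0)%:E) ->
  P [set w | B (M w)] = (mark_law (R := R) B)%:E.
Proof.
move=> mM h; rewrite prbE; last exact: (mM [set e | B e]).
congr EFin; rewrite (prb_partition mM); last exact: (mM [set e | B e]).
rewrite /mark_law [RHS]big_mkcond; apply: eq_bigr => e _; case: ifP => Be.
  rewrite (_ : _ `&` _ = [set w | M w = e]) ?/prb ?h //.
  by apply/seteqP; split=> w /=; [case|move=> ->].
rewrite (_ : _ `&` _ = set0) ?/prb ?measure0 //.
by apply/seteqP; split=> w //= [+ e1]; rewrite e1 Be.
Qed.

Lemma model_Mf m (B : pred mark) : P [set w | B (Mf m w)] = (mark_law (R := R) B)%:E.
Proof.
apply: mark_law_of; first exact: model_mMf.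
by move=> e; case: model => _ [_ [_ [_ [_ [/(_ m e)[]]]]]].
Qed.
Lemma model_Mb m (B : pred mark) : P [set w | B (Mb m w)] = (mark_law (R := R) B)%:E.
Proof.
apply: mark_law_of; first exact: model_mMb.
by move=> e; case: model => _ [_ [_ [_ [_ [/(_ m e)[]]]]]].
Qed.
Lemma model_S m x : P [set w | S m w = x] = (n%:R^-1)%:E.
Proof. by case: model => _ [_ [_ [_ [_ [_ [/(_ m x)]]]]]]. Qed.
Lemma model_indep : mutually_independent P (gen_events X Y Mf Mb S).
Proof. by case: model => _ [_ [_ [_ [_ [_ []]]]]]. Qed.

Definition Sset (K : nat) (z : nat -> 'I_n) : set T :=
  [set w | forall i, (i < K)%N -> S i w = z i].

Lemma measurable_Sset K z : measurable (Sset K z).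
Proof.
apply: measurable_forall => i; apply: measurable_impl; first exact: measurable_const.
exact: (model_mS i [set z i]).
Qed.

Lemma prod_EFin (I : Type) (r : seq I) (f : I -> R) :
  (\big[*%E/1%E]_(i <- r) (f i)%:E = (\prod_(i <- r) f i)%:E)%E.
Proof. by rewrite (big_morph EFin EFinM erefl). Qed.

Lemma joint_law K z j x B j' x' B' : (forall i, 0 <= x i) -> (forall i, 0 <= x' i) ->
  prb (Sset K z `&` (tail X Mf j x B `&` tail Y Mb j' x' B')) =
  n%:R^-1 ^+ K * (tail_law mu j x B * tail_law mu j' x' B').
Proof.
move=> x0 x'0.
pose len (a : 'I_5) := nth 0%N [:: j; j'; j; j'; K] a.
pose J := [seq (a, i) | a <- enum 'I_5, i <- iota 0 (len a)].
pose E (c : 'I_5 * nat) : set T := match nat_of_ord c.1 with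
  | 0 => [set w | x c.2 < X c.2 w] | 1 => [set w | x' c.2 < Y c.2 w]
  | 2 => [set w | B c.2 (Mf c.2 w)] | 3 => [set w | B' c.2 (Mb c.2 w)]
  | _ => [set w | S c.2 w = z c.2] end.
pose pe (c : 'I_5 * nat) : R := match nat_of_ord c.1 with
  | 0 => expR (- (mu * x c.2)) | 1 => expR (- (mu * x' c.2))
  | 2 => mark_law (B c.2) | 3 => mark_law (B' c.2) | _ => n%:R^-1 end.
have PE c : P (E c) = (pe c)%:E.
  case: c => -[a ha] i; rewrite /E /pe /=; case: a ha => [|[|[|[|a]]]] ha.
  - exact: model_X. - exact: model_Y. - exact: model_Mf. - exact: model_Mb. - exact: model_S.
have uJ : uniq J.
  apply: allpairs_uniq_dep; [exact: enum_uniq|by move=> a _; exact: iota_uniq|].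
  by move=> [a i] [b l] _ _ /= [-> ->].
have H r : (forall c, c \in J -> gen_events X Y Mf Mb S c (E c)) ->
    (\big[*%E/1%E]_(c <- J) P (E c))%E = r%:E -> prb (\big[setI/setT]_(c <- J) E c) = r.
  by move=> gE e; rewrite /prb model_indep // e.
have -> : Sset K z `&` (tail X Mf j x B `&` tail Y Mb j' x' B') = \big[setI/setT]_(c <- J) E c.
  rewrite -bigcap_seq; apply/seteqP; split=> w /=.
    move=> [Sw [tX tY]] [[a ha] i] /= /allpairsPdep[a' [i' [_ hi [ea ei]]]].
    move: hi; rewrite -ea -ei mem_iota add0n /= /len /= /E /=.
    case: a ha {ea ei a' i'} => [|[|[|[|[|a]]]]] ha //= hi.
    - by case: (tX i hi). - by case: (tY i hi). - by case: (tX i hi). - by case: (tY i hi).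
    - exact: Sw.
  move=> h; have inJ (a i : nat) (ha : (a < 5)%N) : (i < len (Ordinal ha))%N -> (Ordinal ha, i) \in J.
    move=> hi; apply/allpairsPdep; exists (Ordinal ha), i; split=> //; first by rewrite mem_enum.
    by rewrite mem_iota.
  split; first by move=> i hi; apply: (h (Ordinal (isT : 4 < 5)%N, i)); exact: inJ.
  split=> i hi; split.
  - by apply: (h (Ordinal (isT : 0 < 5)%N, i)); exact: inJ.
  - by apply: (h (Ordinal (isT : 2 < 5)%N, i)); exact: inJ.
  - by apply: (h (Ordinal (isT : 1 < 5)%N, i)); exact: inJ.
  - by apply: (h (Ordinal (isT : 3 < 5)%N, i)); exact: inJ.
rewrite (H (\prod_(c <- J) pe c)); last 1 first.
- by rewrite -prod_EFin; apply: eq_bigr => c _; exact: PE.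
2: { move=> [[a ha] i] _; rewrite /gen_events /E /=; case: a ha => [|[|[|[|[|a]]]]] ha //=.
  + by exists `]x i, +oo[%classic; split=> //; apply/seteqP; split=> w /=; rewrite in_itv /= andbT.
  + by exists `]x' i, +oo[%classic; split=> //; apply/seteqP; split=> w /=; rewrite in_itv /= andbT.
  + by exists [set e | B i e].
  + by exists [set e | B' i e].
  + by exists [set z i]. }
rewrite /J big_allpairs_dep big_enum /=; do 5 rewrite big_ord_recl; rewrite big_ord0 mulr1 /pe /=.
have bi m (F : nat -> R) : \prod_(i <- iota 0 m) F i = \prod_(i < m) F i.
  by rewrite -(big_mkord xpredT) /index_iota subn0.
rewrite !bi prodr_const card_ord /tail_law !big_split /=; ring.
Qed.

Lemma prb_Sset K z : prb (Sset K z) = n%:R^-1 ^+ K.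
Proof.
have := @joint_law K z 0 (fun=> 0) (fun=> predT) 0 (fun=> 0) (fun=> predT) (fun=> lexx _) (fun=> lexx _).
rewrite /tail_law !big_ord0 !mulr1 => <-; congr prb.
by apply/seteqP; split=> w //= [].
Qed.

Lemma renewal_Y K z j x B : (forall i, 0 <= x i) ->
  renewal P mu Y Mb (Sset K z `&` tail X Mf j x B).
Proof.
move=> x0; split; [exact: model_mY|exact: model_mMb| |].
  apply: measurableI; first exact: measurable_Sset.
  by apply: measurable_tail; [exact: model_mX|exact: model_mMf].
move=> j' x' B' x'0; rewrite -setIA joint_law //.
have := @joint_law K z j x B 0 (fun=> 0) (fun=> predT) x0 (fun=> lexx _).
rewrite {2}/tail_law !big_ord0 !mulr1 (_ : tail Y Mb 0 _ _ = setT) ?setIT; last by apply/seteqP; split.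
by move=> ->; rewrite mulrA.
Qed.

Lemma renewal_X K z l : (forall c, c \in l -> 0 <= c.1) ->
  renewal P mu X Mf (Sset K z `&` wev Y Mb l).
Proof.
move=> l0; have mw : measurable (wev Y Mb l) by apply: measurable_wev; [exact: model_mY|exact: model_mMb].
have key j x B : (forall i, 0 <= x i) -> prb (Sset K z `&` wev Y Mb l `&` tail X Mf j x B) =
    n%:R^-1 ^+ K * tail_law mu j x B * wlaw mu l.
  move=> x0; rewrite setIAC (wev_law mu0 n2 (renewal_Y _ _ _ _ x0) l0); congr (_ * _).
  have := @joint_law K z j x B 0 (fun=> 0) (fun=> predT) x0 (fun=> lexx _).
  by rewrite {2}/tail_law !big_ord0 !mulr1 (_ : tail Y Mb 0 _ _ = setT) ?setIT //; apply/seteqP; split.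
split; [exact: model_mX|exact: model_mMf| |].
  by apply: measurableI => //; exact: measurable_Sset.
move=> j x B x0; rewrite key //.
have := key 0 (fun=> 0) (fun=> predT) (fun=> lexx _).
rewrite {1}/tail_law !big_ord0 !mulr1 (_ : tail X Mf 0 _ _ = setT) ?setIT; last by apply/seteqP; split.
by move=> ->; ring.
Qed.

Lemma words_law K z l l' : (forall c, c \in l -> 0 <= c.1) -> (forall c, c \in l' -> 0 <= c.1) ->
  prb (Sset K z `&` (wev X Mf l `&` wev Y Mb l')) = n%:R^-1 ^+ K * (wlaw mu l * wlaw mu l').
Proof.
move=> l0 l0'; rewrite [wev X Mf l `&` _]setIC setIA (wev_law mu0 n2 (renewal_X _ _ l0') l0).
have := @renewal_Y K z 0 (fun=> 0) (fun=> predT) (fun=> lexx _).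
rewrite (_ : tail X Mf 0 _ _ = setT) ?setIT; last by apply/seteqP; split.
by move=> rY; rewrite (wev_law mu0 n2 rY l0') prb_Sset; ring.
Qed.

Definition regular (w : T) : Prop := (forall m, 0 < X m w) /\ (forall m, 0 < Y m w) /\
  (forall g : nat, exists m, g%:R < X m w) /\ (forall g : nat, exists m, g%:R < Y m w).

Lemma measurable_regular : measurable [set w | regular w].
Proof.
have mX := model_mX; have mY := model_mY.
apply: measurable_conj; first by apply: measurable_forall => m; exact: measurable_ltS.
apply: measurable_conj; first by apply: measurable_forall => m; exact: measurable_ltS.
by apply: measurable_conj; apply: measurable_forall => g; apply: measurable_exists => m; exact: measurable_ltS.
Qed.

Lemma geometric_null (a s : R) : 0 < s -> s <= 1 -> 0 <= a -> (forall m : nat, a <= (1 - s) ^+ m) -> a = 0.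
Proof.
move=> s0 s1 a0 h; apply: (@eq_of_close _ _ _ s^-1 0) => N _; rewrite subr0 ger0_norm //.
apply: le_trans (h N.+1) _; have N0 : (0 : R) < N.+1%:R by rewrite ltr0n.
have : (1 - s) ^+ N.+1 <= expR (- (N.+1%:R * s)).
  rewrite -mulrN expRM_natl lerXn2r ?nnegrE ?expR_ge0 //; first by lra.
  exact: expR_ge1Dx.
move=> /le_trans; apply; rewrite expRN -invfM lef_pV2 ?posrE ?expR_gt0 ?mulr_gt0 //.
by have := expR_ge1Dx (N.+1%:R * s); rewrite mulrC; lra.
Qed.

Lemma unbounded_gap (Z : nat -> T -> R) (a : 'I_5) (g : R) : 0 <= g ->
  (forall m, measurable_fun setT (Z m)) ->
  (forall m, P [set w | g < Z m w] = (expR (- (mu * g)))%:E) ->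
  (forall m, gen_events X Y Mf Mb S (a, m) [set w | Z m w <= g]) ->
  prb [set w | forall m, Z m w <= g] = 0.
Proof.
move=> g0 mZ pZ gZ.
have mle m : measurable [set w | Z m w <= g] by exact: measurable_leS.
apply: (@geometric_null _ (expR (- (mu * g)))); first exact: expR_gt0.
- by rewrite -expR0 ler_expR oppr_le0 mulr_ge0 // ltW.
- by apply: prb_ge0; exact: measurable_forall.
move=> m; pose J := [seq (a, i) | i <- iota 0 m].
have uJ : uniq J by rewrite map_inj_uniq ?iota_uniq // => i j [].
have := @model_indep J (fun c => [set w | Z c.2 w <= g]) uJ.
have hJ c : c \in J -> gen_events X Y Mf Mb S c [set w | Z c.2 w <= g].
  by move=> /mapP[i _ ->]; exact: gZ.
move=> /(_ hJ).
have pc c : P [set w | Z c w <= g] = (1 - expR (- (mu * g)))%:E.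
  rewrite prbE //; congr EFin; rewrite (_ : [set w | _] = ~` [set w | g < Z c w]); last first.
    by apply/seteqP; split=> w /=; rewrite leNgt => /negP.
  by rewrite prb_setC; [rewrite /prb pZ|exact: measurable_ltS].
have -> : (\big[*%E/1%E]_(c <- J) P [set w | (Z c.2 w <= g)%R])%E = ((1 - expR (- (mu * g))) ^+ m)%:E.
  rewrite (eq_bigr (fun=> (1 - expR (- (mu * g)))%:E)); last by move=> c _; exact: pc.
  by rewrite prod_EFin big_map big_const_seq count_predT size_iota iter_mulr_1.
move=> H.
have mB : measurable (\big[setI/setT]_(c <- J) [set w | Z c.2 w <= g]).
  by rewrite -bigcap_seq; apply: fin_bigcap_measurable.
have : prb (\big[setI/setT]_(c <- J) [set w | Z c.2 w <= g]) = (1 - expR (- (mu * g))) ^+ m by rewrite /prb H.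
move=> <-; apply: prb_le => //; first exact: measurable_forall.
by rewrite -bigcap_seq => w /= h c _; exact: h.
Qed.

Lemma prb_regular : prb (~` [set w | regular w]) = 0.
Proof.
have mX := model_mX; have mY := model_mY.
have pX : prb [set w | exists m, X m w <= 0] = 0.
  apply: null_exists => m; first exact: measurable_leS.
  rewrite (_ : [set w | _] = ~` [set w | 0 < X m w]); last first.
    by apply/seteqP; split=> w /=; rewrite leNgt => /negP.
  by rewrite prb_setC; [rewrite /prb model_X // mulr0 oppr0 expR0 subrr|exact: measurable_ltS].
have pY : prb [set w | exists m, Y m w <= 0] = 0.
  apply: null_exists => m; first exact: measurable_leS.
  rewrite (_ : [set w | _] = ~` [set w | 0 < Y m w]); last first.
    by apply/seteqP; split=> w /=; rewrite leNgt => /negP.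
  by rewrite prb_setC; [rewrite /prb model_Y // mulr0 oppr0 expR0 subrr|exact: measurable_ltS].
have gX : prb [set w | exists g : nat, forall m, X m w <= g%:R] = 0.
  apply: null_exists => g; first by apply: measurable_forall => m; exact: measurable_leS.
  apply: (@unbounded_gap X (Ordinal (isT : 0 < 5)%N)) => // m; first exact: model_X.
  by exists `]-oo, g%:R]%classic; split=> //; apply/seteqP; split=> w /=; rewrite in_itv.
have gY : prb [set w | exists g : nat, forall m, Y m w <= g%:R] = 0.
  apply: null_exists => g; first by apply: measurable_forall => m; exact: measurable_leS.
  apply: (@unbounded_gap Y (Ordinal (isT : 1 < 5)%N)) => // m; first exact: model_Y.
  by exists `]-oo, g%:R]%classic; split=> //; apply/seteqP; split=> w /=; rewrite in_itv.
have m1 (Z : nat -> T -> R) : (forall m, measurable_fun setT (Z m)) -> measurable [set w | exists m, Z m w <= 0].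
  by move=> mZ; apply: measurable_exists => m; exact: measurable_leS.
have m2 (Z : nat -> T -> R) : (forall m, measurable_fun setT (Z m)) ->
    measurable [set w | exists g : nat, forall m, Z m w <= g%:R].
  by move=> mZ; apply: measurable_exists => g; apply: measurable_forall => m; exact: measurable_leS.
apply: (null_sub _ _ _ (prb0_setU _ _ (prb0_setU _ _ pX pY) (prb0_setU _ _ gX gY))).
- by apply: measurableC; exact: measurable_regular.
- by apply: measurableU; apply: measurableU; [exact: m1|exact: m1|exact: m2|exact: m2].
- move=> w /= h; apply: contrapT => h2; apply: h; rewrite /regular.
  move/not_orP: h2 => [/not_orP[a b] /not_orP[c e]].
  split; first by move=> m; rewrite ltNge; apply/negP => q; apply: a; exists m.
  split; first by move=> m; rewrite ltNge; apply/negP => q; apply: b; exists m.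
  split=> g; apply: contrapT => /forallNP q; [apply: c|apply: e]; exists g => m; rewrite leNgt; exact/negP.
all: by [exact: m1|exact: m2|apply: measurableU; [exact: m1|exact: m1]|apply: measurableU; [exact: m2|exact: m2]].
Qed.

Lemma Ev_fset w e : Ev w e <-> fset 0 X Mf w e \/ fset 0 Y Mb w (- e.1, e.2).
Proof.
split.
  move=> [[m _ <-]|[m _ <-]]; [left|right]; exists m; rewrite ?add0r //.
  by rewrite /bwd_time /= opprK.
move=> [[m ->]|[m ee]]; [left|right]; exists m => //; first by rewrite /fwd_time add0r.
by case: e ee => a b /= [ea eb]; rewrite /bwd_time eb -[a in RHS]opprK ea add0r.
Qed.

Lemma fwd_pos w m : regular w -> 0 < fwd_time X w m.
Proof.
move=> [X0 _]; have := @fset_gt R d T n 0 X Mf w (0 + fwd_time X w m, Mf m w) X0.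
by rewrite /= add0r; apply; exists m; rewrite add0r.
Qed.

Lemma bwd_neg w m : regular w -> bwd_time Y w m < 0.
Proof.
move=> [_ [Y0 _]]; have := @fset_gt R d T n 0 Y Mb w (0 - bwd_time Y w m, Mb m w) Y0.
by rewrite /= add0r oppr_gt0; apply; exists m; rewrite /bwd_time opprK add0r.
Qed.

Lemma regular_lf w : regular w -> locally_finite (Ev w).
Proof.
move=> reg s u; have [X0 [Y0 [dX dY]]] := reg.
have bigX : exists a, forall m, (a <= m)%N -> u < fwd_time X w m.
  have [a ha] := dX (Num.truncn `|u|).+1; exists a => m am.
  apply: le_lt_trans (ler_norm u) _; apply: lt_trans (truncnS_gt _) _; apply: lt_le_trans ha _.
  have am1 : (a < m.+1)%N by [].
  rewrite /fwd_time (bigD1 (Ordinal am1)) //= lerDl; apply: sumr_ge0 => i _; exact: ltW.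
have bigY : exists b, forall m, (b <= m)%N -> bwd_time Y w m < s.
  have [a ha] := dY (Num.truncn `|s|).+1; exists a => m am.
  rewrite /bwd_time ltrNl; apply: le_lt_trans (ler_norm (- s)) _; rewrite normrN.
  apply: lt_trans (truncnS_gt _) _; apply: lt_le_trans ha _.
  have am1 : (a < m.+1)%N by [].
  rewrite (bigD1 (Ordinal am1)) //= lerDl; apply: sumr_ge0 => i _; exact: ltW.
have [a ha] := bigX; have [b hb] := bigY.
pose fl := [seq (fwd_time X w m, Mf m w) | m <- rev (iota 0 a)].
pose bl := [seq (bwd_time Y w m, Mb m w) | m <- iota 0 b].
have tr := @later_trans R n.
have sX : {homo fwd_time X w : i j / (i < j)%N >-> i < j}.
  apply: homo_ltn; first exact: lt_trans.
  by move=> i; rewrite /fwd_time [X in _ < X]big_ord_recr /= ltrDl.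
have sY : {homo bwd_time Y w : i j / (i < j)%N >-> j < i}.
  apply: (homo_ltn (r := fun x y => y < x)) => [y x z yx zy|i]; first exact: lt_trans zy yx.
  by rewrite /bwd_time [X in - X < _]big_ord_recr /= ltrN2 ltrDl.
exists [seq e <- fl ++ bl | s < e.1 <= u]; split; last first.
  apply: sorted_filter => //; rewrite (sorted_pairwise tr) pairwise_cat -!(sorted_pairwise tr).
  apply/and3P; split.
  - apply/allrelP => e1 e2 /mapP[m _ ->] /mapP[m' _ ->] /=.
    exact: lt_trans (bwd_neg _ reg) (fwd_pos _ reg).
  - rewrite /fl map_rev rev_sorted sorted_map.
    apply: (sub_sorted (e := ltn)); last exact: iota_ltn_sorted.
    by move=> i j /= /sX.
  - rewrite /bl sorted_map; apply: (sub_sorted (e := ltn)); last exact: iota_ltn_sorted.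
    by move=> i j /= /sY.
move=> e; rewrite mem_filter; split.
  move=> /andP[h]; rewrite mem_cat => he; split=> //.
  by case/orP: he => /mapP[m _ ->]; [left|right]; exists m.
move=> [[[m _ <-]|[m _ <-]] h]; rewrite h /= mem_cat; apply/orP; [left|right].
  apply: (map_f (fun m => (fwd_time X w m, Mf m w))); rewrite mem_rev mem_iota add0n /=.
  by rewrite ltnNge; apply/negP => /ha; move/andP: h => /= [_]; rewrite leNgt => /negP.
apply: (map_f (fun m => (bwd_time Y w m, Mb m w))); rewrite mem_iota add0n /=.
by rewrite ltnNge; apply/negP => /hb; move/andP: h => /= [h _] /(lt_trans h); rewrite ltxx.
Qed.

Definition event_at (c : R) : set T := [set w | exists e, Ev w e /\ e.1 = c].

Lemma event_atE c : event_at c =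
  [set w | exists i : bool * nat, (evt X Y Mf Mb w i).1 = c].
Proof.
apply/seteqP; split=> w /=.
  by move=> [e [/eventsE[i <-] ec]]; exists i.
by move=> [i ec]; exists (evt X Y Mf Mb w i); split=> //; apply/eventsE; exists i.
Qed.

Lemma measurable_event_at c : measurable (event_at c).
Proof.
rewrite event_atE; apply: measurable_exists => i; apply: measurable_eqS => //.
by apply: measurable_evt_time; [exact: model_mX|exact: model_mY].
Qed.

Lemma prb_event_at c : prb (event_at c) = 0.
Proof.
have mX := model_mX; have mY := model_mY.
have S0 : Sset 0 (fun=> Ordinal (ltnW n2)) = setT by apply/seteqP; split.
have rX : renewal P mu X Mf setT.
  have l0 (q : R * option mark) : q \in [::] -> 0 <= q.1 by [].
  by have := @renewal_X 0 (fun=> Ordinal (ltnW n2)) [::] l0; rewrite S0 /= setIT.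
have rY : renewal P mu Y Mb setT.
  have t0 : tail X Mf 0 (fun=> 0) (fun=> predT) = setT by apply/seteqP; split.
  by have := @renewal_Y 0 (fun=> Ordinal (ltnW n2)) 0 (fun=> 0) (fun=> predT) (fun=> lexx _); rewrite S0 t0 setIT.
have mp (Z : nat -> T -> R) : (forall m, measurable_fun setT (Z m)) -> measurable [set w | forall i, 0 < Z i w].
  by move=> mZ; apply: measurable_forall => m; exact: measurable_ltS.
have pp (Z : nat -> T -> R) : (forall m, measurable_fun setT (Z m)) -> 
    (forall w, regular w -> forall m, 0 < Z m w) -> prb [set w | forall i, 0 < Z i w] = 1.
  move=> mZ hZ; apply/eqP; rewrite eq_le prb_le1; last exact: mp.
  have <- : prb [set w | regular w] = 1.
    by have := prb_regular; rewrite prb_setC; [lra|exact: measurable_regular].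
  by apply: prb_le; [exact: measurable_regular|exact: mp|move=> w /= /hZ].
have me (Z : nat -> T -> R) (c' : R) : (forall m, measurable_fun setT (Z m)) ->
    measurable [set w | exists m, \sum_(i < m.+1) Z i w = c'].
  by move=> mZ; apply: measurable_exists => m; apply: measurable_eqS => //; exact: measurable_sum.
have mR : measurable (~` [set w | regular w]) by apply: measurableC; exact: measurable_regular.
have [c0|c0|c0] := ltrgtP c 0.
- have pc : 0 < - c by lra.
  have := no_event_at mu0 n2 pc rY (mp _ mY) (pp _ mY _).
  move=> /(_ (fun w r => r.2.1)) H.
  apply: (null_sub _ _ _ (prb0_setU _ mR H prb_regular)) => //.
  + exact: measurable_event_at.
  + by apply: measurableU => //; exact: me.
  + move=> w [e [/eventsE[[[] m] <-] ec]]; last by left; exists m; rewrite -ec /= /bwd_time opprK.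
    right=> reg; have := fwd_pos m reg; move: ec => /= ->; lra.
  + exact: me.
- have := no_event_at mu0 n2 c0 rX (mp _ mX) (pp _ mX _).
  move=> /(_ (fun w r => r.1)) H.
  apply: (null_sub _ _ _ (prb0_setU _ mR H prb_regular)) => //.
  + exact: measurable_event_at.
  + by apply: measurableU => //; exact: me.
  + move=> w [e [/eventsE[[[] m] <-] ec]]; first by left; exists m.
    right=> reg; have := bwd_neg m reg; move: ec => /= ->; lra.
  + exact: me.
- apply: (null_sub _ mR _ prb_regular); first exact: measurable_event_at.
  rewrite c0 => w [e [/eventsE[[[] m] <-] ec]] reg.
    by have := fwd_pos m reg; move: ec => /= ->; rewrite ltxx.
  by have := bwd_neg m reg; move: ec => /= ->; rewrite ltxx.
Qed.

Lemma nonevent_event_at c w : ~ event_at c w -> nonevent (Ev w) c.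
Proof. by move=> h e Ee ec; apply: h; exists e. Qed.

Lemma Ev_win_fwd w (l l1 : seq (R * option mark)) (h : R) (o : option mark) l2 : regular w -> (forall c, c \in l -> 0 < c.1) ->
  wev X Mf l w -> l = l1 ++ (h, o) :: l2 ->
  win (Ev w) (\sum_(c <- l1) c.1) (\sum_(c <- l1) c.1 + h) o.
Proof.
move=> reg l0 wl el; have [X0 [Y0 _]] := reg.
have := wev_win 0 X0 l0 wl el; rewrite !add0r; set s := \sum_(c <- l1) c.1.
have s0 : 0 <= s.
  by rewrite /s big_seq sumr_ge0 // => c cl; apply/ltW/l0; rewrite el mem_cat cl.
have h0 : 0 < h by apply: (l0 (h, o)); rewrite el mem_cat mem_head orbT.
apply: win_ext => //; first by rewrite lerDl ltW.
move=> e; split=> -[Ee he]; split=> //; first by apply/Ev_fset; left.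
case/Ev_fset: Ee => // /(fset_gt Y0) /= he'; case/andP: he => he _.
by clear el; suff : false by []; lra.
Qed.

Lemma Ev_win_bwd w (l l1 : seq (R * option mark)) (h : R) (o : option mark) l2 : regular w -> (forall c, c \in l -> 0 < c.1) ->
  wev Y Mb l w -> l = l1 ++ (h, o) :: l2 ->
  nonevent (Ev w) (- \sum_(c <- l1) c.1) -> nonevent (Ev w) (- (\sum_(c <- l1) c.1 + h)) ->
  win (Ev w) (- (\sum_(c <- l1) c.1 + h)) (- \sum_(c <- l1) c.1) o.
Proof.
move=> reg l0 wl el ne1 ne2; have [X0 [Y0 _]] := reg.
have := wev_win 0 Y0 l0 wl el; rewrite !add0r.
move: ne1 ne2; set s := \sum_(c <- l1) c.1 => ne1 ne2.
have s0 : 0 <= s.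
  by rewrite /s big_seq sumr_ge0 // => c cl; apply/ltW/l0; rewrite el mem_cat cl.
have tr e : (Ev w e /\ - (s + h) < e.1 <= - s) <-> (fset 0 Y Mb w (- e.1, e.2) /\ s < - e.1 <= s + h).
  clear el wl l0; split=> -[Ee /andP[a b]].
    case/Ev_fset: (Ee) => [/(fset_gt X0) /= e0|fe]; first by suff : false by []; lra.
    split=> //; have := ne1 _ Ee => /eqP; rewrite eq_le b /= -ltNge => c; lra.
  have Ee' : Ev w e by apply/Ev_fset; right.
  split=> //; have := ne2 _ Ee' => /eqP; rewrite eq_le negb_and -!ltNge => /orP[] c; lra.
case: o {el wl} => [m|] /=.
  move=> [tau [h1 H]]; exists (- tau); split.
    have [] := (tr (- tau, m)).2; last by [].
    by rewrite /= opprK; apply/H.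
  move=> [a b]; rewrite tr /=; split=> [/H[ea eb]|[-> ->]]; first by rewrite eb -[a]opprK ea.
  by rewrite opprK; apply/H.
move=> q e Ee; apply/negP => he; have [a b] := (tr e).1 (conj Ee he).
by have := q _ a; rewrite b.
Qed.

End Moran.

Section Expectation.
Context {R : realType} {d : measure_display} {T : measurableType d}.
Variable P : probability T R.

Definition bm (f : T -> R) : Prop := measurable_fun setT f /\ exists M, forall w, `|f w| <= M.
Definition Ex (f : T -> R) : R := (\int[P]_w f w)%R.

Lemma bm_integrable f : bm f -> P.-integrable setT (EFin \o f).
Proof.
move=> [mf [M hM]]; apply: measurable_bounded_integrable => //.
  by rewrite -ge0_fin_numE // fin_num_measure.
by exists M; split; [exact: num_real|move=> x Mx w _; exact: le_trans (hM w) (ltW Mx)].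
Qed.

Lemma bm_cst c : bm (fun=> c).
Proof. by split=> //; exists `|c|. Qed.

Lemma bmD f g : bm f -> bm g -> bm (fun w => f w + g w).
Proof.
move=> [mf [M hM]] [mg [N hN]]; split; first exact: measurable_funD.
by exists (M + N) => w; apply: le_trans (ler_normD _ _) _; exact: lerD.
Qed.

Lemma bmM f g : bm f -> bm g -> bm (fun w => f w * g w).
Proof.
move=> [mf [M hM]] [mg [N hN]]; split; first exact: measurable_funM.
by exists (M * N) => w; rewrite normrM; exact: ler_pM.
Qed.

Lemma bmZ c f : bm f -> bm (fun w => c * f w).
Proof. exact: bmM (bm_cst c). Qed.

Lemma bmB f g : bm f -> bm g -> bm (fun w => f w - g w).
Proof.
move=> bf bg; rewrite (_ : (fun w => _) = (fun w => f w + (-1) * g w)); first exact: bmD bf (bmZ _ bg).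
by apply/funext => w; rewrite mulN1r.
Qed.

Lemma bm_indic A : measurable A -> bm (\1_A).
Proof.
move=> mA; split; first exact: measurable_indic.
by exists 1 => w; rewrite indicE; case: (_ \in _); rewrite /= ?normr1 ?normr0 ?ler01.
Qed.

Lemma bm_sum (I : Type) (r : seq I) (f : I -> T -> R) : (forall i, bm (f i)) ->
  bm (fun w => \sum_(i <- r) f i w).
Proof.
move=> h; elim: r => [|i r IH].
  by rewrite (_ : (fun w => _) = fun=> 0); [exact: bm_cst|apply/funext => w; rewrite big_nil].
rewrite (_ : (fun w => _) = fun w => f i w + \sum_(j <- r) f j w); first exact: bmD.
by apply/funext => w; rewrite big_cons.
Qed.

Lemma ExD f g : bm f -> bm g -> Ex (fun w => f w + g w) = Ex f + Ex g.
Proof. by move=> bf bg; apply: RintegralD => //; exact: bm_integrable. Qed.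

Lemma ExB f g : bm f -> bm g -> Ex (fun w => f w - g w) = Ex f - Ex g.
Proof. by move=> bf bg; apply: RintegralB => //; exact: bm_integrable. Qed.

Lemma ExZ c f : bm f -> Ex (fun w => c * f w) = c * Ex f.
Proof. by move=> bf; apply: RintegralZl => //; exact: bm_integrable. Qed.

Lemma Ex_cst c : Ex (fun=> c) = c.
Proof. by rewrite /Ex Rintegral_cst // -[fine _]/(prb P setT) prbT mulr1. Qed.

Lemma Ex_le f g : bm f -> bm g -> (forall w, f w <= g w) -> Ex f <= Ex g.
Proof. by move=> bf bg h; apply: le_Rintegral => //; exact: bm_integrable. Qed.

Lemma Ex_indic A : measurable A -> Ex (\1_A) = prb P A.
Proof. by move=> mA; rewrite /Ex /Rintegral integral_indic // setIT. Qed.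

Lemma Ex_sum (I : Type) (r : seq I) (f : I -> T -> R) : (forall i, bm (f i)) ->
  Ex (fun w => \sum_(i <- r) f i w) = \sum_(i <- r) Ex (f i).
Proof.
move=> h; elim: r => [|i r IH].
  by rewrite big_nil (_ : (fun w => _) = fun=> 0); [exact: Ex_cst|apply/funext => w; rewrite big_nil].
rewrite big_cons -IH -ExD //; last exact: bm_sum.
by congr Ex; apply/funext => w; rewrite big_cons.
Qed.

Lemma Ex_norm_le f g : bm f -> bm g -> (forall w, `|f w| <= g w) -> `|Ex f| <= Ex g.
Proof.
move=> bf bg h; rewrite ler_norml; apply/andP; split.
  rewrite -mulN1r -ExZ //; apply: Ex_le => // [|w]; first exact: bmZ.
  by have := h w; rewrite ler_norml mulN1r => /andP[].
by apply: Ex_le => // w; have := h w; rewrite ler_norml => /andP[].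
Qed.

End Expectation.

Section Grid.
Variable R : realType.

Record grid (sp : seq R) (delta len : R) (sg : nat -> R) (N Nf : nat) : Prop := Grid {
  grid_lt : forall m, (m < N)%N -> sg m.+1 < sg m;
  grid_mesh : forall m, (m < N)%N -> sg m - sg m.+1 <= delta;
  grid_const : forall m, (N <= m)%N -> sg m = sg N;
  grid_Nf : (Nf <= N)%N;
  grid_0 : sg Nf = 0;
  grid_sp : forall c, c \in sp -> exists2 m, (m < N)%N & sg m.+1 = c;
  grid_len : sg 0%N - sg N <= len }.

Lemma grid_exists (sp : seq R) : exists len, forall delta, 0 < delta ->
  exists sg N Nf, grid sp delta len sg N Nf.
Proof.
pose B := \sum_(c <- sp) `|c|.
have B0 : 0 <= B by apply: sumr_ge0.
have spB c : c \in sp -> `|c| <= B.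
  move=> csp; rewrite /B (perm_big _ (perm_to_rem csp)) big_cons /= lerDl; exact: sumr_ge0.
exists (B *+ 2 + 3) => delta d0.
pose lo := - (B + 1); pose hi := B + 2.
pose M := (Num.truncn ((hi - lo) / delta)).+1.
pose G := hi :: 0 :: sp ++ [seq lo + j%:R * delta | j <- iota 0 M].
have hilo : 0 <= (hi - lo) / delta by rewrite divr_ge0 ?(ltW d0) // /hi /lo; lra.
have unif j : (j < M)%N -> lo <= lo + j%:R * delta <= hi.
  move=> jM; rewrite lerDl mulr_ge0 ?(ltW d0) //=.
  by rewrite -lerBrDl -ler_pdivlMr // -truncn_ge_nat.
have GB c : c \in G -> lo <= c <= hi.
  rewrite !in_cons mem_cat => /or3P[/eqP ->|/eqP ->|/orP[/spB|/mapP[j]]].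
  - by rewrite /lo /hi; lra.
  - by rewrite /lo /hi; lra.
  - by rewrite ler_norml /lo /hi => /andP[]; lra.
  - by rewrite mem_iota add0n => /= /unif h ->.
pose s := sort <=%O (undup G).
have ss : sorted <%O s by rewrite sort_lt_sorted undup_uniq.
have ms c : (c \in s) = (c \in G) by rewrite mem_sort mem_undup.
have s0 : (0 < size s)%N by have : hi \in s; [rewrite ms mem_head|case: (s)].
pose N := (size s).-1.
have sN : size s = N.+1 by rewrite /N prednK.
pose tau i := nth 0 s i.
have tmono i j : (i < N.+1)%N -> (j < N.+1)%N -> (tau i < tau j) = (i < j)%N.
  by rewrite -sN => hi' hj; exact: (lt_sorted_ltn_nth 0 ss).
have tin i : (i < N.+1)%N -> tau i \in G by rewrite -sN -ms => h; exact: mem_nth.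
have tex c : c \in G -> exists2 i, (i < N.+1)%N & tau i = c.
  by rewrite -ms => cs; exists (index c s); [rewrite -sN index_mem|exact: nth_index].
have [i0 i0N e0] : exists2 i, (i < N.+1)%N & tau i = 0 by apply: tex; rewrite !in_cons eqxx orbT.
exists (fun m => tau (N - m)%N), N, (N - i0)%N; split.
- by move=> m mN; rewrite tmono; lia.
- move=> m mN; rewrite leNgt; apply/negP => gap.
  set x := tau (N - m.+1)%N in gap; set y := tau (N - m)%N in gap.
  have /GB/andP[xlo xhi] : x \in G by apply: tin; lia.
  have yG : y \in G by apply: tin; lia.
  have xd0 : 0 <= (x - lo) / delta by rewrite divr_ge0 ?(ltW d0) ?subr_ge0.
  pose j := (Num.truncn ((x - lo) / delta)).+1.
  have jx : x < lo + j%:R * delta.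
    by rewrite -ltrBlDl -ltr_pdivrMr //; exact: truncnS_gt.
  have jy : lo + j%:R * delta < y.
    have := xd0; rewrite -truncn_le ler_pdivlMr // => h.
    rewrite /j -natr1 mulrDl mul1r; lra.
  have jM : (j < M)%N.
    rewrite /M ltnS -(ler_nat R).
    have /GB/andP[_ yhi] := yG.
    have : j%:R <= (hi - lo) / delta by rewrite ler_pdivlMr // lerBrDl; lra.
    by move=> h; rewrite ler_nat truncn_ge_nat.
  have : lo + j%:R * delta \in G.
    by rewrite !in_cons mem_cat; apply/or3P/Or33; apply/orP; right; apply/mapP; exists j => //; rewrite mem_iota.
  move=> /tex[r rN er]; rewrite -er in jx jy; move: jx jy.
  by rewrite /x /y !tmono; lia.
- by move=> m Nm; congr tau; lia.
- lia.
- by rewrite subKn //; lia.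
- move=> c csp; have [i iN ei] : exists2 i, (i < N.+1)%N & tau i = c.
    by apply: tex; rewrite !in_cons mem_cat csp !orbT.
  have ilt : (i < N)%N.
    rewrite ltn_neqAle -ltnS iN andbT; apply/eqP => iE.
    have [h hN eh] : exists2 i, (i < N.+1)%N & tau i = hi by apply: tex; rewrite mem_head.
    have : tau i < tau h by rewrite ei eh; have := spB _ csp; rewrite ler_norml /hi => /andP[]; lra.
    by rewrite tmono // iE; lia.
  exists (N - i.+1)%N; first by lia.
  by have -> : (N - (N - i.+1).+1 = i)%N by lia.
- rewrite subn0 subnn; have /GB/andP[a b] := tin N (ltnSn _); have /GB/andP[a' b'] := tin 0%N isT.
  by rewrite mulr2n; move: a b a' b'; rewrite /lo /hi; lra.
Qed.

End Grid.

Section SimpleForm.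
Variables (R : realType) (n : nat) (mu : R) (t : nat -> R) (k : nat) (Av : nat -> R).

Definition pp (u s : R) : R := Num.max (u - s) 0.

Definition ellS (x : R) : R :=
  (\sum_(1 <= i < k.+1) (x < t i)%R)%N%:R - (\sum_(2 <= j < k.+1) (x < Av j)%R)%N%:R.

Definition IS (s : R) : R := \sum_(1 <= i < k.+1) pp (t i) s - \sum_(2 <= j < k.+1) pp (Av j) s.

Definition lam : R := mu / ('C(n, 2))%:R.

Definition rS (i : nat) : R := (n%:R - ellS (t i) - 1) / (n%:R - ellS (t i)).

Definition FS (a : R) (sel : R -> bool) : R :=
  expR (- (lam * IS a)) * \prod_(1 <= i < k.+1 | liveb t k Av i && sel (t i)) rS i.

Lemma pp_diff u s v : s <= v -> 0 <= pp u s - pp u v <= v - s.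
Proof. by rewrite /pp => sv; have [] := leP (u - s) 0; have [] := leP (u - v) 0; lra. Qed.

Lemma pp_diff_mono u u' s v : s <= v -> u <= u' -> pp u s - pp u v <= pp u' s - pp u' v.
Proof.
rewrite /pp => sv uu; have [] := leP (u - s) 0; have [] := leP (u - v) 0;
  have [] := leP (u' - s) 0; have [] := leP (u' - v) 0; lra.
Qed.

Lemma pp_jump u s v : s <= v -> (s < u -> v <= u) -> pp u s - pp u v = (v - s) * (nat_of_bool (s < u)%R)%:R.
Proof.
rewrite /pp => sv; have [su /(_ isT) vu|us _] := ltP s u.
  rewrite mulr1; have [] := leP (u - s) 0; have [] := leP (u - v) 0; lra.
rewrite mulr0; have [] := leP (u - s) 0; have [] := leP (u - v) 0; lra.
Qed.

Hypothesis Ab : forall j, (2 <= j <= k)%N -> Av j <= t j.-1.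

Lemma IS_diff s v : s <= v -> 0 <= IS s - IS v <= k%:R * (v - s).
Proof.
move=> sv.
have E : IS s - IS v = \sum_(1 <= i < k.+1) (pp (t i) s - pp (t i) v)
   - \sum_(2 <= j < k.+1) (pp (Av j) s - pp (Av j) v) by rewrite /IS !sumrB; ring.
rewrite E; apply/andP; split; last first.
  apply: (@le_trans _ _ (\sum_(1 <= i < k.+1) (pp (t i) s - pp (t i) v))).
    by rewrite gerBl sumr_ge0 // => j _; have /andP[] := pp_diff (Av j) sv.
  apply: (@le_trans _ _ (\sum_(1 <= i < k.+1) (v - s))).
    by apply: ler_sum => i _; have /andP[] := pp_diff (t i) sv.
  by rewrite sumr_const_nat subn1 /= mulr_natl.
rewrite subr_ge0; case: k Ab => [|k'] Ab'; first by rewrite !big_geq.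
rewrite big_add1 /= [X in _ <= X]big_nat_recr //=.
apply: (@le_trans _ _ (\sum_(1 <= i < k'.+1) (pp (t i) s - pp (t i) v))).
  apply: ler_sum_nat => i hi; apply: pp_diff_mono => //.
  by apply: (Ab' i.+1); lia.
by rewrite lerDl; have /andP[] := pp_diff (t k'.+1) sv.
Qed.

Lemma IS_jump s v : s <= v -> (forall i, (1 <= i <= k)%N -> s < t i -> v <= t i) ->
  (forall j, (2 <= j <= k)%N -> s < Av j -> v <= Av j) ->
  IS s - IS v = (v - s) * ellS s.
Proof.
move=> sv ht hA.
have -> : IS s - IS v = \sum_(1 <= i < k.+1) (pp (t i) s - pp (t i) v)
   - \sum_(2 <= j < k.+1) (pp (Av j) s - pp (Av j) v) by rewrite /IS !sumrB; ring.
rewrite /ellS mulrBr !natr_sum !mulr_sumr; congr (_ - _); apply: eq_big_nat => i hi.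
  by apply: pp_jump => //; apply: ht; lia.
by apply: pp_jump => //; apply: hA; lia.
Qed.

End SimpleForm.

Lemma lamE (R : realType) (n : nat) (mu h : R) : (2 <= n)%N ->
  2 * th n mu h = lam n mu * h.
Proof.
move=> n2; rewrite /th /lam.
have -> : (n * n.-1 = 2 * 'C(n, 2))%N by rewrite -mul_bin_diag bin1.
have c0 : ('C(n, 2))%:R != 0 :> R by rewrite pnatr_eq0 -lt0n bin_gt0.
by rewrite natrM; field.
Qed.

Section GoodPath.
Variables (R : realType) (n : nat) (Ev : set (R * ('I_n * 'I_n))).
Variables (S : nat -> 'I_n) (t : nat -> R) (k : nat).
Hypothesis lf : locally_finite Ev.
Hypothesis tinc : forall i j, (1 <= i)%N -> (i < j)%N -> t i < t j.
Hypothesis attach_ne : forall j, (2 <= j <= k)%N -> attach_set Ev S t j !=set0.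
Hypothesis tne : forall i, (1 <= i)%N -> nonevent Ev (t i).
Local Notation Av := (attach Ev S t).
Local Notation ellS := (ellS t k Av).

Lemma ellS_card x : ellS x = #|lineages Ev S t k x|%:R.
Proof. by rewrite /ellS (card_lineages_le lf tinc attach_ne). Qed.

Lemma ell_ellS x : ell t k Av x = ellS x.
Proof. by rewrite (ellE lf tinc attach_ne tne). Qed.

Lemma Av_bound j : (2 <= j <= k)%N -> Av j <= t j.-1.
Proof. by move=> hj; apply: (attach_bound tinc) (attach_ne hj); lia. Qed.

Lemma Av_quiet s v j : s <= v -> quiet Ev s v -> (forall i, (1 <= i <= k)%N -> s < t i -> v <= t i) ->
  (2 <= j <= k)%N -> s < Av j -> v <= Av j.
Proof.
move=> sv q ht hj /(attach_gt lf tinc _ (attach_ne hj))[i [hi si m]].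
apply: attach_le; exists i; split=> //.
have vi : v <= t i by apply: ht => //; lia.
have vj : v <= t j by apply: le_trans vi (ltW (tinc _ _)); lia.
case/(meetE S t lf): m => _ [_ e]; apply/(meetE S t lf); split=> //; split=> //.
by rewrite -!(pos_quiet S lf sv _ q).
Qed.

Lemma live_ellS i : (1 <= i <= k)%N -> liveb t k Av i -> ellS (t i) <= n%:R - 1.
Proof.
move=> hi; rewrite (live_card lf tinc attach_ne tne hi) ellS_card => Sn.
have : (#|lineages Ev S t k (t i)| < n)%N.
  rewrite -[X in (_ < X)%N](card_ord n) -cardsT; apply: proper_card.
  rewrite finset.properEneq finset.subsetT andbT; apply: contraNneq Sn => ->; by rewrite inE.
by rewrite lerBrDr natr1 ler_nat.
Qed.

Lemma rS_bound i : (1 <= i <= k)%N -> liveb t k Av i -> 0 <= rS n t k Av i <= 1.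
Proof.
move=> hi li; have h := live_ellS hi li; rewrite /rS.
have h0 : 0 < n%:R - ellS (t i) by lra.
apply/andP; split; first by apply: divr_ge0; lra.
by rewrite ler_pdivrMr // mul1r; lra.
Qed.

Lemma IS_top v : (forall i, (1 <= i <= k)%N -> t i <= v) -> IS t k Av v = 0.
Proof.
move=> h; have z u : u <= v -> pp u v = 0 by move=> uv; rewrite /pp max_r // subr_le0.
rewrite /IS big_nat_cond [X in _ - X]big_nat_cond !big1 ?subrr // => i; rewrite andbT => hi; apply: z.
  by apply: le_trans (Av_bound _) (h _ _); lia.
by apply: h; lia.
Qed.

Lemma IS_ge0 a : 0 <= IS t k Av a.
Proof.
have h i : (1 <= i <= k)%N -> t i <= Num.max a (t k).
  by move=> hi; rewrite le_max (tle tinc) ?orbT //; lia.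
have av : a <= Num.max a (t k) by rewrite le_max lexx.
by have /andP[] := IS_diff Av_bound av; rewrite (IS_top h) subr0.
Qed.

Lemma FS_bound mu a sel : 0 <= mu -> 0 <= FS n mu t k Av a sel <= 1.
Proof.
move=> mu0; have e1 : expR (- (lam n mu * IS t k Av a)) <= 1.
  by rewrite -expR0 ler_expR oppr_le0 mulr_ge0 ?IS_ge0 // divr_ge0.
have : 0 <= \prod_(1 <= i < k.+1 | liveb t k Av i && sel (t i)) rS n t k Av i <= 1.
  rewrite big_nat_cond; elim/big_rec: _ => [|i z]; first by rewrite ler01 lexx.
  move=> /andP[hi /andP[li _]] /andP[z0 z1].
  have /andP[r0 r1] : 0 <= rS n t k Av i <= 1 by apply: rS_bound => //; lia.
  by rewrite mulr_ge0 //= mulr_ile1.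
by move=> /andP[p0 p1]; rewrite /FS mulr_ge0 ?expR_ge0 //= mulr_ile1 ?expR_ge0.
Qed.

End GoodPath.

Section Core.
Context {R : realType} {d : measure_display} {T : measurableType d}.
Variables (P : probability T R) (n : nat) (mu : R).
Variables (X Y : nat -> T -> R) (Mf Mb : nat -> T -> 'I_n * 'I_n) (S : nat -> T -> 'I_n).
Hypothesis mu0 : 0 < mu.
Hypothesis n2 : (2 <= n)%N.
Hypothesis model : moran_model P mu X Y Mf Mb S.
Variables (t : nat -> R) (k : nat).
Hypothesis tinc : forall i j, (1 <= i)%N -> (i < j)%N -> t i < t j.
Variables (a : R) (L : seq (nat * nat * R)).
Hypothesis hL : forall c, c \in L -> (1 <= c.1.1)%N && (c.1.1 < c.1.2 <= k)%N.
Local Notation mark := ('I_n * 'I_n)%type.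
Local Notation prb := (prb P).
Local Notation Ev := (events X Y Mf Mb).
Local Notation slots := {ffun 'I_k.+1 -> 'I_n}.

Definition special : seq R := a :: [seq t i | i <- iota 1 k.+1] ++ [seq c.2 | c <- L].

Variables (delta len : R) (sg : nat -> R) (N Nf : nat).
Hypothesis Hg : grid special delta len sg N Nf.

Definition hs m : R := sg m - sg m.+1.

Lemma sg_lt i j : (i < j)%N -> (j <= N)%N -> sg j < sg i.
Proof.
elim: j => // j IH; rewrite ltnS leq_eqVlt => /orP[/eqP ->|ij] jN; first exact: (grid_lt Hg).
by apply: lt_trans (IH ij (ltnW jN)); exact: (grid_lt Hg).
Qed.

Lemma sg_le i j : (i <= j)%N -> sg j <= sg i.
Proof.
have H i' j' : (i' <= j')%N -> (j' <= N)%N -> sg j' <= sg i'.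
  by rewrite leq_eqVlt => /orP[/eqP ->//|h] h'; exact/ltW/sg_lt.
move=> ij; have [jN|Nj] := leqP j N; first exact: H.
rewrite (grid_const Hg (ltnW Nj)); have [iN|Ni] := leqP i N; first exact: H.
by rewrite (grid_const Hg (ltnW Ni)).
Qed.

Lemma hs_ge0 m : 0 <= hs m.
Proof. by rewrite subr_ge0 sg_le. Qed.

Lemma node c m : c \in special -> sg m.+1 <= c -> c < sg m -> c = sg m.+1.
Proof.
move=> csp h1 h2; have [m' m'N e] := grid_sp Hg csp.
rewrite -e in h1 h2 *; congr sg.
have a1 : (m' <= m)%N.
  rewrite leqNgt; apply/negP => mm'; have := @sg_lt m.+1 m'.+1 mm' m'N.
  by rewrite ltNge h1.
have a2 : (m < m'.+1)%N by rewrite ltnNge; apply/negP => /sg_le; rewrite leNgt h2.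
by apply/eqP; rewrite eqn_leq a2 ltnS a1.
Qed.

Lemma sp_t i : (1 <= i <= k.+1)%N -> t i \in special.
Proof. by move=> hi; rewrite in_cons mem_cat; apply/orP; right; apply/orP; left; apply: map_f; rewrite mem_iota; lia. Qed.

Lemma sp_a : a \in special. Proof. exact: mem_head. Qed.

Lemma sp_L c : c \in L -> c.2 \in special.
Proof. by move=> cL; rewrite in_cons mem_cat; apply/orP; right; apply/orP; right; exact: map_f. Qed.

Lemma sp_top c : c \in special -> c < sg 0%N.
Proof. by move=> /(grid_sp Hg)[m mN <-]; exact: sg_lt. Qed.

Definition prm m (i : 'I_k.+1) : bool := (0 < i)%N && (sg m <= t i).
Definition ypm m : bool := sg m <= t k.+1.
Definition actm m : bool := a <= sg m.+1.
Definition gm m (x : slots) : R := \prod_(c <- L) (if c.2 == sg m then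
   [&& prm m (inord c.1.1), prm m (inord c.1.2) & x (inord c.1.1) == x (inord c.1.2)]%:R else 1).
Definition qm m : R := q0 mu (hs m).
Definition tm m : R := th n mu (hs m).

Lemma gm_local m : local (prm m) (gm m).
Proof.
move=> x x' /agreeP h; apply: eq_bigr => c _; case: ifP => // _; congr (nat_of_bool _)%:R.
by case p1: (prm m _) => //=; case p2: (prm m _) => //=; rewrite !h.
Qed.

Lemma gm_sym m : symmetric_fun (gm m).
Proof.
move=> u v x; apply: eq_bigr => c _; case: ifP => // _; congr (nat_of_bool _)%:R.
by rewrite !ffunE (inj_eq perm.perm_inj).
Qed.

Lemma gm_bound m x : 0 <= gm m x <= 1.
Proof.
rewrite /gm; elim/big_rec: _ => [|c z _ /andP[z0 z1]]; first by rewrite ler01 lexx.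
by case: ifP => _; rewrite ?mul1r ?z0 //; case: [&& _, _ & _]; rewrite /= ?mul1r ?mul0r ?z0 ?lexx ?ler01.
Qed.

Lemma actm_down m : actm m.+1 -> actm m.
Proof. by rewrite /actm => h; apply: le_trans h _; exact: sg_le. Qed.

Lemma prm_up m : prm m.+1 =1 prm m \/
  exists2 i, ~~ prm m i & forall j, prm m.+1 j = (j == i) || prm m j.
Proof.
have [/existsP[i /and3P[i0 h1 h2]]|/existsPn h] :=
    boolP [exists i : 'I_k.+1, [&& (0 < i)%N, sg m.+1 <= t i & t i < sg m]].
  have ei : t i = sg m.+1 by apply: node => //; apply: sp_t; have := ltn_ord i; lia.
  right; exists i; first by rewrite /prm i0 /= -ltNge.
  move=> j; rewrite /prm; case: eqP => [->|ji] /=; first by rewrite i0.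
  case j0: (0 < j)%N => //=; apply/idP/idP; last by apply: le_trans; exact: sg_le.
  move=> hj; rewrite leNgt; apply/negP => hj2; apply: ji; apply/val_inj.
  have ej : t j = sg m.+1 by apply: node => //; apply: sp_t; have := ltn_ord j; lia.
  by apply: (t_inj tinc) => //; rewrite ei ej.
left=> i; rewrite /prm; case i0: (0 < i)%N => //=; apply/idP/idP; last by apply: le_trans; exact: sg_le.
by move=> h1; have := h i; rewrite i0 h1 /= -leNgt.
Qed.

Lemma ypm_prm m : ypm m = false -> forall i, prm m i = false.
Proof.
move=> y i; apply/negbTE; rewrite negb_and -ltNge; case i0: (0 < i)%N => //=.
move/negbT: y; rewrite -ltNge; apply: lt_trans; apply: tinc => //; exact: ltn_ord.
Qed.

Lemma prm0 i : prm 0 i = false.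
Proof.
apply/negbTE; rewrite negb_and -ltNge; case i0: (0 < i)%N => //=.
by apply: sp_top; apply: sp_t; have := ltn_ord i; lia.
Qed.

Definition GN (w : T) : Prop := regular X Y w /\ forall m, (m <= N)%N -> ~ event_at X Y Mf Mb (sg m) w.

Local Notation posw w := (pos (Ev w) (S^~ w) t).
Definition Inv (w : T) m (x : slots) (y : 'I_n) : Prop :=
  (forall i : 'I_k.+1, (0 < i)%N -> (if sg m <= t i then posw w i (sg m) else S i w) = x i) /\
  (if sg m <= t k.+1 then posw w k.+1 (sg m) else S k.+1 w) = y.

Lemma Inv_coord w m o i : GN w -> (m < N)%N -> win (Ev w) (sg m.+1) (sg m) o ->
  (1 <= i <= k.+1)%N ->
  (if sg m.+1 <= t i then posw w i (sg m.+1) else S i w) =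
  (let z := if sg m <= t i then posw w i (sg m) else S i w in if sg m <= t i then lin o z else z).
Proof.
move=> [reg _] mN wn hi /=; have lf := regular_lf Mf Mb reg.
case: ifP => [h1|/negbT]; last first.
  rewrite -ltNge => h; have : t i < sg m by apply: lt_le_trans h _; exact: sg_le.
  by rewrite ltNge => /negbTE ->.
case: ifP => [h2|/negbT]; last first.
  move=> h2; rewrite (negbTE h2); move: h2; rewrite -ltNge => h2.
  rewrite -(node (sp_t hi) h1 h2); exact: pos_self.
rewrite h2 /pos (ancf_comp lf _ (sg_le (leqnSn m)) h2); apply: (ancfE lf); exact: win_anc.
Qed.

Lemma Inv_step w m o x y : GN w -> (m < N)%N -> win (Ev w) (sg m.+1) (sg m) o -> Inv w m x y ->
  Inv w m.+1 (stp (prm m) o x) (ymove ypm m o y).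
Proof.
move=> gn mN wn [hx hy]; split.
  move=> i i0; rewrite (Inv_coord gn mN wn); last by have := ltn_ord i; lia.
  by rewrite /= hx // ffunE /prm i0.
by rewrite (Inv_coord gn mN wn) /= ?hy // leqnn.
Qed.

Local Notation attached w c := (attach_set (Ev w) (S^~ w) t k.+1 c).
Definition uw (w : T) m : R := if actm m then (~~ `[< attached w (sg m.+1) >])%:R else 1.
Definition gw (w : T) m : R := \prod_(c <- L) (if c.2 == sg m then
   (`[< meet (Ev w) (S^~ w) t c.1.1 c.1.2 c.2 >])%:R else 1).

Lemma Inv_occ w m x y : GN w -> Inv w m x y -> (y \in occ (prm m) x) = `[< attached w (sg m) >].
Proof.
move=> [reg _] [hx hy]; have lf := regular_lf Mf Mb reg.
apply/occP/asboolP => [[i /andP[i0 hi] e]|[i [/andP[i1 ik] /(meetE (S^~ w) t lf)[h1 [h2 e]]]]].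
  have hk : sg m <= t k.+1 by apply: le_trans hi (ltW (tinc i0 (ltn_ord i))).
  exists i; split; first by rewrite i0 ltn_ord.
  apply/(meetE (S^~ w) t lf); split=> //; split=> //.
  by have := hx i i0; rewrite hi => ->; rewrite e -hy hk.
have ei : (inord i : 'I_k.+1) = i :> nat by rewrite inordK.
exists (inord i); first by rewrite /prm ei i1.
by rewrite -hx ei // h1 e -hy h2.
Qed.

Lemma Inv_gm w m x y : GN w -> Inv w m x y -> gm m x = gw w m.
Proof.
move=> [reg _] [hx hy]; have lf := regular_lf Mf Mb reg.
rewrite /gm /gw big_seq [RHS]big_seq; apply: eq_bigr => c /hL hc; case: eqP => // ec.
have e1 : (inord c.1.1 : 'I_k.+1) = c.1.1 :> nat by rewrite inordK; lia.
have e2 : (inord c.1.2 : 'I_k.+1) = c.1.2 :> nat by rewrite inordK; lia.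
have p1 : (0 < c.1.1)%N by lia. have p2 : (0 < c.1.2)%N by lia.
congr (nat_of_bool _)%:R; rewrite /prm e1 e2 p1 p2 /=.
apply/and3P/asboolP => [[h1 h2 /eqP]|].
  rewrite -!hx ?e1 ?e2 // h1 h2 => e; apply/(meetE (S^~ w) t lf); rewrite ec; split=> //; split=> //.
move=> /(meetE (S^~ w) t lf); rewrite ec => -[h1 [h2 e]]; split=> //.
by rewrite -!hx ?e1 ?e2 // h1 h2 e.
Qed.

Definition windows w m (s : seq (option mark)) : Prop :=
  forall i, (i < size s)%N -> win (Ev w) (sg (m + i).+1) (sg (m + i)) (nth None s i).

Lemma PhiU_E w s m x y : GN w -> (m + size s <= N)%N -> windows w m s -> Inv w m x y ->
  PhiU prm ypm actm gm m s x y = \prod_(i < size s) (uw w (m + i) * gw w (m + i).+1).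
Proof.
move=> gn; elim: s m x y => [|o s IH] m x y mN wn iv; first by rewrite big_ord0.
rewrite /= in mN; rewrite big_ord_recl /= addn0.
have mN' : (m < N)%N by lia.
have w0 : win (Ev w) (sg m.+1) (sg m) o by have := wn 0%N isT; rewrite addn0.
have iv' := Inv_step gn mN' w0 iv.
congr (_ * _).
  by rewrite /facU (Inv_occ gn iv') (Inv_gm gn iv').
rewrite IH //; [|by lia|by move=> i hi; have := wn i.+1 hi; rewrite addnS].
by apply: eq_bigr => i _; rewrite /bump /= add1n addnS addSn.
Qed.

Definition lfw (s : seq (option mark)) : seq (R * option mark) :=
  [seq (hs (Nf - i.+1), nth None s (Nf - i.+1)) | i <- iota 0 Nf].
Definition lbw (s : seq (option mark)) : seq (R * option mark) :=
  [seq (hs (Nf + i), nth None s (Nf + i)) | i <- iota 0 (N - Nf)].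

Lemma sum_lfw s j : (j <= Nf)%N ->
  \sum_(c <- [seq (hs (Nf - i.+1), nth (None : option mark) s (Nf - i.+1)) | i <- iota 0 j]) c.1 = sg (Nf - j)%N.
Proof.
move=> jN; rewrite big_map /=.
have E : \sum_(0 <= i < j) hs (Nf - i.+1) = sg (Nf - j)%N - sg (Nf - 0)%N.
  apply: (@telescope_sumr_eq _ _ _ (fun i => sg (Nf - i)%N)) => // i hi.
  by rewrite /hs; congr (_ - sg _); lia.
by move: E; rewrite /index_iota !subn0 (grid_0 Hg) subr0.
Qed.

Lemma sum_lbw s j :
  \sum_(c <- [seq (hs (Nf + i), nth (None : option mark) s (Nf + i)) | i <- iota 0 j]) c.1 = - sg (Nf + j)%N.
Proof.
rewrite big_map /=.
have E : \sum_(0 <= i < j) hs (Nf + i) = - sg (Nf + j)%N - - sg (Nf + 0)%N.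
  apply: (@telescope_sumr_eq _ _ _ (fun i => - sg (Nf + i)%N)) => // i hi.
  by rewrite /hs addnS opprK addrC.
by move: E; rewrite /index_iota !subn0 addn0 (grid_0 Hg) oppr0 subr0.
Qed.

Lemma lfw_pos s c : c \in lfw s -> 0 < c.1.
Proof.
move=> /mapP[i]; rewrite mem_iota => hi -> /=; rewrite subr_gt0; apply: (grid_lt Hg).
by have := grid_Nf Hg; lia.
Qed.

Lemma lbw_pos s c : c \in lbw s -> 0 < c.1.
Proof.
move=> /mapP[i]; rewrite mem_iota => hi -> /=; rewrite subr_gt0; apply: (grid_lt Hg).
by have := grid_Nf Hg; lia.
Qed.

Local Notation idx := (N.-tuple (option mark) * slots * 'I_n)%type.
Definition zz (x : slots) (y : 'I_n) (i : nat) : 'I_n := if (i < k.+1)%N then x (inord i) else y.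
Definition Omega (c : idx) : set T :=
  Sset S k.+2 (zz c.1.2 c.2) `&` (wev X Mf (lfw c.1.1) `&` wev Y Mb (lbw c.1.1)).

Lemma iota_split i j : (i < j)%N -> iota 0 j = iota 0 i ++ i :: iota i.+1 (j - i.+1).
Proof. by move=> ij; rewrite -{1}(subnKC (ltnW ij)) iotaD add0n; case: (j - i)%N (subnSK ij) => // l [->]. Qed.

Lemma Omega_windows c w : GN w -> Omega c w -> windows w 0 c.1.1.
Proof.
case: c => -[s x] y /= [reg ne] [_ [wX wY]] m; rewrite size_tuple => mN; rewrite !add0n.
have NfN := grid_Nf Hg.
have [mf|mf] := ltnP m Nf.
  have hi : (Nf - m.+1 < Nf)%N by lia.
  have E : lfw s = [seq (hs (Nf - i.+1), nth None s (Nf - i.+1)) | i <- iota 0 (Nf - m.+1)] ++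
      (hs m, nth None s m) :: [seq (hs (Nf - i.+1), nth None s (Nf - i.+1)) | i <- iota (Nf - m.+1).+1 (Nf - (Nf - m.+1).+1)].
    rewrite /lfw (iota_split hi) map_cat /=; congr (_ ++ (hs _, nth None s _) :: _); lia.
  have := Ev_win_fwd Mb reg (@lfw_pos s) wX E; rewrite sum_lfw; last by lia.
  have -> : (Nf - (Nf - m.+1) = m.+1)%N by lia.
  by rewrite /hs addrC subrK.
have hi : (m - Nf < N - Nf)%N by lia.
have E : lbw s = [seq (hs (Nf + i), nth None s (Nf + i)) | i <- iota 0 (m - Nf)] ++
      (hs m, nth None s m) :: [seq (hs (Nf + i), nth None s (Nf + i)) | i <- iota (m - Nf).+1 (N - Nf - (m - Nf).+1)].
  rewrite /lbw (iota_split hi) map_cat /=; congr (_ ++ (hs _, nth None s _) :: _); lia.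
have := @Ev_win_bwd _ _ _ _ X Y Mf Mb w _ _ _ _ _ reg (@lbw_pos s) wY E; rewrite sum_lbw.
have -> : (Nf + (m - Nf) = m)%N by lia.
have -> : - sg m + hs m = - sg m.+1 by rewrite /hs; ring.
rewrite !opprK; apply; apply: nonevent_event_at; apply: ne; lia.
Qed.

Lemma Omega_Inv c w : Omega c w -> Inv w 0 c.1.2 c.2.
Proof.
case: c => -[s x] y /= [hS _]; split.
  move=> i i0; have : t i < sg 0%N by apply/sp_top/sp_t; have := ltn_ord i; lia.
  rewrite ltNge => /negbTE ->; rewrite hS; last by apply: ltnW; rewrite ltnS; exact: ltn_ord.
  by rewrite /zz ltn_ord inord_val.
have : t k.+1 < sg 0%N by apply/sp_top/sp_t; lia.
by rewrite ltNge => /negbTE ->; rewrite hS // /zz ltnn.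
Qed.

Lemma Omega_inj c c' w : GN w -> Omega c w -> Omega c' w -> c = c'.
Proof.
move=> gn h h'; have W := Omega_windows gn h; have W' := Omega_windows gn h'.
case: c h W => -[s x] y /= [hS _] W; case: c' h' W' => -[s' x'] y' /= [hS' _] W'.
have -> : s = s'.
  apply: val_inj; apply: (@eq_from_nth _ None); first by rewrite !size_tuple.
  by move=> i hi; apply: win_unique (W i hi) (W' i _); rewrite size_tuple; rewrite size_tuple in hi.
have zE i : (i < k.+2)%N -> zz x y i = zz x' y' i by move=> hi; rewrite -hS // -hS'.
have -> : x = x'.
  by apply/ffunP => i; have := zE i (ltnW (ltn_ord i)); rewrite /zz ltn_ord inord_val.
by have := zE k.+1 (ltnSn _); rewrite /zz ltnn => ->.
Qed.

Lemma measurable_Omega c : measurable (Omega c).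
Proof.
apply: measurableI; first exact: (measurable_Sset model).
apply: measurableI; apply: measurable_wev.
- exact: (model_mX model). - exact: (model_mMf model). - exact: (model_mY model). - exact: (model_mMb model).
Qed.

Local Notation W s := (word_law qm tm 0 N s).

Lemma Omega_law c : prb (Omega c) = n%:R^-1 ^+ k.+2 * W c.1.1.
Proof.
rewrite /Omega (words_law mu0 n2 model); last 2 first.
- by move=> q /lfw_pos/ltW. - by move=> q /lbw_pos/ltW.
congr (_ * _); rewrite /wlaw !big_map /= /word_law.
under [RHS]eq_bigr do rewrite add0n.
set F := fun m => Q (qm m) (tm m) (nth None c.1.1 m).
rewrite -(big_mkord xpredT F) (big_cat_nat (leq0n Nf) (grid_Nf Hg)) /=; congr (_ * _).
  rewrite -{1}[Nf]subn0 -/(index_iota 0 Nf) [RHS]big_nat_rev /=; apply: eq_bigr => i _.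
  by rewrite add0n.
have -> : \prod_(Nf <= i < N) F i = \prod_(0 <= i < N - Nf) F (i + Nf)%N.
  by rewrite -{1}[Nf]add0n big_addn.
by rewrite /index_iota subn0; apply: eq_bigr => i _; rewrite addnC.
Qed.

Lemma sum_idx (f : N.-tuple (option mark) -> slots -> 'I_n -> R) :
  \sum_(c : idx) f c.1.1 c.1.2 c.2 = \sum_s \sum_x \sum_y f s x y.
Proof. by rewrite !pair_bigA. Qed.

Lemma sum_Omega (f : N.-tuple (option mark) -> R) :
  \sum_(c : idx) f c.1.1 * prb (Omega c) = \sum_s f s * W s.
Proof.
under eq_bigr do rewrite Omega_law.
rewrite (sum_idx (fun s x y => f s * (n%:R^-1 ^+ k.+2 * W s))); apply: eq_bigr => s _.
rewrite !sumr_const card_ffun !card_ord -mulrnA -[LHS]mulr_natr natrM natrX.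
have n0 : (n%:R : R) != 0 by rewrite pnatr_eq0; lia.
have -> : n%:R * n%:R ^+ k.+1 = (n%:R ^+ k.+2 : R) by rewrite -exprS.
have : n%:R^-1 ^+ k.+2 * n%:R ^+ k.+2 = 1 :> R by rewrite -exprMn mulVf // expr1n.
move: (n%:R^-1 ^+ k.+2) (n%:R ^+ k.+2) => u v e; rewrite -[RHS]mulr1 -e; ring.
Qed.

Lemma sum_Phi : \sum_(c : idx) PhiU prm ypm actm gm 0 c.1.1 c.1.2 c.2 * prb (Omega c) =
  \sum_(c : idx) PhiF tm prm actm gm 0 c.1.1 c.1.2 * prb (Omega c).
Proof.
under eq_bigr do rewrite Omega_law. under [RHS]eq_bigr do rewrite Omega_law.
rewrite (sum_idx (fun s x y => PhiU prm ypm actm gm 0 s x y * (n%:R^-1 ^+ k.+2 * W s))).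
rewrite (sum_idx (fun s x y => PhiF tm prm actm gm 0 s x * (n%:R^-1 ^+ k.+2 * W s))).
have := sum_VU_VF qm tm gm_local gm_sym actm_down prm_up ypm_prm N prm0.
move=> /(congr1 (fun z => n%:R^-1 ^+ k.+2 * z)).
have -> : \sum_x \sum_y VU qm tm prm ypm actm gm N 0 x y =
    \sum_(s : N.-tuple (option mark)) \sum_x \sum_y W s * PhiU prm ypm actm gm 0 s x y.
  rewrite [RHS]exchange_big /=; apply: eq_bigr => x _; rewrite [RHS]exchange_big /=.
  by apply: eq_bigr => y _; rewrite VU_words.
have -> : n%:R * (\sum_x VF qm tm prm actm gm N 0 x) =
    \sum_(s : N.-tuple (option mark)) \sum_x \sum_(y : 'I_n) W s * PhiF tm prm actm gm 0 s x.
  rewrite [RHS]exchange_big /= mulr_sumr; apply: eq_bigr => x _; rewrite [RHS]exchange_big /=.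
  by rewrite VF_words sumr_const card_ord mulr_natl.
rewrite !mulr_sumr => E; etransitivity; [|etransitivity; [exact: E|]].
  apply: eq_bigr => s _; rewrite mulr_sumr; apply: eq_bigr => x _; rewrite mulr_sumr.
  by apply: eq_bigr => y _; ring.
apply: eq_bigr => s _; rewrite mulr_sumr; apply: eq_bigr => x _; rewrite mulr_sumr.
by apply: eq_bigr => y _; ring.
Qed.

Lemma tmE m : tm m * (n * n.-1)%:R = mu * hs m.
Proof. by rewrite /tm /th divfK // pnatr_eq0 muln_eq0 negb_or; lia. Qed.

Definition mass : R := \sum_(c : idx) prb (Omega c).

Lemma massE : mass = \prod_(m < N) (qm m * (1 + mu * hs m)).
Proof.
have := sum_Omega (fun=> 1); under eq_bigr do rewrite mul1r.
under [X in _ = X -> _]eq_bigr do rewrite mul1r /word_law.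
rewrite /mass => ->; under eq_bigr do under eq_bigr do rewrite add0n.
rewrite (sum_tuple_prod N (fun i o => Q (qm i) (tm i) o)); apply: eq_bigr => m _.
by rewrite sumQ tmE.
Qed.

Lemma prod_lower (f e : nat -> R) r : (forall i, (i < r)%N -> 0 <= f i <= 1) ->
  (forall i, (i < r)%N -> 1 - e i <= f i) -> 1 - \sum_(i < r) e i <= \prod_(i < r) f i <= 1.
Proof.
elim: r => [|r IH] h1 h2; first by rewrite !big_ord0 subr0 !lexx.
have /andP[a1 a2] := IH (fun i ir => h1 i (ltnW ir)) (fun i ir => h2 i (ltnW ir)).
have /andP[b1 b2] := h1 r (ltnSn _); have c := h2 r (ltnSn _).
have p0 : 0 <= \prod_(i < r) f i by apply: prodr_ge0 => i _; have /andP[] := h1 i (ltnW (ltn_ord i)).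
rewrite !big_ord_recr /= [X in _ && X]mulr_ile1 // andbT; nra.
Qed.

Lemma fac_bound m : 0 <= qm m * (1 + mu * hs m) <= 1 /\ 1 - (mu * hs m) ^+ 2 <= qm m * (1 + mu * hs m).
Proof.
have z0 : 0 <= mu * hs m by rewrite mulr_ge0 ?hs_ge0 // ltW.
rewrite /qm /q0; move: (mu * hs m) z0 => z z0.
have h1 := expR_ge1Dx z; have h2 := expR_ge1Dx (- z); have e0 := expR_gt0 (- z).
split; last by apply: (@le_trans _ _ ((1 - z) * (1 + z))); [nra|apply: ler_wpM2r => //; lra].
apply/andP; split; first by apply: mulr_ge0; [exact: ltW|lra].
by rewrite -[X in _ <= X](expRxMexpNx_1 z) mulrC; apply: ler_wpM2r => //; exact: ltW.
Qed.

Lemma sum_hs2 : \sum_(m < N) hs m ^+ 2 <= delta * len.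
Proof.
have E : \sum_(m < N) hs m = sg 0%N - sg N.
  rewrite -(big_mkord xpredT hs) (@telescope_sumr_eq _ _ _ (fun i => - sg i)) // ?opprK 1?addrC // => i _.
  by rewrite /hs; ring.
apply: (@le_trans _ _ (delta * \sum_(m < N) hs m)); last first.
  rewrite E; apply: ler_wpM2l; last exact: (grid_len Hg).
  have N0 : (0 < N)%N by have [m mN _] := grid_sp Hg sp_a; lia.
  by apply: le_trans (hs_ge0 0) (grid_mesh Hg N0).
rewrite mulr_sumr; apply: ler_sum => m _; rewrite expr2; apply: ler_wpM2r; first exact: hs_ge0.
exact: (grid_mesh Hg).
Qed.

Lemma mass_bound : 0 <= 1 - mass <= mu ^+ 2 * (delta * len).
Proof.
have /andP[a1 a2] := @prod_lower (fun m => qm m * (1 + mu * hs m)) (fun m => (mu * hs m) ^+ 2) N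
   (fun i _ => (fac_bound i).1) (fun i _ => (fac_bound i).2).
rewrite massE subr_ge0 a2 /=; apply: le_trans (ler_wpM2l (sqr_ge0 mu) sum_hs2).
have e : \sum_(i < N) (mu * hs i) ^+ 2 = mu ^+ 2 * \sum_(i < N) hs i ^+ 2.
  by rewrite mulr_sumr; apply: eq_bigr => i _; rewrite exprMn.
by move: a1; rewrite e; lra.
Qed.

Lemma Q_ge0 m (o : option mark) : 0 <= Q (qm m) (tm m) o.
Proof.
rewrite /Q; case: o => [e|]; last exact: expR_ge0.
by case: ifP => // _; rewrite mulr_ge0 ?expR_ge0 // divr_ge0 // mulr_ge0 ?hs_ge0 // ltW.
Qed.

Lemma sum_additive (phi : nat -> option mark -> R) : (forall m o, 0 <= phi m o) ->
  \sum_(s : N.-tuple (option mark)) (\sum_(m < N) phi m (nth None s m)) * W s <=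
  \sum_(m < N) \sum_o phi m o * Q (qm m) (tm m) o.
Proof.
move=> p0; under eq_bigr do rewrite mulr_suml.
rewrite exchange_big /=; apply: ler_sum => m _.
pose f (i : nat) o := (if i == m then phi i o else 1) * Q (qm i) (tm i) o.
have E (s : N.-tuple (option mark)) : phi m (nth None s m) * W s = \prod_(i < N) f i (nth None s i).
  rewrite /f big_split /= (bigD1 m) //= eqxx big1 ?mulr1; last by move=> i im; rewrite val_eqE (negbTE im).
  by congr (_ * _); apply: eq_bigr => i _; rewrite add0n.
under eq_bigr do rewrite E.
rewrite (sum_tuple_prod N f None) (bigD1 m) //= {1}/f eqxx.
apply: ler_piMr; first by apply: sumr_ge0 => o _; rewrite mulr_ge0 ?Q_ge0.
elim/big_rec: _ => // i z im z1.
have -> : \sum_o f i o = qm i * (1 + mu * hs i).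
  by rewrite -tmE -sumQ; apply: eq_bigr => o _; rewrite /f val_eqE (negbTE im) mul1r.
have [/andP[c0 c1] _] := fac_bound i.
by apply: le_trans (ler_wpM2l c0 z1) _; rewrite mulr1.
Qed.

Lemma Ex_null (F : T -> R) (G : set T) : bm F -> measurable G -> prb (~` G) = 0 ->
  Ex P (fun w => F w * \1_G w) = Ex P F.
Proof.
move=> bF mG G0; have [mF [M hM]] := bF.
have b1 := bm_indic mG; have b2 := bm_indic (measurableC mG).
apply/eqP; rewrite eq_sym -subr_eq0 -ExB //; last exact: bmM.
rewrite -normr_le0; apply: (@le_trans _ _ (Ex P (fun w => M * \1_(~` G) w))); last first.
  by rewrite ExZ // Ex_indic ?G0 ?mulr0 //; exact: measurableC.
apply: Ex_norm_le; [exact: bmB (bmM _ _)|exact: bmZ|] => w.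
rewrite !indicE in_setC; case: (w \in G); rewrite /= ?mulr1 ?mulr0 ?subrr ?normr0 ?subr0 //.
Qed.

Lemma approx (G : set T) (f : T -> R) (c D : idx -> R) : measurable G -> prb (~` G) = 0 ->
  (forall w, G w -> GN w) -> bm f -> (forall w, `|f w| <= 1) -> (forall i, 0 <= D i) ->
  (forall i w, G w -> Omega i w -> `|f w - c i| <= D i) ->
  `|Ex P f - \sum_i c i * prb (Omega i)| <= \sum_i D i * prb (Omega i) + (1 - mass).
Proof.
move=> mG G0 GGN bf f1 D0 h.
have bO i : bm (\1_(Omega i) : T -> R) by apply: bm_indic; exact: measurable_Omega.
have bS (u : idx -> R) : bm (fun w => \sum_i u i * \1_(Omega i) w) by apply: bm_sum => i; exact: bmZ.
have ES (u : idx -> R) : Ex P (fun w => \sum_i u i * \1_(Omega i) w) = \sum_i u i * prb (Omega i).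
  rewrite Ex_sum; last by move=> i; exact: bmZ.
  by apply: eq_bigr => i _; rewrite ExZ // Ex_indic //; exact: measurable_Omega.
have bG := bm_indic mG.
pose g w := f w - \sum_i c i * \1_(Omega i) w.
pose e w := \sum_i D i * \1_(Omega i) w + (1 - \sum_i 1 * \1_(Omega i) w).
have bg : bm g by exact: bmB.
have be : bm e by apply: bmD => //; apply: bmB => //; exact: bm_cst.
have -> : Ex P f - \sum_i c i * prb (Omega i) = Ex P (fun w => g w * \1_G w).
  by rewrite Ex_null // ExB // ES.
have -> : \sum_i D i * prb (Omega i) + (1 - mass) = Ex P (fun w => e w * \1_G w).
  rewrite Ex_null // ExD //; last by apply: bmB => //; exact: bm_cst.
  rewrite ExB //; last exact: bm_cst.
  by rewrite !ES Ex_cst; congr (_ + (_ - _)); apply: eq_bigr => i _; rewrite mul1r.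
apply: Ex_norm_le; [exact: bmM|exact: bmM|] => w.
rewrite normrM [`|\1_G w|]ger0_norm // [\1_G w]indicE.
have [|] := boolP (w \in G); rewrite /= ?mulr0 // !mulr1 inE => Gw.
have [[i Oi]|none] := pselect (exists i, Omega i w).
  have S1 (u : idx -> R) : \sum_j u j * \1_(Omega j) w = u i.
    rewrite (bigD1 i) //= big1 ?addr0; first by rewrite indicE mem_set // mulr1.
    move=> j ji; rewrite indicE memNset ?mulr0 // => Oj; move/eqP: ji; apply.
    exact: Omega_inj (GGN _ Gw) Oj Oi.
  by rewrite /g /e !S1 subrr addr0; exact: h.
have S0 (u : idx -> R) : \sum_j u j * \1_(Omega j) w = 0.
  by apply: big1 => j _; rewrite indicE memNset ?mulr0 // => Oj; apply: none; exists j.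
by rewrite /g /e !S0 !subr0 add0r.
Qed.

Definition UE : set T := [set w | ~ attached w a /\
  forall c, c \in L -> meet (Ev w) (S^~ w) t c.1.1 c.1.2 c.2].
Definition Eset : set T := [set w | forall c, c \in L -> meet (Ev w) (S^~ w) t c.1.1 c.1.2 c.2].

Lemma act_idx m0 m : (m0 < N)%N -> sg m0.+1 = a -> (m < N)%N -> actm m = (m <= m0)%N.
Proof.
move=> m0N e mN; rewrite /actm -e; apply/idP/idP; last by move=> h; exact: sg_le.
by rewrite leNgt; apply: contraNT; rewrite -ltnNge => h; apply: sg_lt.
Qed.

Lemma prod_uw w : GN w -> \prod_(i < N) uw w i = (~~ `[< attached w a >])%:R.
Proof.
move=> [reg _]; have lf := regular_lf Mf Mb reg; have [m0 m0N e] := grid_sp Hg sp_a.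
case: asboolP => [at_a|nat_a] /=.
  by rewrite (bigD1 (Ordinal m0N)) //= /uw (act_idx m0N e m0N) leqnn e asboolT //= mul0r.
apply: big1 => i _; rewrite /uw; case: ifP => // ai; rewrite asboolF //= => at_i; apply: nat_a.
by apply: (attach_set_down lf) at_i.
Qed.

Lemma prod_gw w : \prod_(i < N) gw w i.+1 =
  \prod_(c <- L) (`[< meet (Ev w) (S^~ w) t c.1.1 c.1.2 c.2 >])%:R.
Proof.
rewrite /gw exchange_big /= big_seq [RHS]big_seq; apply: eq_bigr => c cL.
have [m mN e] := grid_sp Hg (sp_L cL).
rewrite (bigD1 (Ordinal mN)) //= e eqxx big1 ?mulr1 // => i im.
case: eqP => // e'; suff : i = Ordinal mN by move=> h; rewrite h eqxx in im.
apply: val_inj => /=; apply/eqP; rewrite eqn_leq; apply/andP; split; rewrite leqNgt; apply/negP => lt.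
  have := @sg_lt m.+1 i.+1 lt (ltn_ord i); rewrite e e' ltxx //.
by have := @sg_lt i.+1 m.+1 lt mN; rewrite e e' ltxx.
Qed.

Lemma prod_meet w : \prod_(c <- L) (`[< meet (Ev w) (S^~ w) t c.1.1 c.1.2 c.2 >])%:R = \1_Eset w :> R.
Proof.
rewrite indicE; have [h|h] := pselect (Eset w).
  by rewrite mem_set // big_seq big1 // => c cL; rewrite asboolT //; exact: h.
rewrite memNset //=; have /existsNP[c /not_implyP[cL nm]] : ~ forall c, c \in L -> meet (Ev w) (S^~ w) t c.1.1 c.1.2 c.2 by [].
by rewrite (perm_big _ (perm_to_rem cL)) big_cons /= asboolF // mul0r.
Qed.

Lemma UE_indic w : GN w -> \1_UE w = \prod_(i < N) (uw w i * gw w i.+1).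
Proof.
move=> gn; rewrite big_split /= prod_uw // prod_gw prod_meet !indicE -natrM mulnb; congr (nat_of_bool _)%:R.
by apply/idP/andP => [|[/asboolPn h1]]; rewrite !inE; [move=> [h1 h2]; split=> //; exact/asboolPn|move=> h2; split].
Qed.

Lemma measurable_Eset : measurable Eset.
Proof.
have -> : Eset = [set w | forall i : nat, (i < size L)%N ->
    meet (Ev w) (S^~ w) t (nth (0%N, 0%N, 0) L i).1.1 (nth (0%N, 0%N, 0) L i).1.2 (nth (0%N, 0%N, 0) L i).2].
  apply/seteqP; split=> w /= h; first by move=> i iL; apply: h; exact: mem_nth.
  by move=> c /(nthP (0%N, 0%N, 0))[i iL <-]; exact: h.
apply: measurable_forall => i; apply: measurable_impl; first exact: measurable_const.
exact: (measurable_meet t (model_mX model) (model_mY model) (model_mMf model) (model_mMb model) (model_mS model)).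
Qed.

Lemma measurable_UE : measurable UE.
Proof.
apply: measurable_conj; last exact: measurable_Eset.
apply: (@measurable_notP _ _ (fun w => attached w a)).
exact: (measurable_attach_set t (model_mX model) (model_mY model) (model_mMf model) (model_mMb model) (model_mS model)).
Qed.

Lemma measurable_GN : measurable [set w | GN w].
Proof.
apply: measurable_conj; first exact: (measurable_regular model).
apply: measurable_forall => m; apply: measurable_impl; first exact: measurable_const.
by apply: (@measurable_notP _ _ (event_at X Y Mf Mb (sg m))); exact: (measurable_event_at model).
Qed.

Lemma prb_GN : prb (~` [set w | GN w]) = 0.
Proof.
have mR := measurable_regular model; have mE := measurable_event_at model.
have e0 : prb [set w | exists m, event_at X Y Mf Mb (sg m) w] = 0.
  by apply: null_exists => m; [exact: mE|exact: (prb_event_at mu0 n2 model)].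
have mex : measurable [set w | exists m, event_at X Y Mf Mb (sg m) w] by apply: measurable_exists => m; exact: mE.
have H : prb (~` [set w | regular X Y w] `|` [set w | exists m, event_at X Y Mf Mb (sg m) w]) = 0.
  by rewrite prb0_setU //; [exact: measurableC|exact: (prb_regular mu0 model)].
apply: null_sub H.
- by apply: measurableC; exact: measurable_GN.
- by apply: measurableU => //; exact: measurableC.
- move=> w /= h; have [r|] := pselect (regular X Y w); last by left.
  by right; apply: contrapT => /forallNP h2; apply: h; split=> // m _; exact: h2.
Qed.

Lemma UE_approx : `|prb UE - \sum_(c : idx) PhiF tm prm actm gm 0 c.1.1 c.1.2 * prb (Omega c)| <= 1 - mass.
Proof.
rewrite -sum_Phi -Ex_indic; last exact: measurable_UE.
have := @approx [set w | GN w] (\1_UE) (fun c => PhiU prm ypm actm gm 0 c.1.1 c.1.2 c.2) (fun=> 0)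
  measurable_GN prb_GN (fun w h => h) (bm_indic measurable_UE).
rewrite [X in _ <= X + _]big1 ?add0r; last by move=> i _; rewrite mul0r.
apply=> //; first by move=> w; rewrite indicE; case: (_ \in _); rewrite /= ?normr1 ?normr0 ?ler01.
move=> c w gn Ow.
rewrite (PhiU_E gn _ (Omega_windows gn Ow) (Omega_Inv Ow)) size_tuple ?add0n //.
by rewrite UE_indic // subrr normr0.
Qed.

Lemma sum_PhiF : \sum_(c : idx) PhiF tm prm actm gm 0 c.1.1 c.1.2 * prb (Omega c) =
  n%:R^-1 ^+ k.+2 * (n%:R * \sum_x VF qm tm prm actm gm N 0 x).
Proof.
under eq_bigr do rewrite Omega_law.
rewrite (sum_idx (fun s x y => PhiF tm prm actm gm 0 s x * (n%:R^-1 ^+ k.+2 * W s))).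
rewrite exchange_big /= mulrCA 2!mulr_sumr; apply: eq_bigr => x _; rewrite exchange_big /= sumr_const card_ord.
rewrite VF_words !mulr_sumr -sumrMnl; apply: eq_bigr => s _; rewrite -mulr_natl; ring.
Qed.

Hypothesis k1 : (1 <= k)%N.
Hypothesis small1 : lam n mu * delta * k.+1%:R <= 1.
Hypothesis small2 : mu * delta <= 2^-1.

Lemma hs_delta m : hs m <= delta.
Proof.
have [mN|Nm] := ltnP m N; first exact: (grid_mesh Hg).
rewrite /hs (grid_const Hg Nm) (grid_const Hg (leqW Nm)) subrr.
have N0 : (0 < N)%N by have [i iN _] := grid_sp Hg sp_a; lia.
by apply: le_trans (hs_ge0 0) (grid_mesh Hg N0).
Qed.

Lemma tm_ge0 m : 0 <= tm m.
Proof. by rewrite divr_ge0 // mulr_ge0 ?hs_ge0 // ltW. Qed.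

Lemma lam_ge0 : 0 <= lam n mu.
Proof. by rewrite divr_ge0 // ltW. Qed.

Lemma small_hs m : lam n mu * hs m * k.+1%:R <= 1.
Proof.
apply: le_trans small1; apply: ler_wpM2r => //; apply: ler_wpM2l; [exact: lam_ge0|exact: hs_delta].
Qed.

Lemma small_tm m : 2 * tm m * k.+1%:R <= 1.
Proof. by rewrite /tm lamE // small_hs. Qed.

Lemma UE_small : a <= t 1%N -> prb UE <= expR (- (th n mu (t 1%N - a))) + (1 - mass).
Proof.
move=> at1.
have [m0 m0N e0] := grid_sp Hg sp_a.
have [m1 m1N e1] : exists2 m, (m < N)%N & sg m.+1 = t 1%N by apply: (grid_sp Hg); apply: sp_t.
have m10 : (m1 <= m0)%N.
  rewrite leqNgt; apply/negP => lt; have := @sg_lt m0.+1 m1.+1 lt m1N; rewrite e0 e1 => h.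
  by move: at1; rewrite leNgt h.
pose b m := if actm m && [exists i, prm m i] then expR (- tm m) else 1.
have VB x : VF qm tm prm actm gm N 0 x <= \prod_(i < N) b i.
  have := @VF_bound R n k qm tm prm actm gm b N 0 x.
  have -> : \prod_(i < N) b (0 + i)%N = \prod_(i < N) b i by apply: eq_bigr => i _; rewrite add0n.
  move=> H; suff /andP[] : 0 <= VF qm tm prm actm gm N 0 x <= \prod_(i < N) b i by [].
  apply: H.
  - by move=> m; exact: expR_ge0.
  - exact: tm_ge0. - exact: small_tm. - exact: gm_bound.
  - by move=> m /negbTE h; rewrite /b h tmE; have [/andP[]] := fac_bound m.
  - move=> m am [i pi]; have ex : [exists i, prm m i] by apply/existsP; exists i.
    rewrite /b am ex /= tmE; have [/andP[_ f1] _] := fac_bound m.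
    have q2 : 2^-1 <= qm m.
      have := expR_ge1Dx (- (mu * hs m)); rewrite -/(qm m).
      have : mu * hs m <= mu * delta by apply: ler_wpM2l; [exact: ltW|exact: hs_delta].
      by move: small2; rewrite /qm /q0; lra.
    have t0 := tm_ge0 m; have := expR_ge1Dx (- tm m); nra.
have Bb : \prod_(i < N) b i <= expR (- (th n mu (t 1%N - a))).
  pose u (m : nat) : R := if (m1 < m <= m0)%N then tm m else 0.
  apply: (@le_trans _ _ (\prod_(i < N) expR (- u i))).
    apply: ler_prod => i _; rewrite /b /u; case: ifP => [_|h].
      by rewrite expR_ge0 /= ler_expR; case: ifP => // _; rewrite ?lexx // oppr0 oppr_le0 tm_ge0.
    rewrite ler01 /=; case: ifP; last by rewrite oppr0 expR0.
    move=> /andP[i1 i0]; move: h; rewrite (act_idx m0N e0 (ltn_ord i)) i0 /= => /existsP; case.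
    exists (inord 1); rewrite /prm inordK //= -e1; exact: sg_le.
  rewrite -expR_sum ler_expR sumrN lerN2.
  have -> : \sum_(i < N) u i = \sum_(m1.+1 <= m < m0.+1) tm m.
    rewrite -(big_mkord xpredT u) -big_mkcond /= [RHS](@big_nat_widenl _ _ _ _ 0) //=.
    rewrite [RHS](@big_nat_widen _ _ _ _ _ N) //=; apply: eq_bigl => i; by rewrite andbC.
  have -> : \sum_(m1.+1 <= m < m0.+1) tm m = mu / (n * n.-1)%:R * (sg m1.+1 - sg m0.+1).
    rewrite (@telescope_sumr_eq _ _ _ (fun i => - (mu / (n * n.-1)%:R * sg i))) //; first by ring.
    by move=> i _; rewrite /tm /th /hs; ring.
  by rewrite e1 e0 /th le_eqVlt; apply/orP; left; apply/eqP; ring.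
have := UE_approx; rewrite sum_PhiF ler_norml => /andP[_]; rewrite lerBlDl => /le_trans; apply.
rewrite lerD2r; apply: le_trans Bb.
have n0 : (n%:R : R) != 0 by rewrite pnatr_eq0; lia.
apply: (@le_trans _ _ (n%:R^-1 ^+ k.+2 * (n%:R * \sum_(x : slots) \prod_(i < N) b i))).
  apply: ler_wpM2l; first by rewrite exprn_ge0 // invr_ge0.
  by apply: ler_wpM2l => //; apply: ler_sum => x _; exact: VB.
rewrite sumr_const card_ffun !card_ord -[X in n%:R * X]mulr_natl natrX mulrA mulrA.
have -> : n%:R^-1 ^+ k.+2 * (n%:R * n%:R ^+ k.+1) = 1 :> R.
  by rewrite -exprS -exprMn mulVf // expr1n.
by rewrite mul1r.
Qed.

Definition Gd (w : T) : Prop := regular X Y w /\ (forall i, ~ event_at X Y Mf Mb (t i) w) /\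
  (forall j, (2 <= j <= k)%N -> exists m : nat, attach_set (Ev w) (S^~ w) t j (- m%:R)).

Local Notation Av w := (attach (Ev w) (S^~ w) t).
Local Notation ISw w := (IS t k (Av w)).

Definition Araw (w : T) m : R := expR (- (lam n mu * (ISw w (sg m.+1) - ISw w (sg m)))) *
  \prod_(1 <= i < k.+1 | liveb t k (Av w) i && ((sg m.+1 <= t i) && (t i < sg m))) rS n t k (Av w) i.
Definition Aw (w : T) m : R := if actm m then Araw w m else 1.

Lemma Gd_lf w : Gd w -> locally_finite (Ev w).
Proof. by move=> [reg _]; exact: regular_lf reg. Qed.
Lemma Gd_ne w : Gd w -> forall j, (2 <= j <= k)%N -> attach_set (Ev w) (S^~ w) t j !=set0.
Proof. by move=> [_ [_ h]] j hj; have [m hm] := h j hj; exists (- m%:R). Qed.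
Lemma Gd_tne w : Gd w -> forall i, (1 <= i)%N -> nonevent (Ev w) (t i).
Proof. by move=> [_ [h _]] i _; apply: nonevent_event_at; exact: h. Qed.

Lemma prod_Araw w M : Gd w -> \prod_(m < M) Araw w m = FS n mu t k (Av w) (sg M) (fun e => sg M <= e).
Proof.
move=> gd; have lf := Gd_lf gd; have ne := Gd_ne gd.
have tl i : (1 <= i <= k)%N -> t i < sg 0%N by move=> hi; apply/sp_top/sp_t; lia.
elim: M => [|M IH].
  rewrite big_ord0 /FS (IS_top tinc ne) ?mulr0 ?oppr0 ?expR0 ?mul1r; last by move=> i hi; exact/ltW/tl.
  rewrite big_nat_cond big_pred0 // => i; apply/negbTE; apply/negP => /and3P[hi _].
  by rewrite leNgt tl //; lia.
rewrite big_ord_recr /= IH /FS /Araw mulrACA -expRD; congr (expR _ * _); first by ring.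
rewrite [RHS](bigID (fun i => t i < sg M)) /= mulrC; congr (_ * _).
  by apply: eq_bigl => i; rewrite andbA.
apply: eq_bigl => i; rewrite -leNgt -andbA; congr (_ && _); apply/idP/andP => [h|[]//].
by split=> //; apply: le_trans h; exact: sg_le.
Qed.

Lemma prod_Aw w : Gd w -> \prod_(m < N) Aw w m = FS n mu t k (Av w) a (fun e => a <= e).
Proof.
move=> gd; have [m0 m0N e0] := grid_sp Hg sp_a; rewrite -[in RHS]e0 -prod_Araw //.
rewrite -(big_mkord xpredT (Aw w)) -(big_mkord xpredT (Araw w)) (big_cat_nat (leq0n m0.+1) m0N) /=.
rewrite [X in _ * X]big_nat_cond [X in _ * X]big1 ?mulr1; last first.
  by move=> i /andP[/andP[h1 h2] _]; rewrite /Aw (act_idx m0N e0 h2) leqNgt h1.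
apply: eq_big_nat => i /andP[_ hi]; have iN : (i < N)%N by exact: leq_trans hi m0N.
by rewrite /Aw (act_idx m0N e0 iN) -ltnS hi.
Qed.

Lemma lineages_occ w m x y : GN w -> (m < N)%N -> Inv w m.+1 x y ->
  lineages (Ev w) (S^~ w) t k (sg m.+1) = occ (prm m) x.
Proof.
move=> gn mN [hx _]; apply/finset.setP => z; rewrite inE; apply/hasP/occP.
  move=> [i]; rewrite mem_iota => hi /andP[si /eqP <-].
  have hi' : (1 <= i <= k)%N by move: hi; rewrite add1n ltnS.
  have ei : (inord i : 'I_k.+1) = i :> nat by rewrite inordK //; lia.
  exists (inord i); last by rewrite -hx ei ?(ltW si) //; lia.
  rewrite /prm ei (_ : (0 < i)%N) /=; last by lia.
  rewrite leNgt; apply/negP => h; have hk : (1 <= i <= k.+1)%N by case/andP: hi' => -> /leqW ->.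
  by have := si; rewrite (node (sp_t hk) (ltW si) h) ltxx.
move=> [i /andP[i0 si] <-]; have lt : sg m.+1 < t i by apply: lt_le_trans si; exact: sg_lt.
exists (i : nat); first by rewrite mem_iota; have := ltn_ord i; lia.
by rewrite lt /= -hx // ltW.
Qed.

Lemma prod_ins w m x y : GN w -> Gd w -> (m < N)%N -> Inv w m.+1 x y ->
  \prod_(1 <= i < k.+1 | liveb t k (Av w) i && ((sg m.+1 <= t i) && (t i < sg m))) rS n t k (Av w) i = ins R prm m x.
Proof.
move=> gn gd mN iv; have lf := Gd_lf gd; have ne := Gd_ne gd; have tn := Gd_tne gd.
have lo := lineages_occ gn mN iv.
rewrite (@big_nat_widenl _ _ _ _ 0) //= big_mkord /ins big_mkcond [RHS]big_mkcond; apply: eq_bigr => i _.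
rewrite /prm; case i0: (0 < i)%N; rewrite ?andbT ?andbF //= -ltNge.
have hi : (1 <= i <= k)%N by have := ltn_ord i; lia.
case h1: (sg m.+1 <= t i); rewrite ?andbT ?andbF //; case h2: (t i < sg m); rewrite ?andbT ?andbF //.
have ei : t i = sg m.+1 by apply: node => //; apply: sp_t; lia.
have xi : x i = S i w by case: iv => hx _; rewrite -hx // -ei lexx; exact: pos_self.
rewrite (live_card lf tinc ne tn hi) ei lo -xi; case: (x i \in _) => //=.
have -> : rS n t k (Av w) i = (n%:R - #|lineages (Ev w) (S^~ w) t k (sg m.+1)|%:R - 1) /
    (n%:R - #|lineages (Ev w) (S^~ w) t k (sg m.+1)|%:R).
  by rewrite /rS (ellS_card lf tinc ne) ei.
by rewrite lo.
Qed.

Definition Dm m (o : option mark) : R := (lam n mu * hs m * k.+1%:R) ^+ 2 +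
  (if o is None then 0 else lam n mu * hs m * k.+1%:R).

Lemma Dm_ge0 m o : 0 <= Dm m o.
Proof.
have h : 0 <= lam n mu * hs m * k.+1%:R := mulr_ge0 (mulr_ge0 lam_ge0 (hs_ge0 m)) (ler0n _ _).
by rewrite addr_ge0 ?sqr_ge0 //; case: o.
Qed.

Lemma weight_close w m o x y x' : GN w -> Gd w -> (m < N)%N -> win (Ev w) (sg m.+1) (sg m) o ->
  x' = stp (prm m) o x -> Inv w m.+1 x' y ->
  `|expR (- (lam n mu * (ISw w (sg m.+1) - ISw w (sg m)))) - wt tm prm m o x| <= Dm m o.
Proof.
move=> gn gd mN wn xE iv; have lf := Gd_lf gd; have ne := Gd_ne gd; have tn := Gd_tne gd.
have ss := sg_le (leqnSn m); have l0 := lam_ge0; have h0 := hs_ge0 m.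
have ab := Av_bound tinc ne.
have /andP[d0 d1] := IS_diff ab ss.
set z := lam n mu * _.
have z0 : 0 <= z by rewrite mulr_ge0.
have zk : z <= lam n mu * hs m * k.+1%:R.
  rewrite -mulrA; apply: ler_wpM2l => //; apply: le_trans d1 _; rewrite mulrC.
  by apply: ler_wpM2l => //; rewrite ler_nat.
have e1 := expR_ge1Dx (- z); have e2 := expRN_ub z0.
have z2 : z ^+ 2 <= (lam n mu * hs m * k.+1%:R) ^+ 2 by rewrite lerXn2r ?nnegrE // (le_trans z0).
rewrite /Dm /wt; case: o wn xE => [e|] wn xE.
  have e3 : expR (- z) <= 1 by rewrite -expR0 ler_expR oppr_le0.
  by have := sqr_ge0 (lam n mu * hs m * k.+1%:R); rewrite ler_norml; lra.
have xx : x' = x by rewrite xE; apply/ffunP => i; rewrite ffunE; case: ifP.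
have ht i : (1 <= i <= k)%N -> sg m.+1 < t i -> sg m <= t i.
  move=> hi h; rewrite leNgt; apply/negP => h2; have hk : (1 <= i <= k.+1)%N by case/andP: hi => -> /leqW ->.
  by have := h; rewrite (node (sp_t hk) (ltW h) h2) ltxx.
have -> : 2 * tm m * #|occ (prm m) x|%:R = z.
  rewrite /z (IS_jump ss ht); last by move=> j hj; apply: (Av_quiet lf tinc ne ss wn ht hj).
  by rewrite (ellS_card lf tinc ne) (lineages_occ gn mN iv) xx /tm lamE // /hs mulrA.
by rewrite addr0 ler_norml; have := sqr_ge0 z; lra.
Qed.

Lemma PhiF_close w s m x y : GN w -> Gd w -> (m + size s <= N)%N -> windows w m s -> Inv w m x y ->
  `|PhiF tm prm actm gm m s x| <= 1 /\
  `|\prod_(i < size s) (Aw w (m + i) * gw w (m + i).+1) - PhiF tm prm actm gm m s x| <=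
   \sum_(i < size s) Dm (m + i) (nth None s i).
Proof.
move=> gn gd; elim: s m x y => [|o s IH] m x y mN wn iv.
  by rewrite !big_ord0 /= subrr normr0 normr1 lexx.
rewrite /= in mN; have mN' : (m < N)%N by lia.
have w0 : win (Ev w) (sg m.+1) (sg m) o by have := wn 0%N isT; rewrite addn0.
have iv' := Inv_step gn mN' w0 iv.
have [|i hi|I1 I2] := IH _ _ _ _ _ iv'; [by lia|by have := wn i.+1 hi; rewrite addnS|].
rewrite !big_ord_recl /= !addn0.
set x' := stp _ _ _ in iv' I1 I2 *.
have -> : \prod_(i < size s) (Aw w (m + bump 0 i) * gw w (m + bump 0 i).+1) =
          \prod_(i < size s) (Aw w (m.+1 + i) * gw w (m.+1 + i).+1).
  by apply: eq_bigr => i _; rewrite /bump /= add1n addnS addSn.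
have -> : \sum_(i < size s) Dm (m + bump 0 i) (nth None s i) = \sum_(i < size s) Dm (m.+1 + i) (nth None s i).
  by apply: eq_bigr => i _; rewrite /bump /= add1n addnS addSn.
set B := PhiF _ _ _ _ _ _ _ in I1 I2 *; set C := \prod_(i < size s) _ in I2 *.
set D := \sum_(i < size s) _ in I2 *.
have gE := Inv_gm gn iv'; have /andP[g0 g1] := gm_bound m.+1 x'.
have /andP[i0 i1] := ins_bound R prm m x'.
have wt01 : 0 <= wt tm prm m o x <= 1.
  case: (o) => [e|] /=; first by rewrite ler01 lexx.
  have hb : 0 <= 2 * tm m * #|occ (prm m) x|%:R := mulr_ge0 (mulr_ge0 (ler0n _ 2) (tm_ge0 m)) (ler0n _ _).
  have : 2 * tm m * #|occ (prm m) x|%:R <= 1.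
    apply: le_trans (small_tm m); apply: ler_wpM2l; first by rewrite mulr_ge0 ?tm_ge0.
    by rewrite ler_nat card_occ.
  by lra.
have Dm0 := Dm_ge0 m o.
have [f1 [f2 f3]] : `|facF tm prm actm gm m o x x'| <= 1 /\ `|Aw w m * gw w m.+1| <= 1 /\
    `|Aw w m * gw w m.+1 - facF tm prm actm gm m o x x'| <= Dm m o.
  rewrite /facF /Aw -gE; case: (actm m); last first.
    by rewrite !mul1r subrr normr0 ger0_norm.
  rewrite /Araw (prod_ins gn gd mN' iv').
  have cl := weight_close gn gd mN' w0 (erefl _) iv'.
  set E := expR _ in cl *; have E0 : 0 <= E by exact: expR_ge0.
  have E1 : E <= 1.
    have ab := Av_bound tinc (Gd_ne gd).
    have /andP[d0 _] := IS_diff ab (sg_le (leqnSn m)).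
    by rewrite -expR0 ler_expR oppr_le0 mulr_ge0 ?lam_ge0.
  case/andP: wt01 => w00 w01.
  split; first by rewrite ger0_norm ?mulr_ge0 // !mulr_ile1 ?mulr_ge0.
  split; first by rewrite ger0_norm ?mulr_ge0 // !mulr_ile1 ?mulr_ge0.
  rewrite -!mulrA -mulrBl normrM; apply: le_trans cl; apply: ler_piMr => //.
  by rewrite ger0_norm ?mulr_ge0 // mulr_ile1.
split; first by rewrite normrM mulr_ile1.
have -> : Aw w m * gw w m.+1 * C - facF tm prm actm gm m o x x' * B =
  (Aw w m * gw w m.+1) * (C - B) + (Aw w m * gw w m.+1 - facF tm prm actm gm m o x x') * B by ring.
have s1 : `|Aw w m * gw w m.+1 * (C - B)| <= D by rewrite normrM; apply: le_trans I2; apply: ler_piMl => //.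
have s2 : `|(Aw w m * gw w m.+1 - facF tm prm actm gm m o x x') * B| <= Dm m o.
  by rewrite normrM; apply: le_trans f3; apply: ler_piMr => //.
apply: le_trans (ler_normD _ _) _; rewrite [leRHS]addrC; exact: lerD s1 s2.
Qed.

Lemma sum_D : \sum_(c : idx) (\sum_(i < N) Dm i (nth None c.1.1 i)) * prb (Omega c) <=
  ((lam n mu * k.+1%:R) ^+ 2 + lam n mu * k.+1%:R * mu) * (delta * len).
Proof.
rewrite (sum_Omega (fun s => \sum_(i < N) Dm i (nth None s i))).
apply: le_trans (sum_additive Dm_ge0) _.
have l0 := lam_ge0.
have c0 : 0 <= (lam n mu * k.+1%:R) ^+ 2 + lam n mu * k.+1%:R * mu.
  by rewrite addr_ge0 ?sqr_ge0 // !mulr_ge0 // ltW.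
apply: le_trans (ler_wpM2l c0 sum_hs2); rewrite mulr_sumr; apply: ler_sum => m _.
have h0 := hs_ge0 m; have [/andP[f0 f1] _] := fac_bound m.
set u := lam n mu * hs m * k.+1%:R; have u0 : 0 <= u := mulr_ge0 (mulr_ge0 l0 h0) (ler0n _ _).
have -> : \sum_o Dm m o * Q (qm m) (tm m) o =
    u ^+ 2 * (qm m * (1 + mu * hs m)) + u * (qm m * (mu * hs m)).
  rewrite sum_option /Dm /= addr0 -/u (eq_bigr (fun e => (u ^+ 2 + u) * Q (qm m) (tm m) (Some e))) //.
  by rewrite -mulr_sumr sumQ_some -[qm m * tm m * _]mulrA tmE -/u; ring.
have q1 : qm m <= 1 by rewrite /qm /q0 -expR0 ler_expR oppr_le0 mulr_ge0 // ltW.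
have b1 : u ^+ 2 * (qm m * (1 + mu * hs m)) <= u ^+ 2 by apply: ler_piMr => //; exact: sqr_ge0.
have b2 : u * (qm m * (mu * hs m)) <= u * (mu * hs m).
  by apply: ler_wpM2l => //; apply: ler_piMl => //; rewrite mulr_ge0 // ltW.
apply: le_trans (lerD b1 b2) _; rewrite /u le_eqVlt; apply/orP; left; apply/eqP; ring.
Qed.

Lemma core_close (G : set T) (f : T -> R) : measurable G -> prb (~` G) = 0 ->
  (forall w, G w -> Gd w) -> bm f -> (forall w, `|f w| <= 1) ->
  (forall w, G w -> f w = FS n mu t k (Av w) a (fun e => a <= e) * \1_Eset w) ->
  `|prb UE - Ex P f| <= ((lam n mu * k.+1%:R) ^+ 2 + lam n mu * k.+1%:R * mu + 2 * mu ^+ 2) * (delta * len).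
Proof.
move=> mG G0 GGd bf f1 hf.
have mGG : measurable (G `&` [set w | GN w]) by apply: measurableI => //; exact: measurable_GN.
have pGG : prb (~` (G `&` [set w | GN w])) = 0.
  by rewrite setCI prb0_setU //; [exact: measurableC|apply: measurableC; exact: measurable_GN|exact: prb_GN].
have h1 : forall i : idx, 0 <= \sum_(j < N) Dm j (nth None i.1.1 j).
  by move=> i; apply: sumr_ge0 => j _; exact: Dm_ge0.
have h2 : forall (i : idx) w, (G `&` [set w | GN w]) w -> Omega i w ->
    `|f w - PhiF tm prm actm gm 0 i.1.1 i.1.2| <= \sum_(j < N) Dm j (nth None i.1.1 j).
  move=> c w [Gw gn] Ow; have gd := GGd _ Gw.
  have sz : (0 + size c.1.1 <= N)%N by rewrite size_tuple.
  have [_] := PhiF_close gn gd sz (Omega_windows gn Ow) (Omega_Inv Ow).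
  rewrite size_tuple hf // -prod_Aw // -prod_meet -prod_gw -big_split /=.
  exact.
have H := approx mGG pGG (fun w h => h.2) bf f1 h1 h2.
have /andP[m0 m1] := mass_bound.
have := UE_approx; have D1 := sum_D.
move: H; set A := Ex P f; set B := \sum_i _; set C := prb UE => H1 H2.
have -> : C - A = (C - B) - (A - B) by ring.
apply: le_trans (ler_normB _ _) _; lra.
Qed.

End Core.

Section Density.
Context {R : realType} (h : R -> R) (mh : measurable_fun setT h) (h0 : forall x, 0 <= h x).

Definition density (B : set R) : \bar R := (\int[lebesgue_measure]_(x in B) (h x)%:E)%E.

Let density0 : density set0 = 0%E.
Proof. by rewrite /density integral_set0. Qed.
Let density_ge0 B : (0 <= density B)%E.
Proof. by apply: integral_ge0 => x _; rewrite lee_fin. Qed.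
Let density_additive : semi_sigma_additive density.
Proof.
have H := @semi_sigma_additive_nng_induced _ _ R lebesgue_measure (fun x => (h x)%:E) ((measurable_EFinP _ _).2 mh) (fun x => h0 x).
exact: H.
Qed.

HB.instance Definition _ := isMeasure.Build _ _ _ density density0 density_ge0 density_additive.

Lemma density_atoms (t : nat -> R) (p : pred nat) (c : nat -> R) k :
  (forall i, (1 <= i <= k)%N -> p i -> 0 <= c i) ->
  exists m : {measure set R -> \bar R}, forall B, m B =
    (\int[lebesgue_measure]_(x in B) (h x)%:E + \sum_(1 <= i < k.+1 | p i && `[< B (t i) >]) (c i)%:E)%E.
Proof.
elim: k => [_|k IH c0].
  by exists density => B; rewrite big_geq // adde0.
have [i hi pi|m hm] := IH; first by apply: c0; lia.
case pk: (p k.+1); last first.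
  exists m => B; rewrite hm; congr (_ + _)%E; rewrite [RHS]big_mkcond [LHS]big_mkcond /= [RHS]big_nat_recr //=.
  by rewrite pk /= adde0.
have ck : 0 <= c k.+1 by apply: c0 => //; lia.
exists (measure_add m (mscale (NngNum ck) (\d_(t k.+1)))) => B.
transitivity (m B + mscale (NngNum ck) (\d_(t k.+1)) B)%E; first exact: measure_addE.
rewrite hm /mscale /= diracE -addeA; congr (_ + _)%E.
rewrite [RHS]big_mkcond [X in (X + _)%E]big_mkcond /= [RHS]big_nat_recr //=; congr (_ + _)%E.
rewrite pk /=; have [h1|h1] := pselect (B (t k.+1)).
  by rewrite asboolT // mem_set // mule1.
by rewrite asboolF // memNset // mule0.
Qed.

End Density.

Section ExpIntegral.
Context {R : realType}.

Lemma integral_expR (c r x y : R) : x < y ->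
  (\int[lebesgue_measure]_(s in `[x, y[) (c * expR (r * s) * r)%:E)%E = (c * expR (r * y) - c * expR (r * x))%:E.
Proof.
move=> xy.
have cE : continuous (fun z : R^o => expR (r * z) : R^o).
  move=> z; apply: continuous_comp; last exact: continuous_expR.
  by apply: continuousM => //; exact: cst_continuous.
have cF : continuous (fun z : R^o => c * expR (r * z) : R^o).
  by move=> z; apply: (@continuous_comp _ _ _ (fun z => expR (r * z)) (fun u => c * u)); [exact: cE|exact: mulrl_continuous].
have cG : continuous (fun z : R^o => c * expR (r * z) * r : R^o).
  by move=> z; apply: (@continuous_comp _ _ _ (fun z => c * expR (r * z)) (fun u => u * r)); [exact: cF|exact: mulrr_continuous].
rewrite integral_itv_bndo_bndc; last first.
  by apply/measurable_EFinP; apply: measurable_funTS; exact: continuous_measurable_fun.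
rewrite EFinB; apply: (@continuous_FTC2 _ _ (fun z => c * expR (r * z))) => //.
- exact: continuous_subspaceT.
- split.
  + by move=> z _; exact: ex_derive.
  + by apply/cvg_at_right_filter; exact: cF.
  + by apply/cvg_at_left_filter; exact: cF.
- move=> z _; rewrite derive1Ml // derive1_comp // [X in _ * (X * _)]derive1E.
  have /funeqP -> := @derive_expR R.
  by rewrite derive1Ml // derive1_id mulr1 mulrA.
Qed.

Lemma integral_step (a u : R) :
  (\int[lebesgue_measure]_(x in `[a, +oo[) ((nat_of_bool (x < u)%R)%:R : R)%:E)%E = (pp u a)%:E.
Proof.
rewrite [LHS](_ : _ = (\int[lebesgue_measure]_(x in `[a, +oo[) (\1_(`]-oo, u[%classic) x)%:E)%E); last first.
  by apply: eq_integral => x _; rewrite indicE mem_setE in_itv.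
rewrite integral_indic //=.
have -> : `]-oo, u[%classic `&` `[a, +oo[%classic = `[a, u[%classic :> set R.
  by apply/seteqP; split=> z /=; rewrite !in_itv /= ?andbT; [move=> [-> ->]|move=> /andP[-> ->]].
rewrite lebesgue_measure_itv /= lte_fin /pp; case: ltP => h; first by rewrite -EFinB max_l // subr_ge0 ltW.
by rewrite max_r // subr_le0.
Qed.

Lemma measurable_step (D : set R) (u : R) : measurable_fun D (fun x : R => (nat_of_bool (x < u)%R)%:R : R).
Proof.
rewrite (_ : (fun x : R => _) = \1_(`]-oo, u[%classic)); first exact: measurable_indic.
by apply/funext => x; rewrite indicE mem_setE in_itv.
Qed.

End ExpIntegral.

Section MeasurableFS.
Context {d : measure_display} {U : measurableType d} {R : realType}.
Variables (n : nat) (mu : R) (t : nat -> R) (k : nat) (av : U -> nat -> R) (a : U -> R).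
Hypothesis mav : forall j, measurable_fun setT (av ^~ j).
Hypothesis ma : measurable_fun setT a.

Lemma measurable_bool (Q : U -> bool) : measurable [set u | Q u] -> measurable_fun setT (fun u => (nat_of_bool (Q u))%:R : R).
Proof.
move=> mQ; rewrite (_ : (fun u => _) = \1_[set u | Q u]); first exact: measurable_indic.
apply/funext => u; rewrite indicE; congr (nat_of_bool _)%:R; apply/idP/idP; rewrite inE //.
Qed.

Lemma measurable_ellS (f : U -> R) : measurable_fun setT f -> measurable_fun setT (fun u => ellS t k (av u) (f u)).
Proof.
move=> mf; apply: measurable_funB.
  under eq_fun do rewrite natr_sum; apply: measurable_sum => i.
  by apply: measurable_bool; exact: measurable_ltS.
under eq_fun do rewrite natr_sum; apply: measurable_sum => j.
by apply: measurable_bool; exact: measurable_ltS.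
Qed.

Lemma measurable_IS : measurable_fun setT (fun u => IS t k (av u) (a u)).
Proof.
apply: measurable_funB; apply: measurable_sum => i; rewrite /pp; apply: measurable_maxr => //; exact: measurable_funB.
Qed.

Lemma measurable_liveb i : measurable [set u | liveb t k (av u) i].
Proof.
rewrite /liveb; case: (1 <= i <= k)%N => /=; last by rewrite (_ : [set u | false] = set0) //; apply/seteqP; split.
rewrite (_ : [set u | _] = [set u | forall j : 'I_k.+1, ~ ((i < j)%N /\ av u j = t i)]).
  apply: measurable_forall => j; apply: measurable_notP.
  by apply: measurable_conj; [exact: measurable_const|exact: measurable_eqS].
apply/seteqP; split=> u /=.
  by move=> /forallP h j [ij e]; move: (h j); rewrite ij e eqxx.
by move=> h; apply/forallP => j; apply/negP => /andP[ij /eqP e]; apply: (h j).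
Qed.

Lemma measurable_inv (f : U -> R) : measurable_fun setT f -> measurable_fun setT (fun u => (f u)^-1).
Proof.
move=> mf; have mV : measurable_fun setT (fun x : R => x^-1).
  have mP : measurable_fun setT (fun x : R => if 0 < x then expR (- ln x) else 0).
    apply: measurable_fun_ifT => //; first exact: measurable_fun_ltr.
    by apply: measurableT_comp => //; apply: measurableT_comp => //; exact: measurable_ln.
  rewrite (_ : (fun x : R => _) = (fun x => (if 0 < x then expR (- ln x) else 0)
      - (if 0 < - x then expR (- ln (- x)) else 0))); last first.
    apply/funext => x; case: (ltgtP x 0) => x0; rewrite ?oppr_gt0 ?x0 ?ltxx ?invr0 ?subr0 //.
    - by rewrite sub0r expRN lnK ?posrE ?oppr_gt0 // invrN opprK.
    - by rewrite (ltNge x) (ltW x0) /= subr0 expRN lnK // posrE.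
  apply: measurable_funB => //.
  have mN : measurable_fun [set: R] (@GRing.opp R) by [].
  exact: (measurableT_comp mP mN).
exact: measurableT_comp mV mf.
Qed.

Lemma measurable_FS (sel : U -> R -> bool) : (forall c, measurable [set u | sel u c]) ->
  measurable_fun setT (fun u => FS n mu t k (av u) (a u) (sel u)).
Proof.
move=> ms; apply: measurable_funM.
  apply: measurableT_comp => //; apply: measurableT_comp => //; apply: measurable_funM => //; exact: measurable_IS.
under eq_fun do rewrite big_mkcond /=; apply: measurable_prod => i _.
apply: measurable_fun_ifT => //.
  apply: (@measurable_fun_bool _ _ _ _ true) => //; rewrite setTI.
  rewrite (_ : _ @^-1` _ = [set u | liveb t k (av u) i /\ sel u (t i)]).
    by apply: measurable_conj => //; exact: measurable_liveb.
  by apply/seteqP; split=> u /= => [/andP|h]; [|apply/andP].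
rewrite /rS; have mE := measurable_ellS (@measurable_cst _ _ _ _ setT (t i)).
apply: measurable_funM; first by apply: measurable_funB => //; exact: measurable_funB.
by apply: measurable_inv; exact: measurable_funB.
Qed.

End MeasurableFS.

Lemma prod_at_most_one (R : comPzRingType) (r : seq nat) (p : pred nat) (c : nat -> R) :
  uniq r -> (forall i j, i \in r -> j \in r -> p i -> p j -> i = j) ->
  \prod_(i <- r | p i) (1 - c i) = 1 - \sum_(i <- r | p i) c i.
Proof.
move=> ur h; have [/hasP[i ir pi]|/hasPn np] := boolP (has p r).
  have E j : j \in r -> p j = (j == i).
    move=> jr; apply/idP/eqP => [pj|-> //]; exact: h.
  rewrite big_mkcond [X in _ - X]big_mkcond (bigD1_seq i) //= [X in _ - X](bigD1_seq i) //= pi.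
  by rewrite !big1_seq ?mulr1 ?addr0 // => j /andP[ji jr]; rewrite E // (negbTE ji).
rewrite big_seq_cond [X in _ - X]big_seq_cond !big_pred0 ?subr0 // => j; apply/negbTE/negP => /andP[jr pj]; by have := np _ jr; rewrite pj.
Qed.

Lemma measureU_real (R : realType) (m : {measure set R -> \bar R}) (A B : set R) :
  measurable A -> measurable B -> A `&` B = set0 -> m (A `|` B) = (m A + m B)%E.
Proof. by move=> mA mB AB; rewrite measureU. Qed.

Section Path.
Variables (R : realType) (n : nat) (mu : R) (Ev : set (R * ('I_n * 'I_n))).
Variables (S : nat -> 'I_n) (t : nat -> R) (k : nat).
Hypothesis lf : locally_finite Ev.
Hypothesis tinc : forall i j, (1 <= i)%N -> (i < j)%N -> t i < t j.
Hypothesis attach_ne : forall j, (2 <= j <= k)%N -> attach_set Ev S t j !=set0.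
Hypothesis tne : forall i, (1 <= i)%N -> nonevent Ev (t i).
Hypothesis mu0 : 0 < mu.
Hypothesis n2 : (2 <= n)%N.
Hypothesis k1 : (1 <= k)%N.

Local Notation Av := (attach Ev S t).
Local Notation ellw := (ellS t k Av).
Local Notation Flt a := (FS n mu t k Av a (fun e => a <= e)).
Local Notation Fle a := (FS n mu t k Av a (fun e => a < e)).
Local Notation lm := (lam n mu).

Lemma lam_gt0 : 0 < lm.
Proof. by rewrite divr_gt0 // ltr0n bin_gt0. Qed.

Lemma ellS_ge0 x : 0 <= ellw x.
Proof. by rewrite (ellS_card lf tinc attach_ne). Qed.

Lemma measurable_path_ellS : measurable_fun setT ellw.
Proof. by apply: (@measurable_ellS _ _ R t k (fun=> Av)) => // j; exact: measurable_cst. Qed.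

Lemma hazardE a : hazard_int n mu t k Av a = (lm * IS t k Av a)%:E.
Proof.
rewrite /hazard_int [RHS]EFinM; congr (_ * _)%E.
have -> : [set x : R | a <= x] = `[a, +oo[%classic by apply/seteqP; split=> x /=; rewrite in_itv /= andbT.
transitivity (\int[lebesgue_measure]_(x in `[a, +oo[) (ellw x)%:E)%E.
  by apply: eq_integral => x _; rewrite (ell_ellS lf tinc attach_ne tne).
have mD : measurable (`[a, +oo[%classic : set R) by [].
have ms lo (u : nat -> R) : measurable_fun (`[a, +oo[%classic : set R) (fun x => (\sum_(lo <= i < k.+1) ((nat_of_bool (x < u i)%R)%:R : R))%:E).
  by apply/measurable_EFinP; apply: measurable_sum => i; exact: measurable_step.
have I lo (u : nat -> R) : (\int[lebesgue_measure]_(x in `[a, +oo[) (\sum_(lo <= i < k.+1) ((nat_of_bool (x < u i)%R)%:R : R))%:E)%E = (\sum_(lo <= i < k.+1) pp (u i) a)%:E.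
  under eq_integral do rewrite -sumEFin; rewrite ge0_integral_sum //=.
  - by rewrite -sumEFin; apply: eq_bigr => i _; exact: integral_step.
  - by move=> i; apply/measurable_EFinP; exact: measurable_step.
have H : (\int[lebesgue_measure]_(x in `[a, +oo[) (ellw x)%:E + (\sum_(2 <= j < k.+1) pp (Av j) a)%:E =
    (\sum_(1 <= i < k.+1) pp (t i) a)%:E)%E.
  rewrite -(I 2%N Av) -(I 1%N t) -ge0_integralD //.
  - by apply: eq_integral => x _; rewrite -EFinD /ellS !natr_sum subrK.
  - by move=> x _; rewrite lee_fin ellS_ge0.
  - by apply/measurable_EFinP; apply: measurable_funTS; exact: measurable_path_ellS.
  - by move=> x _; rewrite lee_fin sumr_ge0.
  - exact: ms.
move: H; case: (integral _ _ _) => [r| |] //=; rewrite -EFinD => -[] e.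
by rewrite /IS -e addrK.
Qed.

Lemma cdfE a sel : cdf_formula n mu t k Av a sel = (FS n mu t k Av a sel)%:E.
Proof.
rewrite /cdf_formula hazardE -EFinN /= -EFinM; congr EFin; congr (_ * _).
by apply: eq_bigr => i _; rewrite (ell_ellS lf tinc attach_ne tne).
Qed.

Definition hS s : R := Fle s * (lm * ellw s).
Definition cS i : R := Fle (t i) * (n%:R - ellw (t i))^-1.

Lemma FS_ge0 a sel : 0 <= FS n mu t k Av a sel.
Proof. by have /andP[] := FS_bound lf tinc attach_ne tne a sel (ltW mu0). Qed.

Lemma hS_ge0 s : 0 <= hS s.
Proof. by rewrite mulr_ge0 ?FS_ge0 // mulr_ge0 ?ellS_ge0 // ltW // lam_gt0. Qed.

Lemma measurable_hS : measurable_fun setT hS.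
Proof.
apply: measurable_funM; last by apply: measurable_funM => //; exact: measurable_path_ellS.
apply: (@measurable_FS _ _ R n mu t k (fun=> Av) id) => // c.
by apply: measurable_ltS => //; exact: measurable_cst.
Qed.

Lemma live_gap i : (1 <= i <= k)%N -> liveb t k Av i -> 1 <= n%:R - ellw (t i).
Proof. by move=> hi li; have := live_ellS lf tinc attach_ne tne hi li; lra. Qed.

Lemma cS_ge0 i : (1 <= i <= k)%N -> liveb t k Av i -> 0 <= cS i.
Proof. by move=> hi li; have g := live_gap hi li; rewrite mulr_ge0 ?FS_ge0 // invr_ge0; lra. Qed.

Lemma cond_lawE B : cond_law n mu t k Av B = (\int[lebesgue_measure]_(x in B) (hS x)%:E +
  \sum_(1 <= i < k.+1 | liveb t k Av i && `[< B (t i) >]) (cS i)%:E)%E.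
Proof.
rewrite /cond_law; congr (_ + _)%E.
  apply: eq_integral => x _; rewrite /F_le cdfE (ell_ellS lf tinc attach_ne tne) -EFinM; congr EFin.
  by rewrite /hS /lam; ring.
by apply: eq_bigr => i _; rewrite /F_le cdfE (ell_ellS lf tinc attach_ne tne) -EFinM.
Qed.

Lemma cond_law_measure : exists m : {measure set R -> \bar R}, forall B, m B = cond_law n mu t k Av B.
Proof.
have [m hm] := density_atoms measurable_hS hS_ge0 t cS_ge0.
by exists m => B; rewrite hm cond_lawE.
Qed.

Lemma live_uniq i j : i \in index_iota 1 k.+1 -> j \in index_iota 1 k.+1 -> t i = t j -> i = j.
Proof.
rewrite !mem_index_iota => /andP[i1 _] /andP[j1 _] e.
by case: (ltngtP i j) => // h; have := tinc _ h; rewrite e ltxx => /(_ _); [move=> /(_ i1)|move=> /(_ j1)].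
Qed.

Lemma jump x : Fle x - Flt x = \sum_(1 <= i < k.+1 | liveb t k Av i && (t i == x)) cS i.
Proof.
have E : Flt x = Fle x * \prod_(1 <= i < k.+1 | liveb t k Av i && (t i == x)) (1 - (n%:R - ellw (t i))^-1).
  rewrite /FS -mulrA; congr (_ * _); rewrite [LHS](bigID (fun i => t i == x)) /= mulrC; congr (_ * _).
    by apply: eq_bigl => i; rewrite -andbA; congr (_ && _); rewrite [RHS]lt_neqAle eq_sym andbC.
  rewrite big_nat_cond [RHS]big_nat_cond; apply: eq_big => i.
    by case: eqP => [->|]; rewrite ?lexx ?andbT ?andbF.
  move=> /andP[hi /andP[/andP[li _] _]]; have g : 1 <= n%:R - ellw (t i) by apply: live_gap => //; lia.
  by rewrite /rS mulrBl divff ?mul1r //; apply/eqP => e; rewrite e in g; lra.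
rewrite E prod_at_most_one ?iota_uniq //.
  rewrite mulrBr mulr1 opprB addrC subrK mulr_sumr; apply: eq_bigr => i /andP[_ /eqP <-] //.
by move=> i j hi hj /andP[_ /eqP ei] /andP[_ /eqP ej]; apply: live_uniq => //; rewrite ei ej.
Qed.

Lemma no_break x y s : (forall i, (1 <= i <= k)%N -> ~~ (x < t i < y)) ->
  (forall j, (2 <= j <= k)%N -> ~~ (x < Av j < y)) -> x <= s < y ->
  ellw s = ellw x /\ Fle s = Flt y * expR (- (lm * ellw x * (y - s))).
Proof.
move=> nt nA /andP[xs sy].
have eqb u : ~~ (x < u < y) -> (s < u) = (x < u) /\ (s < u) = (y <= u).
  move=> nu; suff e1 : (s < u) = (x < u).
    split=> //; rewrite e1; apply/idP/idP => h; last by apply: lt_le_trans h; exact: le_lt_trans xs sy.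
    by rewrite leNgt; apply/negP => h2; rewrite h h2 in nu.
  apply/idP/idP => h; first exact: le_lt_trans h.
  by apply: lt_le_trans sy _; rewrite leNgt; apply/negP => h2; rewrite h h2 in nu.
have e1 : ellw s = ellw x.
  rewrite /ellS; congr (_%:R - _%:R); apply: eq_big_nat => i hi; congr nat_of_bool.
    by have [] := eqb _ (nt i _).
  by have [] := eqb _ (nA i _).
split=> //.
have ht i : (1 <= i <= k)%N -> s < t i -> y <= t i by move=> hi; have [_ <-] := eqb _ (nt i hi).
have hA j : (2 <= j <= k)%N -> s < Av j -> y <= Av j by move=> hj; have [_ <-] := eqb _ (nA j hj).
have := IS_jump (ltW sy) ht hA; rewrite e1 => /eqP; rewrite subr_eq => /eqP IE.
rewrite /FS [RHS]mulrAC -expRD; congr (expR _ * _); first by rewrite IE; ring.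
rewrite big_nat_cond [RHS]big_nat_cond; apply: eq_bigl => i; case hi: (1 <= i < k.+1)%N => //=; congr (_ && _).
by have [_ <-] := eqb _ (nt i hi).
Qed.

Variable m : {measure set R -> \bar R}.
Hypothesis hm : forall B, m B = cond_law n mu t k Av B.

Lemma law_piece x y : x < y -> (forall i, (1 <= i <= k)%N -> ~~ (x < t i < y)) ->
  (forall j, (2 <= j <= k)%N -> ~~ (x < Av j < y)) -> m `[x, y[%classic = (Flt y - Flt x)%:E.
Proof.
move=> xy nt nA; rewrite hm cond_lawE.
have -> : (\int[lebesgue_measure]_(s in `[x, y[) (hS s)%:E)%E = (Flt y - Fle x)%:E.
  pose r := lm * ellw x; pose c := Flt y * expR (- (r * y)).
  have cE s : c * expR (r * s) = Flt y * expR (- (r * (y - s))).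
    by rewrite /c -mulrA -expRD; congr (_ * expR _); ring.
  transitivity (\int[lebesgue_measure]_(s in `[x, y[) (c * expR (r * s) * r)%:E)%E.
    apply: eq_integral => s; rewrite inE /= in_itv /= => hs; have [e1 e2] := no_break nt nA hs.
    by rewrite /hS e1 e2 cE.
  rewrite integral_expR // !cE subrr mulr0 oppr0 expR0 mulr1.
  by have [|_ ->] := @no_break x y x nt nA; rewrite ?lexx.
rewrite (_ : (\sum_(1 <= i < k.+1 | _) _)%E = (Fle x - Flt x)%:E); last first.
  rewrite sumEFin jump; congr EFin; rewrite big_nat_cond [RHS]big_nat_cond; apply: eq_bigl => i.
  case hi: (1 <= i < k.+1)%N => //=; congr (_ && _); apply/asboolP/eqP => /=; rewrite in_itv /=.
    move=> /andP[h1 h2]; apply/eqP; rewrite eq_le h1 andbT leNgt; apply/negP => h3.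
    by have := nt i hi; rewrite h3 h2.
  by move=> ->; rewrite lexx.
by rewrite -EFinD; congr EFin; ring.
Qed.

Lemma law_itv x y : x < y -> m `[x, y[%classic = (Flt y - Flt x)%:E.
Proof.
pose sp := [seq t i | i <- iota 1 k] ++ [seq Av j | j <- iota 2 k.-1].
suff H (l : seq R) : forall x y, x < y -> (forall c, c \in sp -> x < c < y -> c \in l) ->
    m `[x, y[%classic = (Flt y - Flt x)%:E by move=> xy; apply: (H sp).
elim: l => [|c l IH] {}x {}y xy hsp.
  apply: law_piece => // i hi; apply/negP => h.
    by have := hsp (t i) _ h; rewrite mem_cat map_f ?mem_iota; [move=> /(_ isT)|lia].
  by have := hsp (Av i) _ h; rewrite mem_cat (map_f Av) ?orbT ?mem_iota; [move=> /(_ isT)|lia].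
have [/andP[xc cy]|nc] := boolP (x < c < y); last first.
  apply: IH => // z zs xzy; have := hsp z zs xzy; rewrite inE => /orP[/eqP e|//].
  by rewrite -e xzy in nc.
have -> : `[x, y[%classic = `[x, c[%classic `|` `[c, y[%classic :> set R.
  apply/seteqP; split=> z /=; rewrite !in_itv /=.
    by move=> /andP[-> ->]; rewrite /= andbT; case: (ltP z c) => _; [left|right].
  by case=> /andP[h1 h2]; [rewrite h1 (lt_trans h2 cy)|rewrite h2 (le_trans (ltW xc) h1)].
rewrite measureU_real //; last first.
  by apply/seteqP; split=> z //= []; rewrite !in_itv /= => /andP[_ h] /andP[h2 _]; move: h; rewrite ltNge h2.
rewrite !IH //.
- by rewrite -EFinD; congr EFin; ring.
- move=> z zs /andP[h1 h2]; have := hsp z zs; rewrite (lt_trans xc h1) h2 inE => /(_ isT) /orP[/eqP e|//].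
  by move: h1; rewrite e ltxx.
- move=> z zs /andP[h1 h2]; have := hsp z zs; rewrite h1 (lt_trans h2 cy) inE => /(_ isT) /orP[/eqP e|//].
  by move: h2; rewrite e ltxx.
Qed.

Lemma IS_ge s : t 1%N - s <= IS t k Av s.
Proof.
rewrite /IS big_ltn // -addrA -sumrB.
have h0 : 0 <= \sum_(2 <= i < k.+1) (pp (t i) s - pp (Av i) s).
  rewrite big_nat_cond; apply: sumr_ge0 => i /andP[hi _]; rewrite subr_ge0 /pp.
  have h : Av i <= t i.
    by apply: le_trans (Av_bound tinc attach_ne _) (ltW (tinc _ _)); lia.
  by rewrite ge_max !le_max lexx orbT andbT lerD2r h.
by apply: (@le_trans _ _ (pp (t 1%N) s)); [rewrite /pp le_max lexx|lra].
Qed.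

Lemma FS_small s sel : FS n mu t k Av s sel <= expR (- (lm * (t 1%N - s))).
Proof.
have := FS_bound lf tinc attach_ne tne s sel (lexx 0); rewrite /FS /lam !mul0r oppr0 expR0 mul1r => /andP[p0 p1].
apply: (@le_trans _ _ (expR (- (lm * IS t k Av s)))); first by rewrite -[leRHS]mulr1 ler_wpM2l ?expR_ge0.
by rewrite ler_expR lerN2 ler_pM2l ?lam_gt0 // IS_ge.
Qed.

Lemma law_ray a : m `]-oo, a[%classic = (Flt a)%:E.
Proof.
pose F M := `[a - M.+1%:R, a[%classic : set R.
have U : \bigcup_M F M = `]-oo, a[%classic.
  apply/seteqP; split=> x; first by case=> M _; rewrite /F /= !in_itv /= => /andP[].
  rewrite /= in_itv /= => xa; exists (Num.bound (a - x)) => //; rewrite /F /= in_itv /= xa andbT.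
  have := archi_boundP (_ : 0 <= a - x); rewrite subr_ge0 (ltW xa) => /(_ isT) h.
  by rewrite -natr1; lra.
have mU : measurable (\bigcup_M F M) by rewrite U.
have c1 : (m \o F) x @[x --> \oo] --> m (\bigcup_M F M).
  apply: nondecreasing_cvg_mu => // [M|]; first by rewrite /F.
  move=> i j ij; apply/subsetPset => z; rewrite /F /= !in_itv /= => /andP[h ->]; rewrite andbT.
  by apply: le_trans h; rewrite lerD2l lerN2 ler_nat.
have c2 : (m \o F) x @[x --> \oo] --> (Flt a)%:E.
  have r0 : Flt (a - M.+1%:R) @[M --> \oo] --> (0 : R).
    apply/cvgrPdist_lt => e e0; near=> M.
    rewrite sub0r normrN ger0_norm ?FS_ge0 //; apply: le_lt_trans (FS_small _ _) _.
    rewrite -[ltRHS]lnK ?posrE // ltr_expR ltrNl.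
    have : (- ln e) / lm + a - t 1%N < M%:R by near: M; exact: nbhs_infty_gtr.
    rewrite ltrBlDr -ltrBrDr ltr_pdivrMr ?lam_gt0 // => /lt_le_trans; apply.
    by rewrite mulrC ler_pM2l ?lam_gt0 // -natr1; lra.
  have r1 : Flt a - Flt (a - M.+1%:R) @[M --> \oo] --> (Flt a : R).
    by rewrite -[X in _ --> X]subr0; apply: cvgB => //; exact: cvg_cst.
  have -> : m \o F = (fun M => (Flt a - Flt (a - M.+1%:R))%:E).
    by apply/funext => M /=; rewrite law_itv // ltrBlDr ltrDl.
  by apply: cvg_EFin; [exact: nearW|exact: r1].
have e : m (\bigcup_M F M) = (Flt a)%:E  by apply: (cvg_unique (@ereal_hausdorff R) c1 c2).
by rewrite -U.
Unshelve. all: by end_near.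
Qed.

Lemma law_total : m setT = 1%E.
Proof.
pose b := t k + 1.
have tb i : (1 <= i <= k)%N -> t i < b.
  by move=> hi; apply: (@le_lt_trans _ _ (t k)); [apply: (tle tinc); lia|rewrite ltrDl].
have Ab j : (2 <= j <= k)%N -> Av j < b.
  by move=> hj; apply: le_lt_trans (Av_bound tinc attach_ne hj) (tb _ _); lia.
have -> : setT = `]-oo, b[%classic `|` `[b, +oo[%classic :> set R.
  by apply/seteqP; split=> z //= _; rewrite !in_itv /= andbT; case: (ltP z b) => _; [left|right].
rewrite measureU_real //; last first.
  by apply/seteqP; split=> z //= []; rewrite !in_itv /= andbT ltNge => /negP.
rewrite law_ray [X in (_ + X)%E](_ : _ = 0%E) ?adde0.
  congr EFin; rewrite /FS (IS_top tinc attach_ne) ?mulr0 ?oppr0 ?expR0 ?mul1r; last by move=> i hi; exact/ltW/tb.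
  by rewrite big_nat_cond big_pred0 // => i; apply/negbTE/negP => /and3P[hi _]; rewrite leNgt tb.
rewrite hm cond_lawE integral0_eq ?add0e.
  rewrite big_nat_cond big_pred0 // => i; apply/negbTE/negP => /and3P[hi _ /asboolP] /=.
  by rewrite in_itv /= andbT leNgt tb.
move=> x /=; rewrite in_itv /= andbT => bx; congr EFin; rewrite /hS.
suff -> : ellw x = 0 by rewrite !mulr0.
have z u : u < b -> (x < u) = false by move=> ub; apply/negbTE; rewrite -leNgt; exact: ltW (lt_le_trans ub bx).
by rewrite /ellS big_nat_cond [X in _ - X%:R]big_nat_cond !big1 ?subrr // => i /andP[hi _]; rewrite z ?tb ?Ab.
Qed.

Lemma law_set1 a : m [set a] = (Fle a - Flt a)%:E.
Proof.
rewrite hm cond_lawE integral_set1 add0e sumEFin jump; congr EFin; apply: eq_bigl => i; congr (_ && _).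
by apply/asboolP/eqP.
Qed.

Lemma law_rayc a : m `]-oo, a]%classic = (Fle a)%:E.
Proof.
have -> : `]-oo, a]%classic = `]-oo, a[%classic `|` [set a] :> set R.
  apply/seteqP; split=> z /=; rewrite !in_itv /= le_eqVlt; first by case/orP=> [/eqP|]; [right|left].
  by case=> [->|->]; rewrite ?orbT ?eqxx.
rewrite measureU_real //; last by apply/seteqP; split=> z //= []; rewrite in_itv /= => h e; rewrite e ltxx in h.
by rewrite law_ray law_set1 -EFinD; congr EFin; ring.
Qed.

Lemma F_eqE a : F_eq n mu t k Av a = (Fle a - Flt a)%:E.
Proof.
rewrite jump /F_eq; case: asboolP => [[i [li e]]|no].
  have hi : i \in index_iota 1 k.+1 by rewrite mem_index_iota ltnS; case/andP: li.
  rewrite /F_le cdfE (ell_ellS lf tinc attach_ne tne) -EFinM; congr EFin.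
  rewrite big_mkcond (bigD1_seq i) ?iota_uniq //= li e eqxx /= big1_seq ?addr0; first by rewrite /cS e.
  move=> j /andP[ji jr]; case: andP => // -[_ /eqP ej].
  by move/eqP: ji; case; apply: live_uniq => //; rewrite ej e.
by rewrite big_pred0 // => i; apply/negbTE/negP => /andP[li /eqP e]; apply: no; exists i.
Qed.

End Path.

Section Conditioning.
Context {R : realType} {d : measure_display} {T : measurableType d}.
Variable P : probability T R.
Import HBNNSimple.

Lemma integral_eq_off_null (E N : set T) (f g : T -> \bar R) : measurable N -> P N = 0%E ->
  (forall w, ~ N w -> f w = g w) -> (\int[P]_(w in E) f w = \int[P]_(w in E) g w)%E.
Proof.
move=> mN N0 fg.
have H (f1 g1 : T -> \bar R) : (forall w, (0 <= f1 w)%E) -> (forall w, (0 <= g1 w)%E) ->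
    (forall w, ~ N w -> f1 w = g1 w) -> (\int[P]_w f1 w <= \int[P]_w g1 w)%E.
  move=> f0 g0 e; rewrite !ge0_integralTE //; apply: ge_ereal_sup => _ [h hf <-].
  apply: ereal_sup_ubound; exists (mul_nnsfun h (indic_nnsfun R (measurableC mN))).
    move=> w; change ((h w * \1_(~` N) w)%:E <= g1 w)%E; rewrite indicE.
    have [Nw|Nw] := pselect (N w); first by rewrite memNset ?mulr0 //=; apply.
    by rewrite mem_set // mulr1 -e.
  rewrite -!integralT_nnsfun; apply: ge0_ae_eq_integral => //.
  - by apply/measurable_EFinP; exact: measurable_funP.
  - by apply/measurable_EFinP; exact: measurable_funP.
  - by move=> w _; rewrite lee_fin; exact: fun_ge0.
  - by move=> w _; rewrite lee_fin; exact: fun_ge0.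
  - exists N; split=> // w /= h2; apply: contrapT => Nw; apply: h2 => _.
    by change ((h w * \1_(~` N) w)%:E = (h w)%:E); rewrite indicE mem_set // mulr1.
rewrite integral_mkcond [RHS]integral_mkcond integralE [RHS]integralE.
have e w : ~ N w -> (f \_ E) w = (g \_ E) w by move=> Nw; rewrite /patch fg.
by congr (_ - _)%E; apply/eqP; rewrite eq_le !H // => w Nw; rewrite ?funepos.unlock ?funeneg.unlock e.
Qed.

Lemma cond_prob_is_eq (G : set (set T)) (H N : set T) (F F' : T -> \bar R) : measurable N -> P N = 0%E ->
  (forall w, ~ N w -> F w = F' w) -> cond_prob_is P G H F' -> cond_prob_is P G H F.
Proof. by move=> mN N0 e h E GE; rewrite (integral_eq_off_null E mN N0 e); exact: h. Qed.

Lemma adde_cancel (x y z : \bar R) : x \is a fin_num -> (x + y = x + z)%E -> y = z.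
Proof.
move=> fx e; have -> : y = (y + x - x)%E by rewrite addeK.
by rewrite [(y + x)%E]addeC e [(x + z)%E]addeC addeK.
Qed.

Lemma measurable_semi_bigcup (T' : measurableType d) (m : {measure set T' -> \bar R}) (F : (set T')^nat) :
  (forall i, measurable (F i)) -> trivIset setT F -> m (\bigcup_i F i) = (\sum_(0 <= i <oo) m (F i))%E.
Proof.
move=> mF tF; apply/esym/cvg_lim => //; apply: measure_semi_sigma_additive => //; exact: bigcupT_measurable.
Qed.

Lemma prob_setU (A B : set T) : measurable A -> measurable B -> A `&` B = set0 -> P (A `|` B) = (P A + P B)%E.
Proof. by move=> mA mB AB; rewrite measureU. Qed.

Lemma pi_lambda_cond (H : set T) (f : T -> \bar R) (C : set (set T)) : measurable H ->
  measurable_fun setT f -> (forall w, (0 <= f w)%E) -> setI_closed C -> C setT ->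
  (forall E, C E -> measurable E /\ P (H `&` E) = (\int[P]_(w in E) f w)%E) ->
  forall E, <<s C >> E -> measurable E /\ P (H `&` E) = (\int[P]_(w in E) f w)%E.
Proof.
move=> mH mf f0 CI CT hC.
have compl (E : set T) : measurable E /\ P (H `&` E) = (\int[P]_(w in E) f w)%E ->
    measurable (~` E) /\ P (H `&` ~` E) = (\int[P]_(w in ~` E) f w)%E.
  move=> [mE eE]; have mE' := measurableC mE; split=> //.
  have [_ eT] := hC _ CT.
  apply: (@adde_cancel (P (H `&` E))); first by apply: fin_num_measure; exact: measurableI.
  rewrite -prob_setU //; [|exact: measurableI|exact: measurableI|]; last first.
    by apply/seteqP; split=> w //= [[_ h1] [_ h2]].
  rewrite -setIUr setUv eT eE -(setUv E) ge0_integral_setU //.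
  - by rewrite setUv.
  - exact/disj_setPCl.
have union (F : (set T)^nat) : trivIset setT F ->
    (forall i, measurable (F i) /\ P (H `&` F i) = (\int[P]_(w in F i) f w)%E) ->
    measurable (\bigcup_i F i) /\ P (H `&` \bigcup_i F i) = (\int[P]_(w in \bigcup_i F i) f w)%E.
  move=> tF hF; have mF i : measurable (F i) by have [] := hF i.
  split; first exact: bigcupT_measurable.
  rewrite setI_bigcupr measurable_semi_bigcup; first last.
  + by move=> i j _ _ [w [[_ h1] [_ h2]]]; apply: tF => //; exists w.
  + by move=> i; exact: measurableI.
  rewrite ge0_integral_bigcup //; last exact: measurable_funTS.
  by apply: eq_eseriesr => i _; have [] := hF i.
apply: (@dynkin_induction _ (g_sigma_algebraType C) C) => //.
- exact: hC.
- by move=> E _; exact: compl.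
- by move=> F _; exact: union.
Qed.

End Conditioning.

Section Disintegration.
Context {R : realType} {d : measure_display} {T : measurableType d}.
Variables (P : probability T R) (A : T -> R) (E : set T).
Hypothesis mA : measurable_fun setT A.
Hypothesis mE : measurable E.
Variable nu : T -> {measure set R -> \bar R}.
Hypothesis nuT : forall w, nu w setT = 1%E.
Hypothesis mnu : forall a, measurable_fun setT (fun w => nu w `]-oo, a[%classic).
Hypothesis law : forall a, P ([set w | `]-oo, a[%classic (A w)] `&` E) = (\int[P]_(w in E) nu w `]-oo, a[%classic)%E.

Lemma disintegration B : measurable B ->
  measurable_fun setT (fun w => nu w B) /\ P ([set w | B (A w)] `&` E) = (\int[P]_(w in E) nu w B)%E.
Proof.
have mpre (B' : set R) : measurable B' -> measurable ([set w | B' (A w)] `&` E).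
  by move=> mB; apply: measurableI => //; have := mA measurableT mB; rewrite setTI.
have gen : (@measurable _ (measurableTypeR R)) = <<s RGenInftyO.G (R := R) >> := RGenInftyO.measurableE R.
move=> mB; have {mB} : <<s RGenInftyO.G (R := R) >> B by rewrite -gen.
move: B; apply: (@dynkin_induction _ (measurableTypeR R) (RGenInftyO.G (R := R))
  (fun B => measurable_fun setT (fun w => nu w B) /\ P ([set w | B (A w)] `&` E) = (\int[P]_(w in E) nu w B)%E)) => //.
- move=> _ _ [x ->] [y ->]; exists (Num.min x y); apply/seteqP; split=> z /=; rewrite !in_itv /= lt_min.
    by move=> [-> ->].
  by move=> /andP[-> ->].
- split; first by under eq_fun do rewrite nuT; exact: measurable_cst.
  under eq_integral do rewrite nuT.
  by rewrite integral_cst // mul1e; congr (P _); apply/seteqP; split=> w //= [].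
- by move=> _ [x ->]; split; [exact: mnu|exact: law].
- move=> B mB [mf eB]; have mB' : measurable (~` B) := measurableC mB.
  have sum1 w : (nu w B + nu w (~` B) = 1)%E.
    by rewrite -measureU_real // ?setUv ?nuT ?setICr.
  have fB w : nu w B \is a fin_num.
    rewrite ge0_fin_numE //; apply: (@le_lt_trans _ _ 1%E); last exact: ltry.
    by rewrite -(sum1 w) leeDl.
  have mf' : measurable_fun setT (fun w => nu w (~` B)).
    rewrite (_ : (fun w => _) = (fun w => 1 - nu w B)%E); first exact: emeasurable_funB.
    by apply/funext => w; rewrite -(sum1 w) [X in (X - _)%E]addeC addeK.
  split=> //; apply: (@adde_cancel R (P ([set w | B (A w)] `&` E))).
    by apply: fin_num_measure; exact: mpre.
  rewrite -measureU; [|exact: mpre|exact: mpre|]; last first.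
    by apply/seteqP; split=> w //= [[h1 _] [h2 _]].
  rewrite eB -ge0_integralD //; [|exact: measurable_funTS|exact: measurable_funTS].
  under eq_integral do rewrite sum1.
  rewrite integral_cst // mul1e; congr (P _); apply/seteqP; split=> w /=; first by case=> -[].
  by move=> Ew; have [h|h] := pselect (B (A w)); [left|right].
- move=> F mF tF hF.
  have cv w : (\sum_(0 <= i < m) nu w (F i))%E @[m --> \oo] --> nu w (\bigcup_i F i).
    by apply: measure_semi_sigma_additive => //; exact: bigcupT_measurable.
  have eq w : nu w (\bigcup_i F i) = (\sum_(0 <= i <oo) nu w (F i))%E by apply/esym/cvg_lim => //; exact: cv.
  split.
    apply: (@emeasurable_fun_cvg _ _ _ _ (fun m w => \sum_(0 <= i < m) nu w (F i))%E) => [m|w _]; last exact: cv.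
    by apply: emeasurable_sum => i; have [] := hF i.
  under eq_integral do rewrite eq.
  rewrite integral_nneseries //; last by move=> i; apply: measurable_funTS; have [] := hF i.
  have -> : [set w | (\bigcup_i F i) (A w)] `&` E = \bigcup_i ([set w | F i (A w)] `&` E).
    apply/seteqP; split=> w /=; first by move=> [[i _ h] Ew]; exists i.
    by move=> [i _ [h Ew]]; split=> //; exists i.
  rewrite measurable_semi_bigcup; first last.
  + by move=> i j _ _ [w [[h1 _] [h2 _]]]; apply: tF => //; exists (A w).
  + by move=> i; exact: mpre (mF i).
  by apply: eq_eseriesr => i _; have [] := hF i.
Qed.

End Disintegration.

Lemma le_of_small (R : realFieldType) (x y K c : R) : 0 < c ->
  (forall e, 0 < e -> e <= c -> x <= y + K * e) -> x <= y.
Proof.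
move=> c0 h; rewrite leNgt; apply/negP => yx.
pose e := Num.min c ((x - y) / (2 * (`|K| + 1))).
have K0 : 0 <= `|K| by [].
have p0 : 0 < 2 * (`|K| + 1) by lra.
have e0 : 0 < e by rewrite lt_min c0 divr_gt0 // subr_gt0.
have ec : e <= c by rewrite ge_min lexx.
have : e <= (x - y) / (2 * (`|K| + 1)) by rewrite ge_min lexx orbT.
rewrite ler_pdivlMr // => h1; have := h _ e0 ec.
have : K * e <= `|K| * e by rewrite ler_pM2r // ler_norm.
by nra.
Qed.

Section Final.
Context {R : realType} {d : measure_display} {T : measurableType d}.
Variables (P : probability T R) (n : nat) (mu : R).
Variables (X Y : nat -> T -> R) (Mf Mb : nat -> T -> 'I_n * 'I_n) (S : nat -> T -> 'I_n).
Hypothesis mu0 : 0 < mu.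
Hypothesis n2 : (2 <= n)%N.
Hypothesis model : moran_model P mu X Y Mf Mb S.
Variable t : nat -> R.
Hypothesis tinc : forall i j, (1 <= i)%N -> (i < j)%N -> t i < t j.

Local Notation Ev := (events X Y Mf Mb).
Local Notation A w := (attach (Ev w) (S^~ w) t).
Local Notation prb := (prb P).

Let mas j c : measurable [set w | attach_set (Ev w) (S^~ w) t j c].
Proof.
exact: (measurable_attach_set t (model_mX model) (model_mY model) (model_mMf model) (model_mMb model) (model_mS model)).
Qed.

Let mA j : measurable_fun setT (fun w => A w j).
Proof.
exact: (measurable_attach t (model_mX model) (model_mY model) (model_mMf model) (model_mMb model) (model_mS model)).
Qed.

Let mcoal i j : measurable_fun setT (fun w => coal (Ev w) (S^~ w) t i j).
Proof.
exact: (measurable_coal t (model_mX model) (model_mY model) (model_mMf model) (model_mMb model) (model_mS model)).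
Qed.

Lemma mesh_bound k : exists2 c, 0 < c & forall e, 0 < e -> e <= c ->
  lam n mu * e * k.+1%:R <= 1 /\ mu * e <= 2^-1.
Proof.
have l0 : 0 < lam n mu := lam_gt0 mu0 n2.
have q0 : 0 < lam n mu * k.+1%:R by rewrite mulr_gt0.
exists (Num.min (lam n mu * k.+1%:R)^-1 (2 * mu)^-1).
  by rewrite lt_min !invr_gt0 q0 mulr_gt0.
move=> e e0; rewrite le_min => /andP[h1 h2]; split.
  by rewrite mulrAC -ler_pdivlMl // mulr1.
rewrite -ler_pdivlMl //; apply: le_trans h2 _.
by rewrite invfM mulrC.
Qed.

Lemma prb_unattached k a : (1 <= k)%N -> a <= t 1%N ->
  prb [set w | ~ attach_set (Ev w) (S^~ w) t k.+1 a] <= expR (- (th n mu (t 1%N - a))).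
Proof.
move=> k1 at1.
have [c c0 hc] := mesh_bound k.
have [len hlen] := grid_exists (special t k a [::]).
apply: (@le_of_small _ _ _ (mu ^+ 2 * len) c) => // e e0 ec.
have [s1 s2] := hc e e0 ec.
have [sg [N [Nf Hg]]] := hlen e e0.
have hL : forall c : nat * nat * R, c \in [::] -> (1 <= c.1.1)%N && (c.1.1 < c.1.2 <= k)%N by [].
have -> : [set w | ~ attach_set (Ev w) (S^~ w) t k.+1 a] = UE X Y Mf Mb S t k a [::].
  by apply/seteqP; split=> w /=; [split|case].
apply: le_trans (UE_small mu0 n2 model tinc hL Hg k1 s1 s2 at1) _.
rewrite lerD2l; have /andP[_] := mass_bound mu0 n2 model Hg.
by move=> h; apply: le_trans h _; rewrite le_eqVlt; apply/orP; left; apply/eqP; ring.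
Qed.

Lemma attach_null k : (1 <= k)%N ->
  prb [set w | forall m : nat, ~ attach_set (Ev w) (S^~ w) t k.+1 (- m%:R)] = 0.
Proof.
move=> k1.
have mS : measurable [set w | forall m : nat, ~ attach_set (Ev w) (S^~ w) t k.+1 (- m%:R)].
  by apply: measurable_forall => m; apply: measurable_notP.
apply/le_anti/andP; split; last exact: prb_ge0.
apply: (@le_of_small _ _ _ 1 1) => // e e0 _; rewrite add0r mul1r.
pose r := th n mu 1.
have nn : 0 < (n * n.-1)%:R :> R by rewrite ltr0n muln_gt0; lia.
have r0 : 0 < r by rewrite /r /th mulr1 divr_gt0.
pose x := Num.max 0 (Num.max (- ln e / r - t 1%N) (- t 1%N)).
have x0 : 0 <= x by rewrite le_max lexx.
have hm := archi_boundP x0; set m := Num.bound x in hm.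
have [h1 h2] : - ln e / r - t 1%N <= m%:R /\ - t 1%N <= m%:R.
  by split; apply: le_trans (ltW hm); rewrite !le_max lexx ?orbT.
have am : - m%:R <= t 1%N by rewrite lerNl.
apply: (@le_trans _ _ (prb [set w | ~ attach_set (Ev w) (S^~ w) t k.+1 (- m%:R)])).
  apply: prb_le => //; last by move=> w /=; apply.
  exact: (@measurable_notP _ _ (fun w => attach_set (Ev w) (S^~ w) t k.+1 (- m%:R))).
apply: le_trans (prb_unattached k1 am) _; rewrite -[leRHS]lnK ?posrE // ler_expR lerNl.
have -> : th n mu (t 1%N - - m%:R) = r * (m%:R + t 1%N) by rewrite /r /th; ring.
by rewrite mulrC -ler_pdivrMr //; lra.
Qed.

Local Notation Good k := [set w | Gd X Y Mf Mb S t k w].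

Lemma measurable_Gd k : measurable (Good k).
Proof.
apply: measurable_conj; first exact: (measurable_regular model).
apply: measurable_conj.
  by apply: measurable_forall => i; apply: measurable_notP; exact: (measurable_event_at model).
apply: measurable_forall => j; apply: measurable_impl; first exact: measurable_const.
by apply: measurable_exists => m.
Qed.

Lemma prb_Gd k : prb (~` Good k) = 0.
Proof.
pose B1 := ~` [set w | regular X Y w].
pose B2 := [set w | exists i, event_at X Y Mf Mb (t i) w].
pose B3 := [set w | exists j, forall m : nat, ~ attach_set (Ev w) (S^~ w) t j.+2 (- m%:R)].
have m1 : measurable B1 by apply: measurableC; exact: (measurable_regular model).
have m2 : measurable B2 by apply: measurable_exists => i; exact: (measurable_event_at model).
have m3j j : measurable [set w | forall m : nat, ~ attach_set (Ev w) (S^~ w) t j.+2 (- m%:R)].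
  by apply: measurable_forall => m; apply: measurable_notP.
have m3 : measurable B3 by exact: measurable_exists.
have z : prb (B1 `|` (B2 `|` B3)) = 0.
  apply: prb0_setU => //; [exact: measurableU|exact: (prb_regular mu0 model)|].
  apply: prb0_setU => //.
    by apply: null_exists => i; [exact: (measurable_event_at model)|exact: (prb_event_at mu0 n2 model)].
  by apply: null_exists => j //; exact: attach_null.
apply: null_sub z; [by apply: measurableC; exact: measurable_Gd|by apply: measurableU => //; exact: measurableU|].
move=> w /= ng; apply: contrapT => /not_orP[h1 /not_orP[h2 h3]]; apply: ng; split; first exact: contrapT h1.
split; first by move=> i ei; apply: h2; exists i.
move=> j hj; apply: contrapT => h4; apply: h3; exists j.-2 => m.
have -> : j.-2.+2 = j by lia.
by move=> h5; apply: h4; exists m.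
Qed.

Lemma Gd_sub k k' w : (k <= k')%N -> Gd X Y Mf Mb S t k' w -> Gd X Y Mf Mb S t k w.
Proof. by move=> kk [h1 [h2 h3]]; split=> //; split=> // j hj; apply: h3; lia. Qed.

Variable k : nat.
Hypothesis k1 : (1 <= k)%N.

Definition survival a w : R := FS n mu t k (A w) a (fun e => a <= e) * \1_(Good k.+1) w.

Lemma survival_bound a w : 0 <= survival a w <= 1.
Proof.
rewrite /survival indicE; have [g|g] := pselect (Good k.+1 w); last by rewrite memNset // mulr0 lexx ler01.
have g' := Gd_sub (leqnSn k) g; rewrite mem_set // mulr1.
exact: (FS_bound (Gd_lf g') tinc (Gd_ne g') (Gd_tne g') _ _ (ltW mu0)).
Qed.

Lemma bm_survival a : bm (survival a).
Proof.
split.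
  apply: measurable_funM; last by apply: measurable_indic; exact: measurable_Gd.
  apply: (@measurable_FS _ _ R n mu t k (fun w => A w) (fun=> a)) => // c.
  exact: measurable_const.
by exists 1 => w; have /andP[h0 h1] := survival_bound a w; rewrite ger0_norm.
Qed.

Definition valid (L : seq (nat * nat * R)) := forall c, c \in L -> (1 <= c.1.1)%N && (c.1.1 < c.1.2 <= k)%N.

Lemma core_exact a L : valid L -> prb (UE X Y Mf Mb S t k a L) =
  Ex P (fun w => survival a w * \1_(Eset X Y Mf Mb S t L) w).
Proof.
move=> hL.
have mE : measurable (Eset X Y Mf Mb S t L) := measurable_Eset model t L.
have bf : bm (fun w => survival a w * \1_(Eset X Y Mf Mb S t L) w).
  by apply: bmM; [exact: bm_survival|exact: bm_indic].
have [c c0 hc] := mesh_bound k.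
have [len hlen] := grid_exists (special t k a L).
apply/eqP; rewrite -subr_eq0 -normr_le0.
set K := (lam n mu * k.+1%:R) ^+ 2 + lam n mu * k.+1%:R * mu + 2 * mu ^+ 2.
apply: (@le_of_small _ _ _ (K * len) c) => // e e0 ec.
have [s1 s2] := hc e e0 ec.
have [sg [N [Nf Hg]]] := hlen e e0.
have := core_close mu0 n2 model tinc hL Hg k1 s1 s2 (measurable_Gd k.+1) (prb_Gd k.+1) _ bf.
have h1 : forall w, Good k.+1 w -> Gd X Y Mf Mb S t k w by move=> w; apply: Gd_sub.
move=> /(_ h1) h2; rewrite add0r.
have -> : K * len * e = K * (e * len) by ring.
apply: h2.
  move=> w; have /andP[f0 f1] := survival_bound a w.
  by rewrite indicE; case: (_ \in _); rewrite /= ?mulr0 ?mulr1 ?normr0 ?ler01 // ger0_norm.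
by move=> w g; rewrite /survival [\1_(Good k.+1) w]indicE mem_set // mulr1.
Qed.

Definition coalset (L : seq (nat * nat * R)) : set T :=
  [set w | forall c, c \in L -> c.2 <= coal (Ev w) (S^~ w) t c.1.1 c.1.2].

Lemma measurable_coalset L : measurable (coalset L).
Proof.
have -> : coalset L = [set w | forall i : nat, (i < size L)%N ->
    (nth (0%N, 0%N, 0) L i).2 <= coal (Ev w) (S^~ w) t (nth (0%N, 0%N, 0) L i).1.1 (nth (0%N, 0%N, 0) L i).1.2].
  apply/seteqP; split=> w /= h; first by move=> i iL; apply: h; exact: mem_nth.
  by move=> c /(nthP (0%N, 0%N, 0))[i iL <-]; exact: h.
apply: measurable_forall => i; apply: measurable_impl; first exact: measurable_const.
by apply: measurable_leS => //; exact: measurable_cst.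
Qed.

Lemma prb_eq_off_null (A1 A2 G : set T) : measurable A1 -> measurable A2 -> measurable G ->
  prb (~` G) = 0 -> (forall w, G w -> A1 w <-> A2 w) -> prb A1 = prb A2.
Proof.
move=> m1 m2 mG G0 h; have mG' := measurableC mG.
have z B : measurable B -> prb B = prb (B `&` G).
  move=> mB; rewrite (prbID P mB mG) [X in _ + X](_ : _ = 0) ?addr0 //.
  apply: null_sub G0 => //; first exact: measurableI.
rewrite (z A1) // (z A2) //; congr (prb _); apply/seteqP; split=> w /= [h1 h2]; split=> //.
  exact/(h w h2).
exact/(h w h2).
Qed.

Lemma survival_pi a L : valid L ->
  P ([set w | A w k.+1 < a] `&` coalset L) = (\int[P]_(w in coalset L) (survival a w)%:E)%E.
Proof.
move=> hL.
have mE : measurable (Eset X Y Mf Mb S t L) := measurable_Eset model t L.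
have mU : measurable (UE X Y Mf Mb S t k a L) := measurable_UE model t k a L.
have mC := measurable_coalset L.
have ma : measurable [set w | A w k.+1 < a] by apply: measurable_ltS => //; exact: measurable_cst.
pose NE := [set w | event_at X Y Mf Mb a w \/ exists i, event_at X Y Mf Mb (nth 0 [seq c.2 | c <- L] i) w].
have mex : measurable [set w | exists i, event_at X Y Mf Mb (nth 0 [seq c.2 | c <- L] i) w].
  by apply: measurable_exists => i; exact: (measurable_event_at model).
have mNE : measurable NE by apply: measurable_disj => //; exact: (measurable_event_at model).
have NE0 : prb NE = 0.
  have -> : NE = event_at X Y Mf Mb a `|` [set w | exists i, event_at X Y Mf Mb (nth 0 [seq c.2 | c <- L] i) w] by [].
  apply: prb0_setU => //; [exact: (measurable_event_at model)|exact: (prb_event_at mu0 n2 model)|].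
  by apply: null_exists => i; [exact: (measurable_event_at model)|exact: (prb_event_at mu0 n2 model)].
pose G := Good k.+1 `&` ~` NE.
have mG : measurable G by apply: measurableI; [exact: measurable_Gd|exact: measurableC].
have G0 : prb (~` G) = 0.
  rewrite /G setCI setCK; apply: prb0_setU => //; [by apply: measurableC; exact: measurable_Gd|exact: prb_Gd].
have eqa w : G w -> A w k.+1 < a <-> ~ attach_set (Ev w) (S^~ w) t k.+1 a.
  move=> [g nw]; have nea : nonevent (Ev w) a by apply: nonevent_event_at => h; apply: nw; left.
  have ne : attach_set (Ev w) (S^~ w) t k.+1 !=set0 by apply: (Gd_ne g); lia.
  have H := attach_ge (Gd_lf g) tinc ne nea.
  rewrite ltNge; split; first by move=> /negP h1 h2; apply: h1; apply/H.
  by move=> h1; apply/negP => h2; apply: h1; apply/H.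
have eqc w : G w -> coalset L w <-> Eset X Y Mf Mb S t L w.
  move=> [g nw].
  have H c : c \in L -> c.2 <= coal (Ev w) (S^~ w) t c.1.1 c.1.2 <-> meet (Ev w) (S^~ w) t c.1.1 c.1.2 c.2.
    move=> cL; have /andP[i1 /andP[ij jk]] := hL _ cL.
    apply: (coal_ge (Gd_lf g) tinc) => //.
      have g' := Gd_sub (leqnSn k) g.
      have h : (c.1.1 < c.1.2 <= k)%N by rewrite ij.
      exact: (coal_ne (Gd_lf g') (Gd_ne g') i1 h).
    apply: nonevent_event_at => h; apply: nw; right; exists (index c L).
    by rewrite (nth_map (0%N, 0%N, 0)) ?index_mem // nth_index.
  by split=> h c cL; apply/(H c cL); exact: h.
have -> : (\int[P]_(w in coalset L) (survival a w)%:E)%E = (Ex P (fun w => survival a w * \1_(coalset L) w))%:E.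
  rewrite integral_mkcond /Ex /Rintegral fineK.
    apply: eq_integral => w _; rewrite /patch indicE; case: (_ \in _); rewrite /= ?mulr1 ?mulr0 //.
  apply: integrable_fin_num => //; apply: bm_integrable; apply: bmM; [exact: bm_survival|exact: bm_indic].
rewrite (prbE P) //; last exact: measurableI.
congr EFin.
have bs := bm_survival a; have bC := @bm_indic _ _ _ (coalset L) mC.
have bE := @bm_indic _ _ _ _ mE.
transitivity (prb (UE X Y Mf Mb S t k a L)).
  apply: (prb_eq_off_null _ _ mG G0) => //; first exact: measurableI.
  by move=> w g; split=> -[h1 h2]; split; by [apply/(eqa w g)|apply/(eqc w g)].
rewrite core_exact // -(Ex_null _ mG G0); last exact: bmM.
rewrite -[RHS](Ex_null _ mG G0); last exact: bmM.
congr (Ex P _); apply/funext => w; rewrite [\1_G w]indicE.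
have [g|g] := pselect (G w); last by rewrite memNset ?mulr0.
congr (_ * _ * _); rewrite !indicE; congr (nat_of_bool _)%:R.
by apply/idP/idP; rewrite !inE => h; apply/(eqc w g).
Qed.

Definition coalsets : set (set T) := [set E | exists2 L, valid L & E = coalset L].

Lemma sigmaG_sub : sigmaG X Y Mf Mb S t k `<=` <<s coalsets >>.
Proof.
apply: smallest_sub; first exact: smallest_sigma_algebra.
move=> _ [i [j [B [i1 ij mB ->]]]].
have mc : @measurable_fun _ _ (g_sigma_algebraType coalsets) R setT (fun w => coal (Ev w) (S^~ w) t i j).
  apply: (@measurability _ _ (g_sigma_algebraType coalsets) (measurableTypeR R) setT _ (RGenCInfty.G (R := R)) (RGenCInfty.measurableE R)) => _ [_ [x ->] <-]; rewrite setTI.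
  apply: sub_sigma_algebra; exists [:: (i, j, x)].
    by move=> c; rewrite inE => /eqP ->; rewrite i1.
  apply/seteqP; split=> w /=; rewrite in_itv /= andbT.
    by move=> h c; rewrite inE => /eqP ->.
  by move=> h; apply: (h (i, j, x)); rewrite mem_head.
by have := mc measurableT B mB; rewrite setTI.
Qed.

Lemma survival_sigmaG a E : sigmaG X Y Mf Mb S t k E -> measurable E /\
  P ([set w | A w k.+1 < a] `&` E) = (\int[P]_(w in E) (survival a w)%:E)%E.
Proof.
move=> /sigmaG_sub; apply: pi_lambda_cond.
- by apply: measurable_ltS => //; exact: measurable_cst.
- by apply/measurable_EFinP; have [] := bm_survival a.
- by move=> w; rewrite lee_fin; have /andP[] := survival_bound a w.
- move=> _ _ [L hL ->] [L' hL' ->]; exists (L ++ L').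
    by move=> c; rewrite mem_cat => /orP[/hL|/hL'].
  apply/seteqP; split=> w /=.
    by move=> [h h'] c; rewrite mem_cat => /orP[/h|/h'].
  by move=> h; split=> c cL; apply: h; rewrite mem_cat cL ?orbT.
- by exists [::] => //; apply/seteqP; split.
- by move=> _ [L hL ->]; split; [exact: measurable_coalset|exact: survival_pi].
Qed.

Lemma path_law w : exists m : {measure set R -> \bar R}, [/\ m setT = 1%E,
  Good k.+1 w -> [/\ (forall B, m B = cond_law n mu t k (A w) B),
    (forall a, F_lt n mu t k (A w) a = m `]-oo, a[%classic),
    (forall a, F_le n mu t k (A w) a = m `]-oo, a]%classic) & (forall a, F_eq n mu t k (A w) a = m [set a])] &
  forall a, m `]-oo, a[%classic = (survival a w + ((0 < a)%R : bool)%:R * \1_(~` Good k.+1) w)%:E].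
Proof.
have [g|g] := pselect (Good k.+1 w).
  have g' := Gd_sub (leqnSn k) g; have lf := Gd_lf g'; have ne := Gd_ne g'; have tn := Gd_tne g'.
  have [m hm] := cond_law_measure lf tinc ne tn mu0 n2.
  exists m; split.
  - exact: (law_total lf tinc ne tn mu0 n2 k1 hm).
  - move=> _; split=> // a.
    + by rewrite (law_ray lf tinc ne tn mu0 n2 k1 hm) /F_lt (cdfE mu lf tinc ne tn).
    + by rewrite (law_rayc lf tinc ne tn mu0 n2 k1 hm) /F_le (cdfE mu lf tinc ne tn).
    + by rewrite (law_set1 lf tinc ne tn hm) (F_eqE mu lf tinc ne tn).
  - move=> a; rewrite (law_ray lf tinc ne tn mu0 n2 k1 hm) /survival.
    have -> : \1_(Good k.+1) w = 1 :> R by rewrite indicE mem_set.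
    have -> : \1_(~` Good k.+1) w = 0 :> R by rewrite indicE memNset // => h; exact: h.
    by rewrite mulr1 mulr0 addr0.
exists (\d_(0 : R)); split; [exact: diracT|by move=> /g|move=> a].
rewrite /survival.
have -> : \1_(Good k.+1) w = 0 :> R by rewrite indicE memNset.
have -> : \1_(~` Good k.+1) w = 1 :> R by rewrite indicE mem_set.
rewrite mulr0 add0r mulr1; have dE := @diracE _ (measurableTypeR R) R 0 `]-oo, a[%classic.
by apply: etrans dE _; rewrite mem_setE in_itv.
Qed.

Theorem sampled_moran_conditional_law :
  let G := sigmaG X Y Mf Mb S t k in
  (forall a : R,
     [/\ cond_prob_is P G [set w | A w k.+1 < a] (fun w => F_lt n mu t k (A w) a),
         cond_prob_is P G [set w | A w k.+1 <= a] (fun w => F_le n mu t k (A w) a) &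
         cond_prob_is P G [set w | A w k.+1 = a] (fun w => F_eq n mu t k (A w) a)]) /\
  (forall B : set R, measurable B ->
     cond_prob_is P G [set w | B (A w k.+1)] (fun w => cond_law n mu t k (A w) B)).
Proof.
move=> G; have [nu hnu] := choice path_law.
have mN : measurable (~` Good k.+1) by apply: measurableC; exact: measurable_Gd.
have N0 : P (~` Good k.+1) = 0%E by rewrite (prbE P) // prb_Gd.
have mnu a : measurable_fun setT (fun w => nu w `]-oo, a[%classic).
  have -> : (fun w => nu w `]-oo, a[%classic) =
      EFin \o (fun w => survival a w + ((0 < a)%R : bool)%:R * \1_(~` Good k.+1) w).
    by apply/funext => w /=; have [_ _ ->] := hnu w.
  apply/measurable_EFinP; apply: measurable_funD; first by have [] := bm_survival a.
  by apply: measurable_funM => //; exact: measurable_indic.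
have key B : measurable B -> cond_prob_is P G [set w | B (A w k.+1)] (fun w => nu w B).
  move=> mB E GE; have [mE _] := survival_sigmaG 0 GE.
  have nT w : nu w setT = 1%E by have [] := hnu w.
  have law a : P ([set w | `]-oo, a[%classic (A w k.+1)] `&` E) = (\int[P]_(w in E) nu w `]-oo, a[%classic)%E.
    have -> : [set w | `]-oo, a[%classic (A w k.+1)] = [set w | A w k.+1 < a].
      by apply/seteqP; split=> w /=; rewrite in_itv.
    have [_ ->] := survival_sigmaG a GE; apply: (integral_eq_off_null _ mN N0) => w ng.
    have gw : Good k.+1 w by exact: contrapT ng.
    by have [_ _ ->] := hnu w; rewrite [\1_(~` _) w]indicE memNset ?mulr0 ?addr0 //; apply.
  by have [_ ->] := disintegration (mA k.+1) mE nT mnu law mB.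
have good w : ~ (~` Good k.+1) w -> Good k.+1 w by exact: contrapT.
split=> [a|B mB]; last first.
  by apply: (cond_prob_is_eq mN N0 _ (key B mB)) => w /good g; have [_ /(_ g)[h _ _ _] _] := hnu w; rewrite h.
split.
- have -> : [set w | A w k.+1 < a] = [set w | `]-oo, a[%classic (A w k.+1)].
    by apply/seteqP; split=> w /=; rewrite in_itv.
  apply: (cond_prob_is_eq mN N0 _ (key _ _)) => // w /good g.
  by have [_ /(_ g)[_ h _ _] _] := hnu w; exact: h.
- have -> : [set w | A w k.+1 <= a] = [set w | `]-oo, a]%classic (A w k.+1)].
    by apply/seteqP; split=> w /=; rewrite in_itv.
  apply: (cond_prob_is_eq mN N0 _ (key _ _)) => // w /good g.
  by have [_ /(_ g)[_ _ h _] _] := hnu w; exact: h.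
- apply: (cond_prob_is_eq mN N0 _ (key [set a] _)) => // w /good g.
  by have [_ /(_ g)[_ _ _ h] _] := hnu w; exact: h.
Qed.

End Final.

Theorem theorem3 (R : realType) (d : measure_display) (T : measurableType d)
    (P : probability T R) (n : nat) (mu : R) (t : nat -> R)
    (X Y : nat -> T -> R) (Mf Mb : nat -> T -> 'I_n * 'I_n) (S : nat -> T -> 'I_n)
    (k : nat) :
  (2 <= n)%nat -> 0 < mu ->
  (forall i j, (1 <= i)%nat -> (i < j)%nat -> t i < t j) ->
  moran_model P mu X Y Mf Mb S ->
  (1 <= k)%nat ->
  let A := fun w => attach (events X Y Mf Mb w) (S^~ w) t in
  let G := sigmaG X Y Mf Mb S t k in
  (forall a : R,
     [/\ cond_prob_is P G [set w | A w k.+1 < a] (fun w => F_lt n mu t k (A w) a),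
         cond_prob_is P G [set w | A w k.+1 <= a] (fun w => F_le n mu t k (A w) a) &
         cond_prob_is P G [set w | A w k.+1 = a] (fun w => F_eq n mu t k (A w) a)]) /\
  (forall B : set R, measurable B ->
     cond_prob_is P G [set w | B (A w k.+1)] (fun w => cond_law n mu t k (A w) B)).
Proof.
move=> n2 mu0 tinc model k1 A G.
exact: sampled_moran_conditional_law.
Qed.
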